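(* Let $\Lambda$ be a set of points in $\{z\in\mathbb{C}: \operatorname{Im} z<0\}$. If $\Lambda$ satisfies the classical Blaschke condition $$\sum_{\lambda\in\Lambda}\frac{|\operatorname{Im}\lambda|}{1+|\lambda|^2}<\infty$$ and for some $C>0$ we have $\Lambda\subset\{z\in\mathbb{C}: -\operatorname{Im} z\ge C|\operatorname{Re} z|\}$, then there exists a real-valued $q\in L^1(\mathbb{R}_+)$ with compact support such that $\Lambda\subset\operatorname{Res}(q)$.
   Context: $\mathbb{R}_+=[0,+\infty)$. For a real-valued compactly supported $q\in L^1(\mathbb{R}_+)$, consider the one-dimensional Schrödinger operator $-\frac{d^2}{dx^2}+q(x)$ on $\mathbb{R}_+$. For $k\in\mathbb{C}$, its Jost solution $\psi(k,x)$ is the unique solution of $-\psi''(k,x)+q(x)\psi(k,x)=k^2\psi(k,x)$, $x\ge 0$ (derivatives in $x$), that satisfies $\psi(k,x)=e^{ikx}$ for all large $x$. The Jost function is $w(k)=\psi(k,0)$; it is an entire function of $k$. The resonances are the zeros of $w$ in the open lower half-plane $\{z:\operatorname{Im} z<0\}$, and $\operatorname{Res}(q)$ denotes the set of resonances; strictly speaking it is a multiset, in which the multiplicity of each resonance equals the multiplicity of the corresponding zero of $w$.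
   Formalization: The set Λ is additionally assumed to have no accumulation point in the complex plane; without this the claim fails, e.g. for Λ = {-i/2^n}, since the Jost function is entire and not identically zero. *)

(* Defs.v *)
From HB Require Import structures.
From mathcomp Require Import all_boot all_order all_algebra.
From mathcomp Require Import complex.
From mathcomp Require Import all_classical all_reals all_analysis.

Set Implicit Arguments.
Unset Strict Implicit.
Unset Printing Implicit Defensive.

Import Order.TTheory GRing.Theory Num.Theory.
Import numFieldNormedType.Exports.

Local Open Scope classical_set_scope.
Local Open Scope ring_scope.
Local Open Scope complex_scope.

Section complex_valued.
Variable R : realType.
Implicit Types (f : R -> R[i]) (g : R -> R) (a b x : R) (z : R[i]).

Definition re z : R := complex.Re z.
Definition im z : R := complex.Im z.

(* `|z| itself lives in R[i]; this is the modulus as an element of R. *)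
Definition cmod z : R := ComplexField.Normc.normc z.

Definition cexp z : R[i] := (expR (re z))%:C * (cos (im z) +i* sin (im z)).

(* Degenerate intervals (u i = v i) are allowed and contribute nothing. *)
Definition abs_continuous a b g : Prop :=
  forall e : R, 0 < e -> exists2 d : R, 0 < d &
    forall (n : nat) (u v : 'I_n -> R),
      (forall i, [/\ a <= u i, u i <= v i & v i <= b]) ->
      trivIset setT (fun i => `]u i, v i[%classic) ->
      \sum_(i < n) (v i - u i) < d ->
      \sum_(i < n) `|g (v i) - g (u i)| < e.

Definition locally_abs_continuous f : Prop :=
  forall b, 0 < b -> abs_continuous 0 b (re \o f) /\
                     abs_continuous 0 b (im \o f).

(* f : R -> C has derivative z at the real point x. *)
Definition has_derivative f x z : Prop :=
  is_derive x 1 (re \o f) (re z) /\ is_derive x 1 (im \o f) (im z).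

End complex_valued.

Section schroedinger.
Variable R : realType.
Implicit Types (q : R -> R) (k : R[i]) (psi : R -> R[i]).

Local Notation mu := (@lebesgue_measure R).

(* Functions on R_+ are represented by functions on R whose values at negative
   arguments are irrelevant. *)
Definition compactly_supported_L1 q : Prop :=
  mu.-integrable `[0, +oo[ (EFin \o q) /\
  compact (closure [set x | 0 <= x /\ q x != 0]).

(* As q is only integrable, - psi'' + q psi = k^2 psi is understood in the
   usual (Caratheodory) sense: psi and psi' are locally absolutely continuous
   on [0, +oo[ and the equation holds almost everywhere. *)
Definition schroedinger_solution q k psi : Prop :=
  exists dpsi : R -> R[i],
    [/\ locally_abs_continuous psi,
        forall x : R, 0 < x -> has_derivative psi x (dpsi x),
        locally_abs_continuous dpsi &
        {ae mu, forall x : R, 0 < x ->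
           exists2 ddpsi : R[i], has_derivative dpsi x ddpsi &
             - ddpsi + (q x)%:C * psi x = k ^+ 2 * psi x}].

Definition is_jost_solution q k psi : Prop :=
  schroedinger_solution q k psi /\
  \forall x \near +oo, psi x = cexp ('i%C * k * x%:C).

(* Definite description: the Jost solution exists and is unique on [0, +oo[ for
   every k when q is integrable with compact support.  Since the default is
   nowhere zero, it cannot create spurious resonances. *)
Definition jost_solution q k : R -> R[i] :=
  xget (cst 1) [set psi | is_jost_solution q k psi].

Definition jost_function q k : R[i] := jost_solution q k 0.

(* The underlying set of the multiset of resonances: a point belongs to the
   multiset iff the Jost function vanishes there, to any order. *)
Definition Res q : set R[i] :=
  [set k | im k < 0 /\ jost_function q k = 0].

End schroedinger.

Section point_sets.
Variable R : realType.
Implicit Types (L : set R[i]).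

Definition blaschke L : Prop :=
  (\esum_(l in L) (`|im l| / (1 + cmod l ^+ 2))%:E < +oo)%E.

(* L has no accumulation point in C.  For subsets of a cone
   { - Im z >= C |Re z| } satisfying the Blaschke condition this only excludes
   accumulation at 0, e.g. L = { - i / 2 ^ n }, which satisfies both conditions
   but is not contained in the zero set of any entire function other than 0. *)
Definition locally_finite L : Prop :=
  forall r : R, finite_set (L `&` [set z | cmod z <= r]).

End point_sets.

(* Main.v *)
(* Write s = 2ik. If g is a sufficiently small continuous function supported in [0, c]
   whose transform int_0^c g(t) e^{st} dt equals s A(s) with A(s) = int_0^c A(t) e^{st}
   dt, i.e. g = - A', then a contraction argument for the Marchenko (Gelfand-Levitan)
   equations produces a continuous q supported in [0, c] with Jost function 1 + A(s).
   Small data suffice: since Re s > 0 at the points of Lambda, e^{st} is large there,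
   and a small A with a long support can satisfy A(s) = -1.

   The zeros are produced in dyadic blocks, those with |s| ~ 2^j, n_j in number. Let u
   be the transform of a smooth probability density supported at distance ~ 2^-j from 0,
   so that |u| >= 8 on the block, and let Q be a polynomial with real coefficients and
   constant term 1 that vanishes at the values of u on the block. Multiplying Q by the
   truncation of 1 / Q at order N gives 1 + u^N p(u) with p of size 6^{n_j} / 2^N,
   regardless of how close the points of the block are to each other. This is 1 plus the
   transform of a function supported in an interval of length ~ (N + n_j) / 2^j. With N
   = 3 n_j + 5 j + L, the Blaschke condition, which in a cone reads sum n_j / 2^j < oo,
   makes the total length finite and linear in L, while the size of the product over all
   blocks is O(2^-L). *)

Require Import Defs.
From mathcomp Require Import all_boot all_order all_algebra.
From mathcomp Require Import complex.
From mathcomp Require Import all_classical all_reals all_analysis.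
From mathcomp Require Import ring lra zify.

Set Implicit Arguments.
Unset Strict Implicit.
Unset Printing Implicit Defensive.

Import Order.TTheory GRing.Theory Num.Theory.
Import numFieldNormedType.Exports.

Local Open Scope classical_set_scope.
Local Open Scope ring_scope.
Local Open Scope complex_scope.

(** * Integrals of continuous functions as increments of primitives *)

Section primitives.
Context {R : realType}.
Implicit Types (f g F : R -> R) (a b x y : R).

(** Only an inclusion in [Res q] is claimed, so a factor that vanishes on its own block may have any
    further zeros, and the blocks are treated independently before their factors are multiplied.
    Reality of [q] forces real densities; this is why the roots of Q come in conjugate pairs. The
    potential and the kernel of the Jost solution are solved for together, as one fixed point. The
    contraction condition is quadratic in the length of the support and linear in the size of [g],
    so exponential decay of the size pays for linear growth of the support. All functions in the
    construction are continuous, so integrals are increments of primitives and Fubini's theorem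
    follows from the uniqueness of primitives. The exception is the uniqueness of the Jost solution:
    [jost_function] is a definite description over Caratheodory solutions, whose derivatives are
    only absolutely continuous, and the solution built here has to be compared with an arbitrary one
    of that class. *)

Lemma is_derive_epsP F x d : is_derive x (1 : R) F d <->
  (forall e, 0 < e -> exists2 r : R, 0 < r &
    forall y, `|y - x| < r -> `|F y - F x - d * (y - x)| <= e * `|y - x|).
Proof.
split.
  move=> dF e e0.
  have := @ex_derive _ _ _ _ _ _ _ dF.
  have dv := @derive_val _ _ _ _ _ _ _ dF.
  rewrite /derivable => cv.
  have {cv} : (fun h => h^-1 *: ((F \o shift x) (h *: (1:R)) - F x)) @ 0^' --> d.
    by rewrite -dv.
  move/cvgrPdist_le => /(_ _ e0); rewrite near_withinE /= => /nbhs_ballP[r /= r0 H].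
  exists r => // y yx; have [->|xy] := eqVneq y x.
    by rewrite !subrr mulr0 subrr normr0 mulr0.
  have yx0 : y - x != 0 by rewrite subr_eq0.
  have := H (y - x); rewrite /ball /= sub0r normrN => /(_ yx yx0).
  rewrite /shift /= [_%:A]mulr1 subrK [_ *: _]mulrC => Hd.
  have -> : F y - F x - d * (y - x) = - ((d - (F y - F x) / (y - x)) * (y - x)).
    by field.
  by rewrite normrN normrM ler_wpM2r.
move=> H.
have cv : (fun h => h^-1 *: ((F \o shift x) (h *: (1:R)) - F x)) @ 0^' --> d.
  apply/cvgrPdist_le => e e0; rewrite near_withinE /=.
  have [r r0 {}H] := H _ e0.
  apply/nbhs_ballP; exists r => //= h; rewrite /ball /= sub0r normrN => hr h0.
  rewrite /shift /= [_%:A]mulr1 [_ *: _]mulrC.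
  have := H (h + x); rewrite addrK => /(_ hr).
  have -> : d - (F (h + x) - F x) / h = - ((F (h + x) - F x - d * h) / h).
    by field.
  by rewrite normrN normrM normfV ler_pdivrMr ?normr_gt0.
apply: DeriveDef; first by apply/cvg_ex; exists d.
exact: cvg_lim cv.
Qed.

Lemma is_derive_continuous F x d : is_derive x (1 : R) F d -> {for x, continuous F}.
Proof.
move=> dF; apply: differentiable_continuous; apply/derivable1_diffP.
exact: (@ex_derive _ _ _ _ _ _ _ dF).
Qed.

Lemma derive_bound F f a b m M : a <= b ->
  (forall x, a <= x <= b -> is_derive x (1 : R) F (f x)) ->
  (forall x, a <= x <= b -> m <= f x <= M) ->
  m * (b - a) <= F b - F a <= M * (b - a).
Proof.
move=> ab dF fmM.
have [||c] := @MVT_segment _ F f a b ab.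
- by move=> x; rewrite in_itv/= => /andP[ax xb]; apply: dF; rewrite !ltW.
- apply: derivable_within_continuous => x; rewrite in_itv/= => axb.
  exact: (@ex_derive _ _ _ _ _ _ _ (dF _ axb)).
rewrite in_itv/= => /fmM /andP[mf fM] ->.
by rewrite !ler_wpM2r// subr_ge0.
Qed.

Lemma derive_norm_bound F f a b M : a <= b ->
  (forall x, a <= x <= b -> is_derive x (1 : R) F (f x)) ->
  (forall x, a <= x <= b -> `|f x| <= M) -> `|F b - F a| <= M * (b - a).
Proof.
move=> ab dF fM; rewrite ler_norml -mulNr; apply: (derive_bound ab dF) => x xab.
by rewrite -ler_norml fM.
Qed.

Lemma is_derive_unique F G f a : (forall x, is_derive x (1 : R) F (f x)) ->
  (forall x, is_derive x (1 : R) G (f x)) -> F a = G a -> F = G.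
Proof.
move=> dF dG FGa; apply/funext => x; apply/eqP; rewrite -subr_eq0.
have dFG y : is_derive y (1 : R) (F - G) 0.
  by have := is_deriveB (dF y) (dG y); rewrite subrr.
have := is_derive_0_is_cst x a dFG.
by rewrite !fctE FGa subrr => ->.
Qed.

(* The Lebesgue integral from -1 is constant to the left of 0, hence a primitive on the
   whole line. *)
Lemma ex_prim_right f : continuous f -> (forall x, x <= 0 -> f x = 0) ->
  exists F, forall x, is_derive x (1 : R) F (f x).
Proof.
move=> cf f0.
pose F x := (\int[lebesgue_measure]_(t in `[(-1 : R), x]) f t)%R.
have Fneg x : x < 0 -> F x = 0.
  move=> x0; rewrite /F (@eq_Rintegral _ _ _ _ _ (cst 0)); last first.
    by move=> t; rewrite inE/= in_itv/= => /andP[_ tx]; rewrite f0// (le_trans tx) ?ltW.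
  by rewrite /Rintegral integral0.
exists F => x; have [x0|x0] := ltP x 0.
  rewrite f0 ?ltW//; apply/is_derive_epsP => e e0; exists (- x); first by lra.
  move=> y; rewrite ltr_norml => /andP[_ yx]; rewrite !Fneg; [|lra|lra].
  by rewrite mul0r !subrr normr0 mulr_ge0// ltW.
have x1 : x < x + 1 by rewrite ltrDl.
have fi : lebesgue_measure.-integrable `[-1, x + 1] (EFin \o f).
  apply: continuous_compact_integrable; first exact: segment_compact.
  by apply: continuous_subspaceT.
have x1' : -1 < x by apply: lt_le_trans x0; rewrite oppr_lt0.
have [d1 d2] := continuous_FTC1_closed x1 fi x1' (cf x).
apply: DeriveDef; first exact: d1.
by rewrite -derive1E.
Qed.

Lemma is_derive_scale k x : is_derive x (1 : R) (fun y => k * y) k.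
Proof.
have := @is_deriveM _ _ (fun=> k) (fun y : R => y) x 1 0 1 (is_derive_cst _ _ _) (is_derive_id _ _).
by move=> h; apply: (is_derive_eq h); rewrite /cst/= [_ *: 1]mulr1 scaler0 addr0.
Qed.

Lemma is_derive_mul F G x d e : is_derive x (1 : R) F d -> is_derive x (1 : R) G e ->
  is_derive x (1 : R) (fun y => F y * G y) (d * G x + F x * e).
Proof.
move=> dF dG; apply: (is_derive_eq (is_deriveM dF dG)).
by rewrite addrC; congr (_ + _); exact: mulrC.
Qed.

(** Splitting [f - f 0] at the origin and reflecting the left half gives two functions that vanish
    on the negative half-line, where [ex_prim_right] applies; the constant [f 0] contributes a
    linear term. *)
Lemma ex_prim f : continuous f -> exists F, F 0 = 0 /\
   forall x, is_derive x (1 : R) F (f x).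
Proof.
move=> cf.
have cmax : continuous (fun x : R => Num.max x 0).
  by move=> x; apply: continuous_max; [exact: cvg_id|exact: cvg_cst].
pose fr x := f (Num.max x 0) - f 0.
have cfr : continuous fr.
  move=> x; apply: continuousB; last exact: cvg_cst.
  by apply: continuous_comp; [exact: cmax|exact: cf].
pose fl x := f (- Num.max x 0) - f 0.
have cfl : continuous fl.
  move=> x; apply: continuousB; last exact: cvg_cst.
  apply: (@continuous_comp _ _ _ (fun x => - Num.max x 0) f); last exact: cf.
  by apply: continuousN; exact: cmax.
have [A dA] : exists F, forall x, is_derive x (1 : R) F (fr x).
  by apply: ex_prim_right => // x x0; rewrite /fr max_r// subrr.
have [B dB] : exists F, forall x, is_derive x (1 : R) F (fl x).
  by apply: ex_prim_right => // x x0; rewrite /fl max_r// oppr0 subrr.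
pose F x := A x - B (- x) + f 0 * x.
have dF x : is_derive x (1 : R) F (f x).
  have dN : is_derive x (1 : R) (fun y : R => - y) (-1) by apply: is_deriveN.
  have dBN : is_derive x (1 : R) (B \o -%R) (fl (- x) * -1).
    by apply: is_derive1_comp.
  have dl : is_derive x (1 : R) (fun y => f 0 * y) (f 0).
    exact: is_derive_scale.
  have h := is_deriveD (is_deriveB (dA x) dBN) dl.
  apply: (is_derive_eq h).
  rewrite /fr /fl; have [x0|x0] := leP 0 x.
    by rewrite max_r ?oppr_le0// oppr0; ring.
  by rewrite max_l ?oppr_ge0 ?ltW// opprK; ring.
exists (fun x => F x - F 0); split; first by rewrite subrr.
move=> x; have := is_deriveB (dF x) (is_derive_cst (F 0) x 1).
by rewrite subr0.
Qed.

(* Oriented integrals for free: [int a b f] makes sense for [b < a]. Both are junk when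
   [f] has no primitive vanishing at 0. *)
Definition prim f : R -> R :=
  xget (cst 0) [set F | F 0 = 0 /\ forall x, is_derive x (1 : R) F (f x)].

Definition int a b f := prim f b - prim f a.

Lemma primP f : continuous f -> forall x, is_derive x (1 : R) (prim f) (f x).
Proof.
move=> cf; rewrite /prim; case: xgetP => [F _ []//|].
by have [F HF] := ex_prim cf => /(_ F).
Qed.

Lemma int_FTC F f a b : (forall x, is_derive x (1 : R) F (f x)) ->
  continuous f -> int a b f = F b - F a.
Proof.
move=> dF cf; rewrite /int.
have -> : F = (fun x => prim f x + (F a - prim f a)).
  apply: (@is_derive_unique _ _ f a) => //; last by ring.
  move=> x; have := is_deriveD (primP cf x) (is_derive_cst (F a - prim f a) x 1).
  by rewrite addr0.
by ring.
Qed.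

Lemma int_chasles a b c f : int a b f + int b c f = int a c f.
Proof. by rewrite /int; ring. Qed.

Lemma int_xx a f : int a a f = 0.
Proof. exact: subrr. Qed.

Lemma int_swap a b f : int b a f = - int a b f.
Proof. by rewrite /int opprB. Qed.

Lemma int_derive a f x : continuous f -> is_derive x (1 : R) (int a ^~ f) (f x).
Proof.
move=> cf; have := is_deriveB (primP cf x) (is_derive_cst (prim f a) x 1).
by rewrite subr0.
Qed.

Lemma int_norm_bound M a b f : continuous f -> a <= b ->
  (forall x, a <= x <= b -> `|f x| <= M) -> `|int a b f| <= M * (b - a).
Proof. by move=> cf ab; apply: derive_norm_bound => // x _; exact: primP. Qed.

Lemma cont_cst (T : topologicalType) (k : R) : continuous (fun _ : T => k).
Proof. by move=> x; exact: cvg_cst. Qed.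

Lemma cont_add (T : topologicalType) (f g : T -> R) : continuous f -> continuous g ->
  continuous (fun t => f t + g t).
Proof. by move=> cf cg t; apply: continuousD; [exact: cf|exact: cg]. Qed.

Lemma cont_opp (T : topologicalType) (f : T -> R) : continuous f ->
  continuous (fun t => - f t).
Proof. by move=> cf t; apply: continuousN; exact: cf. Qed.

Lemma cont_sub (T : topologicalType) (f g : T -> R) : continuous f -> continuous g ->
  continuous (fun t => f t - g t).
Proof. by move=> cf cg t; apply: continuousB; [exact: cf|exact: cg]. Qed.

Lemma cont_mul (T : topologicalType) (f g : T -> R) : continuous f -> continuous g ->
  continuous (fun t => f t * g t).
Proof. by move=> cf cg t; apply: continuousM; [exact: cf|exact: cg]. Qed.

Lemma cont_comp (T U V : topologicalType) (f : T -> U) (g : U -> V) :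
  continuous f -> continuous g -> continuous (fun t => g (f t)).
Proof. by move=> cf cg t; apply: continuous_comp; [exact: cf|exact: cg]. Qed.

Lemma cont_norm (T : topologicalType) (f : T -> R) : continuous f ->
  continuous (fun t => `|f t|).
Proof. by move=> cf; apply: cont_comp cf _; exact: norm_continuous. Qed.

Lemma cont_id (T : topologicalType) : continuous (fun t : T => t).
Proof. by move=> x; exact: cvg_id. Qed.

Lemma cont_pair (T U V : topologicalType) (f : T -> U) (g : T -> V) :
  continuous f -> continuous g -> continuous (fun t => (f t, g t)).
Proof. by move=> cf cg t; apply: cvg_pair; [exact: cf|exact: cg]. Qed.

Lemma cont_fst (T U : topologicalType) : continuous (fun p : T * U => p.1).
Proof. by move=> p; exact: cvg_fst. Qed.

Lemma cont_snd (T U : topologicalType) : continuous (fun p : T * U => p.2).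
Proof. by move=> p; exact: cvg_snd. Qed.

Lemma intD a b f g : continuous f -> continuous g ->
  int a b (fun x => f x + g x) = int a b f + int a b g.
Proof.
move=> cf cg.
have dF x := is_deriveD (primP cf x) (primP cg x).
by rewrite (int_FTC _ _ dF) ?/int ?fctE; [ring|exact: cont_add].
Qed.

Lemma intZ a b k f : continuous f ->
  int a b (fun x => k * f x) = k * int a b f.
Proof.
move=> cf.
have dF x := is_deriveZ k (primP cf x).
rewrite (int_FTC _ _ dF) ?/int ?fctE; first by rewrite -mulrBr.
by apply: cont_mul => //; exact: cont_cst.
Qed.

Lemma intN a b f : continuous f -> int a b (fun x => - f x) = - int a b f.
Proof.
move=> cf; rewrite -mulN1r -intZ//; congr int.
by apply/funext => x; rewrite mulN1r.
Qed.

Lemma intB a b f g : continuous f -> continuous g ->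
  int a b (fun x => f x - g x) = int a b f - int a b g.
Proof. by move=> cf cg; rewrite intD ?intN//; exact: cont_opp. Qed.

Lemma int_cst a b k : int a b (fun=> k) = k * (b - a).
Proof.
rewrite (int_FTC _ _ (is_derive_scale k)); first by rewrite mulrBr.
exact: cont_cst.
Qed.

Lemma eq_int a b f g : continuous f -> continuous g -> a <= b ->
  (forall x, a <= x <= b -> f x = g x) -> int a b f = int a b g.
Proof.
move=> cf cg ab fg; apply/eqP; rewrite -subr_eq0 -normr_le0 -intB//.
rewrite -(mul0r (b - a)); apply: int_norm_bound => //; first exact: cont_sub.
by move=> x /fg ->; rewrite subrr normr0.
Qed.

Lemma int_ge0 a b f : continuous f -> a <= b ->
  (forall x, a <= x <= b -> 0 <= f x) -> 0 <= int a b f.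
Proof.
move=> cf ab f0; rewrite -(mul0r (b - a)).
have -> : int a b f = prim f b - prim f a by [].
have [c] := @MVT_segment _ (prim f) f a b ab (fun x _ => primP cf x)
  (derivable_within_continuous (fun x _ => @ex_derive _ _ _ _ _ _ _ (primP cf x))).
by rewrite in_itv/= => /f0 fc ->; rewrite mul0r mulr_ge0// subr_ge0.
Qed.

Lemma le_int a b f g : continuous f -> continuous g -> a <= b ->
  (forall x, a <= x <= b -> f x <= g x) -> int a b f <= int a b g.
Proof.
move=> cf cg ab fg; rewrite -subr_ge0 -intB//; apply: int_ge0 => //.
  exact: cont_sub.
by move=> x /fg; rewrite subr_ge0.
Qed.

Lemma ler_norm_int a b f : continuous f -> a <= b ->
  `|int a b f| <= int a b (fun x => `|f x|).
Proof.
move=> cf ab; have cn := cont_norm cf.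
rewrite ler_norml -intN//; apply/andP; split; apply: le_int => //.
- exact: cont_opp.
- by move=> x _; rewrite lerNl -normrN ler_norm.
- by move=> x _; rewrite ler_norm.
Qed.

(** Oriented integrals make this valid for [k] of either sign and for [k = 0], which allows a
    variable endpoint to be scaled to a fixed interval. *)
Lemma int_affine a b k d f : continuous f ->
  int a b (fun x => k * f (k * x + d)) = int (k * a + d) (k * b + d) f.
Proof.
move=> cf.
have dF x : is_derive x (1 : R) (fun x => prim f (k * x + d)) (k * f (k * x + d)).
  have dl : is_derive x (1 : R) (fun y => k * y + d) k.
    by have := is_deriveD (is_derive_scale k x) (is_derive_cst d x 1); rewrite addr0.
  have dp := primP cf (k * x + d).
  have := @is_derive1_comp _ (prim f) (fun y => k * y + d) x _ _ dp dl.
  by rewrite mulrC.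
rewrite (int_FTC _ _ dF)//.
apply: cont_mul; first exact: cont_cst.
apply: (@cont_comp _ _ _ (fun x => k * x + d) f) => //.
apply: cont_add; last exact: cont_cst.
by apply: cont_mul; [exact: cont_cst|exact: cont_id].
Qed.

Lemma int_shift a b d f : continuous f ->
  int a b (fun x => f (x + d)) = int (a + d) (b + d) f.
Proof.
move=> cf; have := int_affine a b 1 d cf; rewrite !mul1r => <-.
by congr int; apply/funext => x; rewrite !mul1r.
Qed.

End primitives.

(** * Integrals depending on a parameter: continuity, Leibniz rule, Fubini *)

Section parametric_integrals.
Context {R : realType}.

Definition cont2 (T : topologicalType) (f : T -> R -> R) :=
  continuous (fun p : T * R => f p.1 p.2).

Lemma cont2_slice (T : topologicalType) (f : T -> R -> R) (x : T) :
  cont2 f -> continuous (f x).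
Proof.
move=> cf; apply: (@cont_comp _ _ _ (fun t : R => (x, t)) (fun p => f p.1 p.2)) => //.
apply: cont_pair; last exact: cont_id.
by move=> ?; exact: cvg_cst.
Qed.

Lemma cont2_comp (S T : topologicalType) (f : T -> R -> R) (u : S -> T) (v : S -> R) :
  cont2 f -> continuous u -> continuous v -> continuous (fun s => f (u s) (v s)).
Proof.
move=> cf cu cv.
apply: (@cont_comp _ _ _ (fun s => (u s, v s)) (fun p => f p.1 p.2)) => //.
exact: cont_pair.
Qed.

Lemma cont2_swap (f : R -> R -> R) : cont2 f -> cont2 (fun t x => f x t).
Proof. by move=> cf; apply: cont2_comp cf _ _; [exact: cont_snd|exact: cont_fst]. Qed.

(** Compactness of the segment turns joint continuity into uniformity in [t], as in the tube
    lemma. *)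
Lemma cont2_near (T : topologicalType) (f : T -> R -> R) (a b : R) (x : T) (e : R) :
  cont2 f -> 0 < e ->
  \forall y \near x, forall t, a <= t <= b -> `|f y t - f x t| <= e.
Proof.
move=> cf e0.
have /compact_near_coveringP cov := @segment_compact R a b.
have : \forall y \near x, `[a, b] `<=` (fun t => `|f y t - f x t| <= e).
  apply: (cov _ (nbhs x) (fun y t => `|f y t - f x t| <= e)) => t _.
  have e2 : 0 < e / 2 by rewrite divr_gt0.
  have /cvgrPdist_le /(_ _ e2) := cf (x, t).
  rewrite nearE => -[[A B] /= [nA nB] AB].
  exists (B, A) => //= -[t' y] /= [Bt' Ay].
  have h1 := AB (y, t') (conj Ay Bt').
  have h2 := AB (x, t') (conj (nbhs_singleton nA) Bt').
  rewrite /= in h1 h2.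
  have -> : f y t' - f x t' = (f x t - f x t') - (f x t - f y t') by ring.
  by rewrite [e]splitr (le_trans (ler_normB _ _))// lerD.
by apply: filterS => y H t tab; apply: H; rewrite /= in_itv.
Qed.

Lemma cont_int_cst (T : topologicalType) (f : T -> R -> R) (a b : R) : cont2 f ->
  continuous (fun x => int a b (f x)).
Proof.
move=> cf.
wlog ab : a b / a <= b.
  move=> H; have [|/ltW ba] := leP a b; first exact: H.
  have -> : (fun x => int a b (f x)) = (fun x => - int b a (f x)).
    by apply/funext => x; rewrite int_swap.
  by apply: cont_opp; exact: H.
move=> x; apply/cvgrPdist_le => e e0.
have d0 : 0 < e / (b - a + 1) by rewrite divr_gt0// ltr_wpDl// subr_ge0.
have := cont2_near a b x cf d0; apply: filterS => y H.
rewrite -intB; try exact: cont2_slice.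
apply: le_trans (int_norm_bound (M := e / (b - a + 1)) _ ab _) _.
- by apply: cont_sub; exact: cont2_slice.
- by move=> t tab; rewrite distrC; exact: H.
- rewrite mulrAC ler_pdivrMr ?ltr_wpDl ?subr_ge0// ler_pM2l//; lra.
Qed.

Lemma cont_int (T : topologicalType) (f : T -> R -> R) (a b : T -> R) : cont2 f ->
  continuous a -> continuous b -> continuous (fun x => int (a x) (b x) (f x)).
Proof.
move=> cf ca cb.
have key (g : T -> R) : continuous g -> continuous (fun x => int 0 (g x) (f x)).
  move=> cg.
  (* Scaling by [g x] moves the variable endpoint into the integrand, where the case of fixed
     endpoints applies. *)
  have -> : (fun x => int 0 (g x) (f x)) =
            (fun x => int 0 1 (fun t => g x * f x (g x * t + 0))).
    apply/funext => x; rewrite int_affine ?mulr0 ?mulr1 ?addr0//.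
    exact: cont2_slice.
  apply: cont_int_cst.
  have cg1 : continuous (fun p : T * R => g p.1).
    by apply: cont_comp cg; exact: cont_fst.
  apply: cont_mul => //.
  apply: (cont2_comp (u := fun p : T * R => p.1) (v := fun p => g p.1 * p.2 + 0) cf).
    exact: cont_fst.
  by apply: cont_add; [apply: cont_mul => //; exact: cont_snd|exact: cont_cst].
have -> : (fun x => int (a x) (b x) (f x)) =
          (fun x => int 0 (b x) (f x) - int 0 (a x) (f x)).
  by apply/funext => x; rewrite -(int_chasles (a x) 0 (b x)) int_swap addrC.
by apply: cont_sub; exact: key.
Qed.

Lemma int_leibniz (F f : R -> R -> R) (a b x : R) : cont2 F -> cont2 f ->
  (forall y t, is_derive y (1 : R) (F ^~ t) (f y t)) ->
  is_derive x (1 : R) (fun y => int a b (F y)) (int a b (f x)).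
Proof.
move=> cF cf dF.
wlog ab : a b / a <= b.
  move=> H; have [|/ltW ba] := leP a b; first exact: H.
  have -> : (fun x => int a b (F x)) = (fun x => - int b a (F x)).
    by apply/funext => y; rewrite int_swap.
  rewrite int_swap; apply: is_deriveN; exact: H.
apply/is_derive_epsP => e e0.
have d0 : 0 < e / (b - a + 1) by rewrite divr_gt0// ltr_wpDl// subr_ge0.
have := cont2_near a b x cf d0; move=> /nbhs_ballP[r /= r0 H].
exists r => // y yx.
have cFs z : continuous (F z) by exact: cont2_slice.
have cfs z : continuous (f z) by exact: cont2_slice.
have -> : int a b (F y) - int a b (F x) - int a b (f x) * (y - x) =
    int a b (fun t => F y t - F x t - (y - x) * f x t).
  rewrite intB ?intB ?intZ//; first by ring.
    exact: cont_sub.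
  by apply: cont_mul => //; exact: cont_cst.
apply: le_trans (int_norm_bound (M := e / (b - a + 1) * `|y - x|) _ ab _) _.
- apply: cont_sub; first exact: cont_sub.
  by apply: cont_mul => //; exact: cont_cst.
- move=> t tab.
  (* Removing the linear part leaves a function of [z] with derivative [f z t - f x t], which is
     small uniformly in [t]; the mean value bound then controls its increment. *)
  pose G (z : R) := F z t - z * f x t.
  have dG z : is_derive z (1 : R) G (f z t - f x t).
    have h := is_deriveB (dF z t) (is_derive_scale (f x t) z).
    by move: h; congr (is_derive _ _ _ _); apply/funext => w; rewrite /G mulrC.
  have -> : F y t - F x t - (y - x) * f x t = G y - G x by rewrite /G; ring.
  have [xy|/ltW yx'] := leP x y.
    rewrite (ger0_norm (_ : 0 <= y - x)) ?subr_ge0//.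
    apply: (derive_norm_bound xy (fun z _ => dG z)) => z /andP[xz zy].
    apply: H => //; rewrite /ball/= distrC; move: yx; rewrite !ger0_norm ?subr_ge0//.
    by apply: le_lt_trans; rewrite lerB.
  rewrite distrC (distrC y) (ger0_norm (_ : 0 <= x - y)) ?subr_ge0//.
  apply: (derive_norm_bound yx' (fun z _ => dG z)) => z /andP[xz zy].
  apply: H => //; rewrite /ball/=; move: yx; rewrite distrC !ger0_norm ?subr_ge0//.
  by apply: le_lt_trans; rewrite lerB.
- rewrite mulrAC; apply: ler_wpM2r => //.
  rewrite mulrAC ler_pdivrMr ?ltr_wpDl ?subr_ge0// ler_pM2l//; lra.
Qed.

(* Both sides have the same derivative in [b]. *)
Lemma int_fubini (f : R -> R -> R) (a b c d : R) : cont2 f ->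
  int a b (fun x => int c d (f x)) = int c d (fun t => int a b (f ^~ t)).
Proof.
move=> cf; have cf' := cont2_swap cf.
pose U y := int a y (fun x => int c d (f x)).
pose V y := int c d (fun t => int a y (f ^~ t)).
suff : U = V by move/(congr1 (fun G => G b)).
have cU : continuous (fun x => int c d (f x)) by exact: cont_int_cst.
apply: (@is_derive_unique _ U V (fun x => int c d (f x)) a).
- by move=> x; exact: int_derive.
- move=> x; apply: int_leibniz => //.
    apply: (cont_int (f := fun p : R * R => f ^~ p.2)) => //; [|exact: cont_cst|exact: cont_fst].
    apply: (cont2_comp (u := fun p : R * R * R => p.2) (v := fun p => p.1.2) cf).
      exact: cont_snd.
    by apply: cont_comp; [exact: cont_fst|exact: cont_snd].
  by move=> y t; apply: int_derive; exact: (@cont2_slice _ (fun t x => f x t)).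
- rewrite /U /V int_xx; apply/esym.
  have -> : (fun t => int a a (f ^~ t)) = fun=> 0.
    by apply/funext => t; rewrite int_xx.
  by rewrite int_cst mul0r.
Qed.

(** Both sides are primitives in [C] of the inner integral on the left. On the right,
    differentiation under the integral yields the values [f r (C - r)], and the moving endpoint
    contributes nothing because the inner interval is degenerate at [r = C]. *)
Lemma int_fubini_triangle (f : R -> R -> R) (C : R) : cont2 f ->
  int 0 C (fun t => int 0 t (fun r => f r (t - r))) =
  int 0 C (fun r => int 0 (C - r) (f r)).
Proof.
move=> cf.
pose D x := int 0 x (fun r => f r (x - r)).
pose F x r := int 0 (x - r) (f r).
have cF : cont2 F.
  apply: (cont_int (f := fun p : R * R => f p.2)); [|exact: cont_cst|].
    apply: (cont2_comp (u := fun p : R * R * R => p.1.2) (v := fun p => p.2) cf).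
      by apply: cont_comp; [exact: cont_fst|exact: cont_snd].
    exact: cont_snd.
  by apply: cont_sub; [exact: cont_fst|exact: cont_snd].
have cFs x : continuous (F x) by exact: cont2_slice.
pose h x r := f r (x - r).
have ch : cont2 h.
  apply: (cont2_comp (u := fun p : R * R => p.2) (v := fun p => p.1 - p.2) cf).
    exact: cont_snd.
  by apply: cont_sub; [exact: cont_fst|exact: cont_snd].
have cD : continuous D by apply: cont_int => //; [exact: cont_cst|exact: cont_id].
pose U y := int 0 y D.
pose V y := int 0 y (F y).
suff : U = V by move/(congr1 (fun G => G C)).
apply: (@is_derive_unique _ U V D 0); last by rewrite /U /V !int_xx.
  by move=> x; exact: int_derive.
move=> x.
have d1 : is_derive x (1 : R) (fun y => int 0 x (F y)) (D x).
  apply: (int_leibniz (f := h)) => // y r.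
  have cfr : continuous (f r) by exact: cont2_slice.
  have dl : is_derive y (1 : R) (fun y => y - r) 1.
    by have := is_deriveB (is_derive_id y 1) (is_derive_cst r y 1); rewrite subr0.
  have := @is_derive1_comp _ (int 0 ^~ (f r)) (fun y => y - r) y _ _ (int_derive 0 (y - r) cfr) dl.
  by rewrite mulr1.
have d2 : is_derive x (1 : R) (fun y => int x y (F y)) 0.
  apply/is_derive_epsP => e e0.
  have Fxx : F x x = 0 by rewrite /F subrr int_xx.
  have /cvgrPdist_le /(_ _ e0) := cF (x, x).
  rewrite nearE => -[[A B] /= [/nbhs_ballP[r1 /= r10 nA] /nbhs_ballP[r2 /= r20 nB]] AB].
  exists (Num.min r1 r2); first by rewrite lt_min r10 r20.
  move=> y; rewrite lt_min => /andP[yr1 yr2].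
  rewrite int_xx mul0r !subr0.
  have bd r : `|r - x| <= `|y - x| -> `|F y r| <= e.
    move=> rx; have := AB (y, r); rewrite /= Fxx sub0r normrN; apply; split.
      by apply: nA; rewrite /ball/= distrC.
    by apply: nB; rewrite /ball/= distrC (le_lt_trans rx).
  have [xy|/ltW yx] := leP x y.
    rewrite (ger0_norm (_ : 0 <= y - x)) ?subr_ge0//.
    apply: int_norm_bound => // r /andP[xr ry]; apply: bd.
    by rewrite !ger0_norm ?subr_ge0// lerB.
  rewrite int_swap normrN (distrC y) (ger0_norm (_ : 0 <= x - y)) ?subr_ge0//.
  apply: int_norm_bound => // r /andP[yr rx]; apply: bd.
  by rewrite distrC (distrC y) !ger0_norm ?subr_ge0// lerB.
have := is_deriveD d1 d2; rewrite addr0.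
by congr (is_derive _ _ _ _); apply/funext => y; rewrite !fctE int_chasles.
Qed.

End parametric_integrals.

(** * Complex-valued calculus and the transform *)

Section complex_calculus.
Context {R : realType}.
Implicit Types (z w s : R[i]) (a b c x y : R) (A B : R -> R).

Lemma ceqP z w : re z = re w -> im z = im w -> z = w.
Proof. by case: z w => a b [c d]; rewrite /re /im /= => -> ->. Qed.

Lemma reD z w : re (z + w) = re z + re w. Proof. by case: z w => a b [c d]. Qed.
Lemma imD z w : im (z + w) = im z + im w. Proof. by case: z w => a b [c d]. Qed.
Lemma reN z : re (- z) = - re z. Proof. by case: z. Qed.
Lemma imN z : im (- z) = - im z. Proof. by case: z. Qed.
Lemma reM z w : re (z * w) = re z * re w - im z * im w.
Proof. by case: z w => a b [c d]. Qed.
Lemma imM z w : im (z * w) = re z * im w + im z * re w.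
Proof. by case: z w => a b [c d]. Qed.
Lemma reC x : re x%:C = x. Proof. by []. Qed.
Lemma imC x : im x%:C = 0. Proof. by []. Qed.
Lemma re0 : re (0 : R[i]) = 0. Proof. by []. Qed.
Lemma im0 : im (0 : R[i]) = 0. Proof. by []. Qed.
Lemma re1 : re (1 : R[i]) = 1. Proof. by []. Qed.
Lemma im1 : im (1 : R[i]) = 0. Proof. by []. Qed.

Definition reimE := (reD, imD, reN, imN, reM, imM, reC, imC, re0, im0, re1, im1).

Lemma cexpD z w : cexp (z + w) = cexp z * cexp w.
Proof.
apply: ceqP; rewrite /cexp !reimE /re /im /= expRD ?cosD ?sinD; ring.
Qed.

Lemma cexp0 : cexp (0 : R[i]) = 1.
Proof. by apply: ceqP; rewrite /cexp !reimE /= expR0 cos0 sin0 /re /im /=; ring. Qed.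

Lemma re_cexp z : re (cexp z) = expR (re z) * cos (im z).
Proof. by rewrite /cexp !reimE /re /im /=; ring. Qed.

Lemma im_cexp z : im (cexp z) = expR (re z) * sin (im z).
Proof. by rewrite /cexp !reimE /re /im /=; ring. Qed.

(** Componentwise, like [has_derivative], so that complex statements reduce to pairs of real
    ones. *)
Definition ccont (T : topologicalType) (f : T -> R[i]) :=
  continuous (fun t => re (f t)) /\ continuous (fun t => im (f t)).

Lemma ccont_cst (T : topologicalType) z : ccont (fun _ : T => z).
Proof. by split; exact: cont_cst. Qed.

Lemma ccont_real (T : topologicalType) (f : T -> R) : continuous f ->
  ccont (fun t => (f t)%:C).
Proof. by move=> cf; split => //; exact: cont_cst. Qed.

Lemma ccontD (T : topologicalType) (f g : T -> R[i]) : ccont f -> ccont g ->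
  ccont (fun t => f t + g t).
Proof.
move=> [f1 f2] [g1 g2]; split.
  by under eq_fun do rewrite reD; exact: cont_add.
by under eq_fun do rewrite imD; exact: cont_add.
Qed.

Lemma ccontN (T : topologicalType) (f : T -> R[i]) : ccont f ->
  ccont (fun t => - f t).
Proof.
move=> [f1 f2]; split.
  by under eq_fun do rewrite reN; exact: cont_opp.
by under eq_fun do rewrite imN; exact: cont_opp.
Qed.

Lemma ccontB (T : topologicalType) (f g : T -> R[i]) : ccont f -> ccont g ->
  ccont (fun t => f t - g t).
Proof. by move=> cf cg; apply: ccontD => //; exact: ccontN. Qed.

Lemma ccontM (T : topologicalType) (f g : T -> R[i]) : ccont f -> ccont g ->
  ccont (fun t => f t * g t).
Proof.
move=> [f1 f2] [g1 g2]; split.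
  by under eq_fun do rewrite reM; apply: cont_sub; exact: cont_mul.
by under eq_fun do rewrite imM; apply: cont_add; exact: cont_mul.
Qed.

Lemma ccont_comp (S T : topologicalType) (f : S -> T) (g : T -> R[i]) :
  continuous f -> ccont g -> ccont (fun t => g (f t)).
Proof.
move=> cf [g1 g2]; split.
  exact: (@cont_comp _ _ _ f (fun t => re (g t))).
exact: (@cont_comp _ _ _ f (fun t => im (g t))).
Qed.

Lemma ccont_cexp (T : topologicalType) (f : T -> R[i]) : ccont f ->
  ccont (fun t => cexp (f t)).
Proof.
move=> [f1 f2]; split.
  under eq_fun do rewrite re_cexp; apply: cont_mul.
    by apply: (cont_comp f1); exact: continuous_expR.
  by apply: (cont_comp f2); exact: continuous_cos.
under eq_fun do rewrite im_cexp; apply: cont_mul.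
  by apply: (cont_comp f1); exact: continuous_expR.
by apply: (cont_comp f2); exact: continuous_sin.
Qed.

Definition cint a b (f : R -> R[i]) : R[i] :=
  int a b (fun t => re (f t)) +i* int a b (fun t => im (f t)).

Lemma re_cint a b f : re (cint a b f) = int a b (fun t => re (f t)). Proof. by []. Qed.
Lemma im_cint a b f : im (cint a b f) = int a b (fun t => im (f t)). Proof. by []. Qed.

Lemma eq_cint a b f g : ccont f -> ccont g -> a <= b ->
  (forall t, a <= t <= b -> f t = g t) -> cint a b f = cint a b g.
Proof.
move=> [f1 f2] [g1 g2] ab fg; apply: ceqP; rewrite ?re_cint ?im_cint.
  by apply: eq_int => // t /fg ->.
by apply: eq_int => // t /fg ->.
Qed.

Lemma cint_chasles a b c f : cint a b f + cint b c f = cint a c f.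
Proof. by apply: ceqP; rewrite !reimE ?re_cint ?im_cint int_chasles. Qed.

Lemma cint_xx a f : cint a a f = 0.
Proof. by apply: ceqP; rewrite ?re_cint ?im_cint int_xx. Qed.

Lemma cintD a b f g : ccont f -> ccont g ->
  cint a b (fun t => f t + g t) = cint a b f + cint a b g.
Proof.
move=> [f1 f2] [g1 g2]; apply: ceqP; rewrite !reimE ?re_cint ?im_cint -intD//.
  by under eq_fun do rewrite reD.
by under eq_fun do rewrite imD.
Qed.

Lemma cintZ a b z f : ccont f -> cint a b (fun t => z * f t) = z * cint a b f.
Proof.
move=> [f1 f2]; apply: ceqP; rewrite !reimE ?re_cint ?im_cint.
  under eq_fun do rewrite reM.
  by rewrite intB ?intZ//; apply: cont_mul => //; exact: cont_cst.
under eq_fun do rewrite imM.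
by rewrite intD ?intZ//; apply: cont_mul => //; exact: cont_cst.
Qed.

Lemma cintZr a b z f : ccont f -> cint a b (fun t => f t * z) = cint a b f * z.
Proof.
move=> cf; rewrite mulrC -cintZ//; congr cint.
by apply/funext => t; rewrite mulrC.
Qed.

Lemma cintN a b f : ccont f -> cint a b (fun t => - f t) = - cint a b f.
Proof.
move=> cf; rewrite -mulN1r -cintZ//; congr cint.
by apply/funext => t; rewrite mulN1r.
Qed.

Lemma cintB a b f g : ccont f -> ccont g ->
  cint a b (fun t => f t - g t) = cint a b f - cint a b g.
Proof. by move=> cf cg; rewrite cintD ?cintN//; exact: ccontN. Qed.

Lemma cint_shift a b d f : ccont f ->
  cint a b (fun x => f (x + d)) = cint (a + d) (b + d) f.
Proof.
move=> [f1 f2]; apply: ceqP; rewrite ?re_cint ?im_cint.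
  exact: (int_shift _ _ _ f1).
exact: (int_shift _ _ _ f2).
Qed.

Definition ccont2 (f : R -> R -> R[i]) := ccont (fun p : R * R => f p.1 p.2).

Lemma cint_fubini (f : R -> R -> R[i]) a b c d : ccont2 f ->
  cint a b (fun x => cint c d (f x)) = cint c d (fun t => cint a b (f ^~ t)).
Proof.
move=> [f1 f2]; apply: ceqP; rewrite !re_cint || rewrite !im_cint.
  exact: (@int_fubini _ (fun x t => re (f x t))).
exact: (@int_fubini _ (fun x t => im (f x t))).
Qed.

Lemma cint_fubini_triangle (f : R -> R -> R[i]) c : ccont2 f ->
  cint 0 c (fun t => cint 0 t (fun r => f r (t - r))) =
  cint 0 c (fun r => cint 0 (c - r) (f r)).
Proof.
move=> [f1 f2]; apply: ceqP; rewrite !re_cint || rewrite !im_cint.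
  exact: (@int_fubini_triangle _ (fun x t => re (f x t))).
exact: (@int_fubini_triangle _ (fun x t => im (f x t))).
Qed.

Lemma ccont_slice (f : R -> R -> R[i]) x : ccont2 f -> ccont (f x).
Proof.
move=> cf; apply: (ccont_comp (f := fun t : R => (x, t)) _ cf).
by apply: cont_pair; [exact: cont_cst|exact: cont_id].
Qed.

Lemma ccont_cint (T : topologicalType) (f : T -> R -> R[i]) (u v : T -> R) :
  ccont (fun p : T * R => f p.1 p.2) -> continuous u -> continuous v ->
  ccont (fun p => cint (u p) (v p) (f p)).
Proof.
move=> [f1 f2] cu cv; split.
  exact: (@cont_int _ _ (fun p t => re (f p t)) u v f1 cu cv).
exact: (@cont_int _ _ (fun p t => im (f p t)) u v f2 cu cv).
Qed.

Lemma has_derivative_int a f x : ccont f -> has_derivative (cint a ^~ f) x (f x).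
Proof.
move=> [f1 f2]; split.
  exact: (@int_derive _ a (fun t => re (f t))).
exact: (@int_derive _ a (fun t => im (f t))).
Qed.

Lemma has_derivativeD f g x z w : has_derivative f x z -> has_derivative g x w ->
  has_derivative (fun t => f t + g t) x (z + w).
Proof.
move=> [f1 f2] [g1 g2]; split; rewrite !reimE.
  have -> : @re R \o (fun t => f t + g t) = (@re R \o f) + (@re R \o g).
    by apply/funext => t; rewrite !fctE reD.
  exact: is_deriveD.
have -> : @im R \o (fun t => f t + g t) = (@im R \o f) + (@im R \o g).
  by apply/funext => t; rewrite !fctE imD.
exact: is_deriveD.
Qed.

Lemma has_derivativeN f x z : has_derivative f x z ->
  has_derivative (fun t => - f t) x (- z).
Proof.
move=> [f1 f2]; split; rewrite !reimE.
  have -> : @re R \o (fun t => - f t) = - (@re R \o f).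
    by apply/funext => t; rewrite !fctE reN.
  exact: is_deriveN.
have -> : @im R \o (fun t => - f t) = - (@im R \o f).
  by apply/funext => t; rewrite !fctE imN.
exact: is_deriveN.
Qed.

Lemma has_derivative_cst z x : has_derivative (fun=> z) x 0.
Proof. by split; exact: is_derive_cst. Qed.

Lemma has_derivativeM f g x z w : has_derivative f x z -> has_derivative g x w ->
  has_derivative (fun t => f t * g t) x (z * g x + f x * w).
Proof.
move=> [f1 f2] [g1 g2]; split; rewrite !reimE.
  have -> : @re R \o (fun t => f t * g t) =
      (fun t => re (f t) * re (g t)) - (fun t => im (f t) * im (g t)).
    by apply/funext => t; rewrite !fctE reM.
  apply: (is_derive_eq (is_deriveB (is_derive_mul f1 g1) (is_derive_mul f2 g2))) => /=.
  by ring.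
have -> : @im R \o (fun t => f t * g t) =
    (fun t => re (f t) * im (g t)) + (fun t => im (f t) * re (g t)).
  by apply/funext => t; rewrite !fctE imM.
apply: (is_derive_eq (is_deriveD (is_derive_mul f1 g2) (is_derive_mul f2 g1))) => /=.
by ring.
Qed.

Lemma has_derivative_cexp s x :
  has_derivative (fun t => cexp (s * t%:C)) x (s * cexp (s * x%:C)).
Proof.
have hr (t : R) : re (s * t%:C) = re s * t by rewrite !reimE; ring.
have hi (t : R) : im (s * t%:C) = im s * t by rewrite !reimE; ring.
have de := @is_derive1_comp _ _ _ _ _ _ (is_derive_expR (re s * x)) (is_derive_scale (re s) x).
have dc := @is_derive1_comp _ _ _ _ _ _ (is_derive_cos (im s * x)) (is_derive_scale (im s) x).
have ds := @is_derive1_comp _ _ _ _ _ _ (is_derive_sin (im s * x)) (is_derive_scale (im s) x).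
split.
  have -> : @re R \o (fun t => cexp (s * t%:C)) = (fun t => expR (re s * t) * cos (im s * t)).
    by apply/funext => t; rewrite /comp re_cexp hr hi.
  apply: (is_derive_eq (is_derive_mul de dc)) => /=.
  by rewrite reM re_cexp im_cexp hr hi; ring.
have -> : @im R \o (fun t => cexp (s * t%:C)) = (fun t => expR (re s * t) * sin (im s * t)).
  by apply/funext => t; rewrite /comp im_cexp hr hi.
apply: (is_derive_eq (is_derive_mul de ds)) => /=.
by rewrite imM re_cexp im_cexp hr hi; ring.
Qed.

Lemma cint_FTC F f a b : (forall x, has_derivative F x (f x)) -> ccont f ->
  cint a b f = F b - F a.
Proof.
move=> dF [f1 f2]; apply: ceqP; rewrite !reimE ?re_cint ?im_cint.
  exact: (@int_FTC _ (@re R \o F) (fun t => re (f t)) a b (fun x => proj1 (dF x)) f1).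
exact: (@int_FTC _ (@im R \o F) (fun t => im (f t)) a b (fun x => proj2 (dF x)) f2).
Qed.

(** A Laplace transform on [[0, c]] with the sign of [s] reversed; it grows in the right half-plane,
    where the prescribed points [s = 2ik] lie. *)
Definition lap c (A : R -> R) s : R[i] :=
  cint 0 c (fun t => (A t)%:C * cexp (s * t%:C)).

Lemma ccont_exp s : ccont (fun t : R => cexp (s * t%:C)).
Proof.
apply: ccont_cexp; apply: ccontM; first exact: ccont_cst.
by apply: ccont_real; exact: cont_id.
Qed.

Lemma ccont_lap A s : continuous A -> ccont (fun t => (A t)%:C * cexp (s * t%:C)).
Proof. by move=> cA; apply: ccontM; [exact: ccont_real|exact: ccont_exp]. Qed.

Lemma lapD c A B s : continuous A -> continuous B ->
  lap c (fun t => A t + B t) s = lap c A s + lap c B s.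
Proof.
move=> cA cB; rewrite -cintD; try exact: ccont_lap.
by congr cint; apply/funext => t; rewrite rmorphD mulrDl.
Qed.

Lemma lapZ c k A s : continuous A ->
  lap c (fun t => k * A t) s = k%:C * lap c A s.
Proof.
move=> cA; rewrite -cintZ; last exact: ccont_lap.
by congr cint; apply/funext => t; rewrite rmorphM mulrA.
Qed.

Lemma lap_cst0 c s : lap c (fun=> 0) s = 0.
Proof.
have -> : lap c (fun=> 0) s = cint 0 c (fun=> 0).
  by congr cint; apply/funext => t; rewrite mul0r.
by apply: ceqP; rewrite ?re_cint ?im_cint int_cst mul0r.
Qed.

Lemma eq_lap c A B s : continuous A -> continuous B -> 0 <= c ->
  (forall t, 0 <= t <= c -> A t = B t) -> lap c A s = lap c B s.
Proof.
move=> cA cB c0 AB; apply: eq_cint => //; try exact: ccont_lap.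
by move=> t /AB ->.
Qed.

Lemma lap0 c A : continuous A -> lap c A 0 = (int 0 c A)%:C.
Proof.
move=> cA; apply: ceqP; rewrite ?re_cint ?im_cint ?reimE.
  by congr int; apply/funext => t; rewrite mul0r cexp0 mulr1.
have -> : (fun t => im ((A t)%:C * cexp (0 * t%:C))) = fun=> 0.
  by apply/funext => t; rewrite mul0r cexp0 mulr1.
by rewrite int_cst mul0r.
Qed.

End complex_calculus.

(** * The inverse problem for small data *)

Section contraction.
Context {R : realType}.

(** Telescoping bounds the increments by a geometric sum, so the sequence is Cauchy at each point.
    The error is uniform relative to [w], which is what carries continuity to the limit. *)
Lemma geometric_step_limit (T : Type) (v : nat -> T -> R) (w : T -> R) (K th : R) :
  0 <= th < 1 ->
  (forall n t, `|v n.+1 t - v n t| <= K * th ^+ n * w t) ->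
  exists u : T -> R, forall n t, `|u t - v n t| <= K / (1 - th) * th ^+ n * w t.
Proof.
move=> /andP[th0 th1] vS; have th1' : 0 < 1 - th by rewrite subr_gt0.
(* The factor [1 - th ^+ m] is the exact partial geometric sum and makes the induction on [m] close
   with equality. *)
have vD n m t : `|v (n + m)%N t - v n t| <= K / (1 - th) * th ^+ n * (1 - th ^+ m) * w t.
  elim: m => [|m IH]; first by rewrite addn0 subrr normr0 expr0 subrr mulr0 mul0r.
  have -> : v (n + m.+1)%N t - v n t =
     (v (n + m).+1 t - v (n + m)%N t) + (v (n + m)%N t - v n t).
    by rewrite addnS; ring.
  apply: le_trans (ler_normD _ _) _; apply: le_trans (lerD (vS _ _) IH) _.
  rewrite le_eqVlt; apply/orP; left; apply/eqP.
  rewrite exprD exprS; field; exact: lt0r_neq0.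
have kw0 n t : 0 <= K * th ^+ n * w t by apply: le_trans (vS n t); exact: normr_ge0.
have vD' n m t : `|v (n + m)%N t - v n t| <= K / (1 - th) * th ^+ n * w t.
  apply: le_trans (vD n m t) _.
  have -> : K / (1 - th) * th ^+ n * (1 - th ^+ m) * w t =
     (K * th ^+ n * w t) / (1 - th) * (1 - th ^+ m) by ring.
  have -> : K / (1 - th) * th ^+ n * w t = (K * th ^+ n * w t) / (1 - th) by ring.
  rewrite -[leRHS]mulr1; apply: ler_wpM2l; first by rewrite divr_ge0// ltW.
  by rewrite gerBl exprn_ge0.
have d0 t : (fun n => K / (1 - th) * th ^+ n * w t) @ \oo --> (0 : R).
  have := @cvg_geometric R (K / (1 - th) * w t) th.
  rewrite ger0_norm// => /(_ th1).
  by under eq_fun do rewrite /geometric/= mulrAC.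
have cv t : cvg (v ^~ t @ \oo).
  apply: cauchy_cvg; apply: cauchy_exP => e e0.
  have /cvgrPdist_lt /(_ e e0) [N _ HN] := d0 t.
  exists (v N t); exists N => // n /= Nn; rewrite /ball/= distrC.
  rewrite -(subnKC Nn); apply: le_lt_trans (vD' _ _ _) _.
  by have := HN N (leqnn N); rewrite /= sub0r normrN; apply: le_lt_trans; exact: ler_norm.
exists (fun t => lim (v ^~ t @ \oo)) => n t.
have h : (fun m => `|v m t - v n t|) @ \oo --> `|lim (v ^~ t @ \oo) - v n t|.
  by apply: cvg_norm; apply: cvgB; [exact: cv|exact: cvg_cst].
apply: (closed_cvg (fun x => x <= K / (1 - th) * th ^+ n * w t)) h.
  exact: closed_le.
by exists n => // m /= nm; rewrite -(subnKC nm); exact: vD'.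
Qed.

(** Banach's theorem in a weighted sup norm for plain functions: distances enter only as bounds
    [d * w t], and completeness of [S] as stability under weighted uniform limits. *)
Lemma contraction_fixpoint (T : Type) (S : set (T -> R)) (Phi : (T -> R) -> T -> R)
    (w : T -> R) (K th : R) (u0 : T -> R) :
  0 <= th < 1 -> (forall t, 0 <= w t) -> 0 <= K -> S u0 ->
  (forall u, S u -> S (Phi u)) ->
  (forall u v d, S u -> S v -> 0 <= d -> (forall t, `|u t - v t| <= d * w t) ->
     forall t, `|Phi u t - Phi v t| <= th * d * w t) ->
  (forall t, `|Phi u0 t - u0 t| <= K * w t) ->
  (forall (v : nat -> T -> R) u, (forall n, S (v n)) ->
     (forall e, 0 < e -> exists N, forall n t, (N <= n)%N -> `|u t - v n t| <= e * w t) ->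
     S u) ->
  exists2 u, S u & Phi u = u.
Proof.
move=> th01 w0 K0 Su0 SPhi contr step0 clS.
have [th0 th1] := andP th01.
pose v n := iter n Phi u0.
have Sv n : S (v n) by elim: n => //= n; exact: SPhi.
have vS n t : `|v n.+1 t - v n t| <= K * th ^+ n * w t.
  elim: n t => [|n IH] t; first by rewrite expr0 mulr1; exact: step0.
  have := @contr (v n.+1) (v n) (K * th ^+ n) (Sv _) (Sv _) _ IH t.
  rewrite exprS mulrCA; apply; rewrite mulr_ge0// exprn_ge0//.
have [u Hu] := geometric_step_limit th01 vS.
set K' := K / (1 - th) in Hu.
have K'0 : 0 <= K' by rewrite divr_ge0// subr_ge0 ltW.
have conv e : 0 < e -> exists N, forall n t, (N <= n)%N -> `|u t - v n t| <= e * w t.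
  move=> e0; have := @cvg_geometric R K' th.
  rewrite ger0_norm// => /(_ th1) /cvgrPdist_le /(_ e e0)[N _ HN].
  exists N => n t Nn; apply: le_trans (Hu n t) _; apply: ler_wpM2r => //.
  by have := HN n Nn; rewrite /= sub0r normrN; apply: le_trans; exact: ler_norm.
have Su : S u by apply: clS conv.
exists u => //; apply/funext => t; apply/eqP; rewrite -subr_eq0 -normr_le0.
apply/ler_addgt0Pr => e e0; rewrite add0r.
(* Dividing by [w t + 1] also covers points where the weight vanishes. *)
have w1 : 0 < w t + 1 by rewrite ltr_wpDl.
have d0 : 0 < e / 2 / (w t + 1) by rewrite !divr_gt0.
have [N HN] := conv _ d0.
have -> : Phi u t - u t = (Phi u t - Phi (v N) t) - (u t - v N.+1 t) by rewrite /v/=; ring.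
apply: le_trans (ler_normB _ _) _.
have le2 : e / 2 / (w t + 1) * w t <= e / 2.
  by rewrite mulrAC ler_pdivrMr// ler_pM2l ?divr_gt0// lerDl.
rewrite [leRHS]splitr; apply: lerD; last first.
  by apply: le_trans (HN _ _ (leqnSn N)) le2.
have := @contr u (v N) _ Su (Sv N) (ltW d0) (fun t => HN N t (leqnn N)) t.
move=> /le_trans; apply; apply: le_trans le2.
rewrite -mulrA; apply: ler_piMl; last exact: ltW.
by rewrite mulr_ge0// ltW.
Qed.

End contraction.

(** * The fixed point equation for the potential and the kernel *)

Section inverse_problem.
Context {R : realType}.
Variables (c e : R) (g : R -> R).
Hypotheses (c1 : 1 <= c) (e0 : 0 <= e) (ec : e * c ^+ 2 * 100 <= 1).
Hypotheses (cg : continuous g) (ge : forall y, `|g y| <= e).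
Hypothesis g0 : forall y, c <= y -> g y = 0.

Implicit Types (q : R -> R) (B : R -> R -> R).

Let c0 : 0 < c. Proof. exact: lt_le_trans c1. Qed.

(* Clamping the arguments to [0, c] makes all functions continuous on the whole plane. *)
Definition clamp (x : R) := Num.min (Num.max x 0) c.

Lemma clampP x : 0 <= clamp x <= c.
Proof.
rewrite /clamp; apply/andP; split; last by rewrite ge_min lexx orbT.
by rewrite le_min le_max lexx orbT ltW.
Qed.

Lemma clamp_id x : 0 <= x <= c -> clamp x = x.
Proof. by move=> /andP[x0 xc]; rewrite /clamp max_l// min_l. Qed.

Lemma clamp_ge x : c <= x -> clamp x = c.
Proof. by move=> cx; rewrite /clamp max_l ?min_r// (le_trans _ cx)// ltW. Qed.

Lemma cont_clamp : continuous clamp.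
Proof.
move=> x.
have h : {for x, continuous ((fun y : R => Num.max y 0) \min (fun=> c))}.
  apply: continuous_min; last exact: cvg_cst.
  by apply: continuous_max; [exact: cvg_id|exact: cvg_cst].
exact: h.
Qed.

(** Clamping respects the region [c <= x + t] where the kernel must vanish, so that the support
    condition is preserved by [Phi]. *)
Lemma clamp_sum x t : 0 <= x -> 0 <= t -> c <= x + t -> c <= clamp x + clamp t.
Proof.
move=> x0 t0 xt; have /andP[cx0 _] := clampP x; have /andP[ct0 _] := clampP t.
have [cx|xc] := leP c x; first by rewrite clamp_ge// lerDl.
have [ct|tc] := leP c t; first by rewrite (clamp_ge ct) lerDr.
by rewrite !clamp_id// ?x0 ?t0/= ltW.
Qed.

(* In the representation psi = e^{ikx} (1 + int_0^c B(x,t) e^{2ikt} dt) of the Jost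
   solution, [dkernel q B x t] is minus the x-derivative of [B x t]. *)
Definition dkernel (q : R -> R) (B : R -> R -> R) x t :=
  q (x + t) + int 0 t (fun r => q (x + r) * B (x + r) (t - r)).

Lemma cont_dkernel_integrand q B : continuous q -> cont2 B ->
  cont2 (fun (p : R * R) r => q (p.1 + r) * B (p.1 + r) (p.2 - r)).
Proof.
move=> cq cB.
have c1r : continuous (fun p : R * R * R => p.1.1 + p.2).
  by apply: cont_add; [apply: cont_comp; exact: cont_fst|exact: cont_snd].
apply: cont_mul; first exact: cont_comp c1r cq.
apply: (cont2_comp (v := fun p : R * R * R => p.1.2 - p.2) cB) => //.
apply: cont_sub; last exact: cont_snd.
by apply: cont_comp; [exact: cont_fst|exact: cont_snd].
Qed.

Lemma cont_dkernel q B : continuous q -> cont2 B -> cont2 (dkernel q B).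
Proof.
move=> cq cB; apply: cont_add.
  by apply: (cont_comp _ cq); apply: cont_add; [exact: cont_fst|exact: cont_snd].
apply: (cont_int (f := fun (p : R * R) r => q (p.1 + r) * B (p.1 + r) (p.2 - r))).
- exact: cont_dkernel_integrand.
- exact: cont_cst.
- exact: cont_snd.
Qed.

(** A potential and a kernel form one real function on a disjoint sum, so that a single contraction
    solves for both. *)
Let T := (R + R * R)%type.
Implicit Types u v : T -> R.
Let Q u (y : R) := u (inl y).
Let K u (x t : R) := u (inr (x, t)).

(** The first case solves the boundary condition at [x = 0], namely that [dkernel q B 0 y] equals
    [g y] plus the integral of [q s * B s y], for [q y]. The second integrates the [x]-derivative of
    the kernel back from [x = c], where the kernel vanishes. *)
Let Phi u (t : T) : R := match t with
  | inl y => g y + int 0 c (fun s => Q u s * K u s (clamp y))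
             - int 0 (clamp y) (fun s => Q u s * K u s (clamp y - s))
  | inr p => int (clamp p.1) c (fun s => dkernel (Q u) (K u) s (clamp p.2))
  end.

(* The weight of the kernel makes [Phi] contract with rate 5/8. *)
Let wt (t : T) : R := if t is inl _ then 1 else 3 * c.

(** With these bounds every integral of a product [q * B] over a part of [[0, c]] is at most
    [2e / (4c) * c = e / 2]. Hence the new potential is at most [e + e/2 + e/2 = 2e], and the new
    kernel at most [(5/2) e c], which is below [1 / (4c)] as soon as [10 e c^2 <= 1]. *)
Let S : set (T -> R) := [set u |
  [/\ continuous (Q u) /\ cont2 (K u),
      forall y, `|Q u y| <= 2 * e,
      forall x t, `|K u x t| <= (4 * c)^-1,
      forall y, c <= y -> Q u y = 0 &
      forall x t, 0 <= x -> 0 <= t -> c <= x + t -> K u x t = 0]].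

Let cont_conv q B y : continuous q -> cont2 B -> continuous (fun s : R => q s * B s (y - s)).
Proof.
move=> cq cB; apply: cont_mul => //.
apply: (cont2_comp (u := fun s : R => s) (v := fun s => y - s) cB); first exact: cont_id.
by apply: cont_sub; [exact: cont_cst|exact: cont_id].
Qed.

Let cont_prod q B y : continuous q -> cont2 B -> continuous (fun s : R => q s * B s y).
Proof.
move=> cq cB; apply: cont_mul => //.
by apply: (cont2_comp (u := fun s : R => s) cB); [exact: cont_id|exact: cont_cst].
Qed.

Let cont_dk q B x y : continuous q -> cont2 B ->
  continuous (fun r : R => q (x + r) * B (x + r) (y - r)).
Proof.
move=> cq cB.
exact: (@cont2_slice _ _ _ (x, y) (cont_dkernel_integrand cq cB)).
Qed.

Let bound_prod u x t : S u -> `|Q u x * K u x t| <= 2 * e * (4 * c)^-1.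
Proof. by move=> [_ q1 b1 _ _]; rewrite normrM ler_pM. Qed.

Let S_Phi u : S u -> S (Phi u).
Proof.
move=> Su; have [[cq cB] q1 b1 q2 b2] := Su.
have e4 : 2 * e * (4 * c)^-1 * c = e / 2 by field; exact: lt0r_neq0.
have p0 : 0 <= 2 * e * (4 * c)^-1 by rewrite !mulr_ge0// invr_ge0 ltW// mulr_gt0.
split.
- split.
    apply: cont_sub.
      apply: cont_add => //.
      apply: (cont_int (f := fun y s => Q u s * K u s (clamp y))); try exact: cont_cst.
      apply: cont_mul; first by apply: (cont_comp _ cq); exact: cont_snd.
      apply: (cont2_comp (u := fun p : R * R => p.2) (v := fun p => clamp p.1) cB).
        exact: cont_snd.
      by apply: cont_comp; [exact: cont_fst|exact: cont_clamp].
    apply: (cont_int (f := fun y s => Q u s * K u s (clamp y - s))); last first.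
    + exact: cont_clamp.
    + exact: cont_cst.
    apply: cont_mul; first by apply: (cont_comp _ cq); exact: cont_snd.
    apply: (cont2_comp (u := fun p : R * R => p.2) (v := fun p => clamp p.1 - p.2) cB).
      exact: cont_snd.
    apply: cont_sub; last exact: cont_snd.
    by apply: cont_comp; [exact: cont_fst|exact: cont_clamp].
  apply: (cont_int (f := fun (p : R * R) s => dkernel (Q u) (K u) s (clamp p.2))).
  + apply: (cont2_comp (u := fun p : R * R * R => p.2) (v := fun p => clamp p.1.2)).
    * exact: cont_dkernel.
    * exact: cont_snd.
    * apply: (cont_comp _ cont_clamp).
      by apply: cont_comp; [exact: cont_fst|exact: cont_snd].
  + by apply: cont_comp; [exact: cont_fst|exact: cont_clamp].
  + exact: cont_cst.
- move=> y; rewrite /Q /=; have /andP[k0 kc] := clampP y.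
  have h1 : `|int 0 c (fun s => Q u s * K u s (clamp y))| <= e / 2.
    apply: le_trans (int_norm_bound (M := 2 * e * (4 * c)^-1) _ (ltW c0) _) _.
    + exact: cont_prod.
    + by move=> x _; exact: bound_prod.
    + by rewrite -e4 subr0.
  have h2 : `|int 0 (clamp y) (fun s => Q u s * K u s (clamp y - s))| <= e / 2.
    apply: le_trans (int_norm_bound (M := 2 * e * (4 * c)^-1) _ k0 _) _.
    + exact: cont_conv.
    + by move=> x _; exact: bound_prod.
    + by rewrite -e4 subr0 ler_wpM2l.
  have h3 := ge y.
  move: h1 h2 h3; rewrite !ler_norml; lra.
- move=> x t; rewrite /K /=.
  have /andP[k0 kc] := clampP x; have /andP[l0 lc] := clampP t.
  have h s : `|dkernel (Q u) (K u) s (clamp t)| <= 5 / 2 * e.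
    have h2 : `|int 0 (clamp t) (fun r => Q u (s + r) * K u (s + r) (clamp t - r))| <= e / 2.
      apply: le_trans (int_norm_bound (M := 2 * e * (4 * c)^-1) _ l0 _) _.
      + exact: cont_dk.
      + by move=> r _; exact: bound_prod.
      + by rewrite -e4 subr0 ler_wpM2l.
    have h3 := q1 (s + clamp t).
    by rewrite /dkernel; move: h2 h3; rewrite !ler_norml; lra.
  apply: le_trans (int_norm_bound (M := 5 / 2 * e) _ kc _) _.
  + by apply: (@cont2_slice _ _ (fun t s => dkernel (Q u) (K u) s t)); exact/cont2_swap/cont_dkernel.
  + by move=> s _; exact: h.
  + apply: (@le_trans _ _ (5 / 2 * e * c)).
      by apply: ler_wpM2l; [rewrite mulr_ge0|rewrite lerBlDr lerDl].
    rewrite -ler_pdivlMr// -invfM.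
    have -> : 4 * c * c = 4 * c ^+ 2 by ring.
    have c2 : 0 < 4 * c ^+ 2 by rewrite mulr_gt0// exprn_gt0.
    rewrite -[leRHS]mul1r ler_pdivlMr//.
    have : 0 <= e * c ^+ 2 by rewrite mulr_ge0// exprn_ge0// ltW.
    by move: ec; lra.
- move=> y cy; rewrite /Q /= (g0 cy) clamp_ge//.
  have -> : int 0 c (fun s => Q u s * K u s c) = int 0 c (fun=> 0).
    apply: eq_int; [exact: cont_prod|exact: cont_cst|exact: ltW|].
    by move=> x /andP[x0 _]; rewrite b2 ?mulr0// ?lerDr// ltW.
  have -> : int 0 c (fun s => Q u s * K u s (c - s)) = int 0 c (fun=> 0).
    apply: eq_int; [exact: cont_conv|exact: cont_cst|exact: ltW|].
    by move=> x /andP[x0 xc]; rewrite b2 ?mulr0// ?subr_ge0// addrC subrK.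
  by rewrite int_cst mul0r; ring.
- move=> x t x0 t0 xt; rewrite /K /=.
  have /andP[k0 kc] := clampP x; have /andP[l0 lc] := clampP t.
  have ct := clamp_sum x0 t0 xt.
  have -> : int (clamp x) c (fun s => dkernel (Q u) (K u) s (clamp t)) = int (clamp x) c (fun=> 0).
    apply: eq_int => //; [|exact: cont_cst|].
      by apply: (@cont2_slice _ _ (fun t s => dkernel (Q u) (K u) s t)); exact/cont2_swap/cont_dkernel.
    move=> s /andP[xs sc].
    have st : c <= s + clamp t by apply: le_trans ct _; rewrite lerD2r.
    rewrite /dkernel q2// add0r.
    rewrite (@eq_int _ _ _ _ (fun=> 0)) ?int_cst ?mul0r//; [exact: cont_dk|exact: cont_cst|].
    move=> r /andP[r0 rt]; rewrite b2 ?mulr0//; [|lra|lra].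
    by rewrite addr_ge0// (le_trans k0).
  by rewrite int_cst mul0r.
Qed.

Let Phi_contr u v d : S u -> S v -> 0 <= d -> (forall t, `|u t - v t| <= d * wt t) ->
  forall t, `|Phi u t - Phi v t| <= 5 / 8 * d * wt t.
Proof.
move=> Su Sv d0 uv; have [[cq cB] q1 b1 _ _] := Su; have [[cq' cB'] q1' b1' _ _] := Sv.
have dQ y : `|Q u y - Q v y| <= d by have := uv (inl y); rewrite mulr1.
have dK x t : `|K u x t - K v x t| <= d * (3 * c) by have := uv (inr (x, t)).
pose P := d * (4 * c)^-1 + 2 * e * (d * (3 * c)).
have dQK x t : `|Q u x * K u x t - Q v x * K v x t| <= P.
  have -> : Q u x * K u x t - Q v x * K v x t =
     (Q u x - Q v x) * K u x t + Q v x * (K u x t - K v x t) by ring.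
  by apply: le_trans (ler_normD _ _) _; rewrite !normrM lerD// ler_pM.
have P0 : 0 <= P by apply: le_trans (dQK 0 0); exact: normr_ge0.
(* [P] bounds the change of a product [q * B], and [e * c ^+ 2 <= 1 / 100] turns [P * c] into at
   most [(1/4 + 6/100) d]. The potential contains two such integrals, and [62/100 < 5/8]; the kernel
   requires [131/100 * c <= 5/8 * (3 * c)]. *)
have cP : P * c <= 31 / 100 * d.
  have -> : P * c = d / 4 + 6 * (e * c ^+ 2) * d.
    by rewrite /P; field; exact: lt0r_neq0.
  have : 0 <= (1 - e * c ^+ 2 * 100) * d by rewrite mulr_ge0// subr_ge0.
  by lra.
have cPb y : 0 <= y <= c -> P * (y - 0) <= 31 / 100 * d.
  by move=> /andP[y0 yc]; apply: le_trans cP; rewrite subr0 ler_wpM2l.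
case=> [y|[x t]] /=.
- have /andP[k0 kc] := clampP y.
  have h1 : `|int 0 c (fun s => Q u s * K u s (clamp y)) -
              int 0 c (fun s => Q v s * K v s (clamp y))| <= 31 / 100 * d.
    rewrite -intB; try exact: cont_prod.
    apply: le_trans (int_norm_bound (M := P) _ (ltW c0) _) _.
    + by apply: cont_sub; exact: cont_prod.
    + by move=> s _; exact: dQK.
    + by apply: cPb; rewrite lexx ltW.
  have h2 : `|int 0 (clamp y) (fun s => Q u s * K u s (clamp y - s)) -
              int 0 (clamp y) (fun s => Q v s * K v s (clamp y - s))| <= 31 / 100 * d.
    rewrite -intB; try exact: cont_conv.
    apply: le_trans (int_norm_bound (M := P) _ k0 _) _.
    + by apply: cont_sub; exact: cont_conv.
    + by move=> s _; exact: dQK.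
    + by apply: cPb; rewrite k0 kc.
  rewrite mulr1; move: h1 h2; rewrite !ler_norml; lra.
have /andP[k0 kc] := clampP x; have /andP[l0 lc] := clampP t.
have cdk w : S w -> continuous (fun s => dkernel (Q w) (K w) s (clamp t)).
  move=> [[cqw cBw] _ _ _ _].
  by apply: (@cont2_slice _ _ (fun t s => dkernel (Q w) (K w) s t)); exact/cont2_swap/cont_dkernel.
rewrite -intB; try exact: cdk.
apply: le_trans (int_norm_bound (M := 131 / 100 * d) _ kc _) _.
- by apply: cont_sub; exact: cdk.
- move=> s _; rewrite /dkernel.
  have h1 := dQ (s + clamp t).
  have h2 : `|int 0 (clamp t) (fun r => Q u (s + r) * K u (s + r) (clamp t - r)) -
              int 0 (clamp t) (fun r => Q v (s + r) * K v (s + r) (clamp t - r))| <= 31 / 100 * d.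
    rewrite -intB; try exact: cont_dk.
    apply: le_trans (int_norm_bound (M := P) _ l0 _) _.
    + by apply: cont_sub; exact: cont_dk.
    + by move=> r _; exact: dQK.
    + by apply: cPb; rewrite l0 lc.
  by move: h1 h2; rewrite !ler_norml; lra.
- apply: (@le_trans _ _ (131 / 100 * d * c)).
    by apply: ler_wpM2l; [rewrite mulr_ge0|rewrite lerBlDr lerDl].
  have : 0 <= d * c by rewrite mulr_ge0// ltW.
  by lra.
Qed.

Lemma inverse_kernel_exists : exists q B, [/\ continuous q, cont2 B,
  forall y, c <= y -> q y = 0,
  forall x t, 0 <= x -> 0 <= t -> c <= x + t -> B x t = 0 &
  (forall x t, 0 <= x <= c -> 0 <= t <= c -> B x t = int x c (fun s => dkernel q B s t)) /\
  (forall y, 0 <= y <= c ->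
     dkernel q B 0 y = g y + int 0 c (fun s => q s * B s y))].
Proof.
have wt0 t : 0 <= wt t by case: t => //= _; rewrite mulr_ge0// ltW.
have S0 : S (fun=> 0).
  split=> //; first by split; exact: cont_cst.
  - by move=> y; rewrite normr0 mulr_ge0.
  - by move=> x t; rewrite normr0 invr_ge0 ltW// mulr_gt0.
have [] := @contraction_fixpoint R T S Phi wt (3 * (e + 1)) (5 / 8) (fun=> 0).
- by lra.
- exact: wt0.
- by rewrite mulr_ge0// addr_ge0.
- exact: S0.
- exact: S_Phi.
- exact: Phi_contr.
- move=> t; rewrite subr0; have [_ q1 b1 _ _] := S_Phi S0.
  case: t => [y|[x t]] /=.
    by apply: le_trans (q1 y) _; rewrite mulr1; move: e0; lra.
  apply: le_trans (b1 x t) _; apply: (@le_trans _ _ 1).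
    by rewrite invf_le1 ?mulr_gt0//; move: c1; lra.
  have : 0 <= e * c by rewrite mulr_ge0// ltW.
  by move: c1; lra.
- move=> v u Sv uv.
  (* A weighted uniform limit is a uniform limit wherever the weight is bounded, and it is bounded
     on each of the two components. *)
  have cv (A : topologicalType) (h : A -> T) : (forall n, continuous (fun a => v n (h a))) ->
      (exists2 k : R, 0 < k & forall a, wt (h a) <= k) -> continuous (fun a => u (h a)).
    move=> cvh [k k0 hk] a; apply/cvgrPdist_le => d d0.
    have d3 : 0 < d / 3 / k by rewrite !divr_gt0.
    have [N /(_ N _ (leqnn N)) HN] := uv _ d3.
    have d3' : 0 < d / 3 by rewrite divr_gt0.
    have /cvgrPdist_le /(_ _ d3') := cvh N a; apply: filterS => b ab.
    have bb z : `|u (h z) - v N (h z)| <= d / 3.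
      apply: le_trans (HN _) _; apply: (@le_trans _ _ (d / 3 / k * k)).
        by apply: ler_wpM2l; [exact: ltW|exact: hk].
      by rewrite divfK// lt0r_neq0.
    have := bb a; have := bb b; move: ab; rewrite !ler_norml; lra.
  have le_lim t r : (forall n, `|v n t| <= r) -> `|u t| <= r.
    move=> vr; apply/ler_addgt0Pr => d d0.
    have k0 : 0 < wt t + 1 by rewrite ltr_wpDl.
    have d3 : 0 < d / (wt t + 1) by rewrite !divr_gt0.
    have [N /(_ N t (leqnn N)) HN] := uv _ d3.
    have h : d / (wt t + 1) * wt t <= d.
      by rewrite mulrAC ler_pdivrMr// ler_pM2l// lerDl.
    have := vr N; have := le_trans HN h; rewrite !ler_norml; lra.
  have k0 : 0 < 3 * c by rewrite mulr_gt0.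
  split.
  + split.
      apply: (cv _ (fun y => inl y)); first by move=> n; have [[]] := Sv n.
      by exists 1.
    apply: (cv _ (fun p : R * R => inr (p.1, p.2))).
      by move=> n; have [[]] := Sv n.
    by apply: (@ex_intro2 _ _ _ (3 * c) k0) => p; exact: lexx.
  + by move=> y; apply: le_lim => n; have [_ h _ _ _] := Sv n; exact: h.
  + by move=> x t; apply: le_lim => n; have [_ _ h _ _] := Sv n; exact: h.
  + move=> y cy; apply/eqP; rewrite -normr_le0; apply: le_lim => n.
    by have [_ _ _ h _] := Sv n; have := h y cy; rewrite /Q => ->; rewrite normr0.
  + move=> x t x0 t0 xt; apply/eqP; rewrite -normr_le0; apply: le_lim => n.
    by have [_ _ _ _ h] := Sv n; have := h x t x0 t0 xt; rewrite /K => ->; rewrite normr0.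
move=> u [[cq cB] _ _ q2 b2] fu.
exists (Q u), (K u); split => //; split.
  by move=> x t xc tc; rewrite /K -[in LHS]fu /= !clamp_id.
move=> y yc.
have qE : Q u y = g y + int 0 c (fun s => Q u s * K u s y)
             - int 0 y (fun s => Q u s * K u s (y - s)).
  by rewrite {1}/Q -[in LHS]fu /= !clamp_id.
have dE : int 0 y (fun r => Q u (0 + r) * K u (0 + r) (y - r)) =
          int 0 y (fun s => Q u s * K u s (y - s)).
  by congr int; apply/funext => r; rewrite add0r.
by rewrite /dkernel dE add0r qE subrK.
Qed.

End inverse_problem.

(** * The Jost solution *)

Section jost_representation.
Context {R : realType}.
Implicit Types (A g q : R -> R) (B : R -> R -> R) (s z : R[i]) (x y t : R).

Lemma ccont_exp_comp (T : topologicalType) s (f : T -> R) : continuous f ->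
  ccont (fun p => cexp (s * (f p)%:C)).
Proof. by move=> cf; exact: ccont_comp (ccont_exp s). Qed.

Lemma int_lap_integrand a b s (f : R -> R) z : continuous f ->
  (int a b f)%:C * z = cint a b (fun r => (f r)%:C * z).
Proof.
move=> cf; rewrite cintZr; last exact: ccont_real.
congr (_ * _); apply: ceqP => //; rewrite im_cint.
by rewrite (_ : (fun t => im (f t)%:C) = fun=> 0)// int_cst mul0r.
Qed.

Lemma lap_int a b c s (F : R -> R -> R) : cont2 F ->
  lap c (fun t => int a b (F ^~ t)) s = cint a b (fun x => lap c (F x) s).
Proof.
move=> cF; rewrite /lap.
rewrite -(@cint_fubini _ (fun t x => (F x t)%:C * cexp (s * t%:C))); last first.
  apply: ccontM; first exact/ccont_real/cont2_swap.
  exact/ccont_exp_comp/cont_fst.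
congr cint; apply/funext => t; apply: int_lap_integrand => //.
by apply: (@cont2_slice _ _ (fun t x => F x t)); exact: cont2_swap.
Qed.

Variables (c : R) (g q : R -> R) (B : R -> R -> R).
Hypotheses (c0 : 0 < c) (cg : continuous g) (cq : continuous q) (cB : cont2 B).
Hypothesis q0 : forall y, c <= y -> q y = 0.
Hypothesis B0 : forall x t, 0 <= x -> 0 <= t -> c <= x + t -> B x t = 0.
Hypothesis BE : forall x t, 0 <= x <= c -> 0 <= t <= c ->
  B x t = int x c (fun y => dkernel q B y t).
Hypothesis qE : forall y, 0 <= y <= c ->
  dkernel q B 0 y = g y + int 0 c (fun x => q x * B x y).

(* With s = 2ik, [amplitude s x] is e^{-ikx} psi(k,x), and [tail s x] is minus its
   derivative. *)
Definition amplitude s x : R[i] := 1 + lap c (B x) s.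

Lemma amplitude_sub1 s x : amplitude s x - 1 = lap c (B x) s.
Proof. by rewrite /amplitude addrAC subrr add0r. Qed.

Definition tail s x : R[i] :=
  cexp (- s * x%:C) * cint x c (fun y => cexp (s * y%:C) * ((q y)%:C * amplitude s y)).

Lemma ccont_amplitude s : ccont (amplitude s).
Proof.
apply: ccontD; first exact: ccont_cst.
apply: (ccont_cint (f := fun x t => (B x t)%:C * cexp (s * t%:C))); last 2 first.
- exact: cont_cst.
- exact: cont_cst.
by apply: ccontM; [exact: ccont_real|exact/ccont_exp_comp/cont_snd].
Qed.

Lemma ccont_tail_integrand s :
  ccont (fun y => cexp (s * y%:C) * ((q y)%:C * amplitude s y)).
Proof.
apply: ccontM; first exact: ccont_exp.
by apply: ccontM; [exact: ccont_real|exact: ccont_amplitude].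
Qed.

Lemma ccont_tail s : ccont (tail s).
Proof.
apply: ccontM; first exact: ccont_exp.
apply: (ccont_cint (f := fun _ y => cexp (s * y%:C) * ((q y)%:C * amplitude s y))).
- exact: (ccont_comp (f := fun p : R * R => p.2) (@cont_snd _ _) (ccont_tail_integrand s)).
- exact: cont_id.
- exact: cont_cst.
Qed.

Lemma tail_ge s x : c <= x -> tail s x = 0.
Proof.
move=> cx; rewrite /tail -[cint _ _ _]opprK -cintN; last exact: ccont_tail_integrand.
set f := (fun y => _).
have -> : cint x c f = 0; last by rewrite oppr0 mulr0.
have h : cint c x f = cint c x (fun=> 0).
  apply: eq_cint => //; [|exact: ccont_cst|].
    exact/ccontN/ccont_tail_integrand.
  by move=> t /andP[ct _]; rewrite /f (q0 ct) mul0r mulr0 oppr0.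
have h0 : cint c x (fun=> 0 : R[i]) = 0.
  by apply: ceqP; rewrite ?re_cint ?im_cint int_cst mul0r.
by have := cint_chasles c x c f; rewrite cint_xx h h0 add0r.
Qed.

Lemma tail_derivative s x :
  has_derivative (tail s) x (- ((q x)%:C * amplitude s x) - s * tail s x).
Proof.
have cf := ccont_tail_integrand s.
set f := (fun y => _) in cf.
have d1 := has_derivative_cexp (- s) x.
have d2 : has_derivative (fun x => cint x c f) x (- f x).
  have -> : (fun x => cint x c f) = (fun x => - cint c x f).
    apply/funext => y; apply/eqP; rewrite -addr_eq0 cint_chasles; exact/eqP/cint_xx.
  by apply: has_derivativeN; exact: has_derivative_int.
have := has_derivativeM d1 d2.
congr (has_derivative _ _ _).
have e1 : cexp (- s * x%:C) * cexp (s * x%:C) = 1.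
  by rewrite -cexpD mulNr addNr cexp0.
have key (E1 E2 J G : R[i]) : E1 * E2 = 1 ->
    - s * E1 * J + E1 * - (E2 * G) = - G - s * (E1 * J).
  move=> e; have -> : - s * E1 * J + E1 * - (E2 * G) = - ((E1 * E2) * G) - s * (E1 * J) by ring.
  by rewrite e mul1r.
exact: key e1.
Qed.

(** The integral in [dkernel] is a convolution in [t], so its transform is the integral over [r] of
    [q (x + r) * e^{sr} * (amplitude s (x + r) - 1)]. The term [q (x + t)] supplies the missing 1,
    and a shift by [x] gives [tail]. *)
Lemma lap_dkernel s x : 0 <= x <= c -> lap c (dkernel q B x) s = tail s x.
Proof.
move=> /andP[x0 xc].
have cqx : continuous (fun t => q (x + t)).
  by apply: (cont_comp _ cq); apply: cont_add; [exact: cont_cst|exact: cont_id].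
have cBx : cont2 (fun r t => B (x + r) t).
  apply: (cont2_comp (u := fun p : R * R => x + p.1) cB); last exact: cont_snd.
  by apply: cont_add; [exact: cont_cst|exact: cont_fst].
pose f r t : R[i] := (q (x + r) * B (x + r) t)%:C * cexp (s * (r + t)%:C).
have cf : ccont2 f.
  apply: ccontM.
    apply: ccont_real; apply: cont_mul => //.
    by apply: (cont_comp _ cqx); exact: cont_fst.
  by apply: ccont_exp_comp; apply: cont_add; [exact: cont_fst|exact: cont_snd].
have cdk : continuous (fun t => int 0 t (fun r => q (x + r) * B (x + r) (t - r))).
  apply: (cont_int (f := fun t r => q (x + r) * B (x + r) (t - r))); last 2 first.
  - exact: cont_cst.
  - exact: cont_id.
  apply: cont_mul; first by apply: (cont_comp _ cqx); exact: cont_snd.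
  apply: (cont2_comp (u := fun p : R * R => p.2) (v := fun p => p.1 - p.2) cBx).
    exact: cont_snd.
  by apply: cont_sub; [exact: cont_fst|exact: cont_snd].
rewrite (lapD _ _ cqx cdk).
have -> : lap c (fun t => int 0 t (fun r => q (x + r) * B (x + r) (t - r))) s =
    cint 0 c (fun r => (q (x + r))%:C * cexp (s * r%:C) * (amplitude s (x + r) - 1)).
  transitivity (cint 0 c (fun t => cint 0 t (fun r => f r (t - r)))).
    congr cint; apply/funext => t; rewrite int_lap_integrand//.
      by congr cint; apply/funext => r; rewrite /f (addrC r) subrK.
    apply: cont_mul => //.
    apply: (cont2_comp (u := fun r : R => r) (v := fun r => t - r) cBx); first exact: cont_id.
    by apply: cont_sub; [exact: cont_cst|exact: cont_id].
  rewrite cint_fubini_triangle//.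
  have cfr r : ccont (f r) by exact: ccont_slice.
  apply: eq_cint.
  - apply: (ccont_cint (f := f) cf); first exact: cont_cst.
    by apply: cont_sub; [exact: cont_cst|exact: cont_id].
  - apply: ccontM; first exact: ccont_lap.
    apply: ccontB; last exact: ccont_cst.
    apply: (ccont_comp (f := fun r => x + r) _ (ccont_amplitude s)).
    by apply: cont_add; [exact: cont_cst|exact: cont_id].
  - exact: ltW.
  move=> r /andP[r0 rc].
  (* For [t >= c - r] the arguments of the kernel add up to at least [c], so it vanishes there and
     the triangle may be completed to a square. *)
  have -> : cint 0 (c - r) (f r) = cint 0 c (f r).
    rewrite -(cint_chasles 0 (c - r) c).
    have -> : cint (c - r) c (f r) = cint (c - r) c (fun=> 0).
      apply: eq_cint => //; [exact: ccont_cst|by rewrite gerBl|].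
      move=> t /andP[rt tc]; rewrite /f B0 ?mulr0 ?mul0r//.
      + exact: addr_ge0.
      + by apply: le_trans rt; rewrite subr_ge0.
      + by move: x0 rt; lra.
    have -> : cint (c - r) c (fun=> 0 : R[i]) = 0.
      by apply: ceqP; rewrite ?re_cint ?im_cint int_cst mul0r.
    by rewrite addr0.
  rewrite amplitude_sub1 /lap -cintZ; last first.
    by apply: ccont_lap; exact: cont2_slice.
  congr cint; apply/funext => t.
  by rewrite /f rmorphD mulrDr cexpD rmorphM; exact: mulrACA.
rewrite /lap -cintD; last 2 first.
- exact: ccont_lap.
- apply: ccontM; first exact: ccont_lap.
  apply: ccontB; last exact: ccont_cst.
  apply: (ccont_comp (f := fun r => x + r) _ (ccont_amplitude s)).
  by apply: cont_add; [exact: cont_cst|exact: cont_id].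
have cti := ccont_tail_integrand s.
set h := (fun y => _) in cti.
transitivity (cint 0 c (fun t => cexp (- s * x%:C) * h (t + x))).
  congr cint; apply/funext => t.
  have e1 : cexp (- s * x%:C) * cexp (s * x%:C) = 1.
    by rewrite -cexpD mulNr addNr cexp0.
  have e2 : cexp (s * (t + x)%:C) = cexp (s * t%:C) * cexp (s * x%:C).
    by rewrite -cexpD -mulrDr -rmorphD.
  rewrite /h e2 (addrC t x).
  have key (E1 E2 T Q A : R[i]) : E1 * E2 = 1 ->
      Q * T + Q * T * (A - 1) = E1 * (T * E2 * (Q * A)).
    move=> e; have -> : E1 * (T * E2 * (Q * A)) = (E1 * E2) * (Q * T * A) by ring.
    by rewrite e; ring.
  exact: key e1.
rewrite cintZ; last first.
  apply: (ccont_comp (f := fun t => t + x) _ cti).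
  by apply: cont_add; [exact: cont_id|exact: cont_cst].
rewrite cint_shift// /tail; congr (_ * _).
rewrite add0r -(cint_chasles x c (c + x)).
have -> : cint c (c + x) h = cint c (c + x) (fun=> 0).
  apply: eq_cint => //; [exact: ccont_cst|by rewrite lerDl|].
  by move=> t /andP[ct _]; rewrite /h (q0 ct) mul0r mulr0.
have -> : cint c (c + x) (fun=> 0 : R[i]) = 0.
  by apply: ceqP; rewrite ?re_cint ?im_cint int_cst mul0r.
by rewrite addr0.
Qed.

(** Transforming the kernel equation [BE] in [t] gives the Volterra equation of the Jost amplitude;
    beyond [c] both sides equal 1. *)
Lemma amplitudeE s x : 0 <= x -> amplitude s x = 1 + cint x c (tail s).
Proof.
move=> x0; rewrite /amplitude; congr (_ + _).
have cBx : continuous (B x) by exact: cont2_slice.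
have [xc|/ltW cx] := leP x c; last first.
  rewrite (@eq_lap _ _ _ (fun=> 0)) ?lap_cst0//; last 3 first.
  - exact: cont_cst.
  - exact: ltW.
  - by move=> t /andP[t0 _]; rewrite B0// (le_trans cx)// lerDl.
  have : cint c x (tail s) = cint c x (fun=> 0).
    apply: eq_cint => //; [exact: ccont_tail|exact: ccont_cst|].
    by move=> t /andP[ct _]; rewrite tail_ge.
  have -> : cint c x (fun=> 0 : R[i]) = 0.
    by apply: ceqP; rewrite ?re_cint ?im_cint int_cst mul0r.
  move=> h; have := cint_chasles c x c (tail s).
  by rewrite cint_xx h add0r => ->.
have cdk := cont_dkernel cq cB.
rewrite (@eq_lap _ _ _ (fun t => int x c (fun y => dkernel q B y t))); last 4 first.
- exact: cBx.
- apply: (cont_int_cst (f := fun t y => dkernel q B y t)); exact: cont2_swap.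
- exact: ltW.
- by move=> t tc; apply: BE => //; rewrite x0 xc.
rewrite lap_int//; apply: eq_cint => //.
- apply: (ccont_cint (f := fun x t => (dkernel q B x t)%:C * cexp (s * t%:C))); last 2 first.
  + exact: cont_cst.
  + exact: cont_cst.
  by apply: ccontM; [exact: ccont_real|exact/ccont_exp_comp/cont_snd].
- exact: ccont_tail.
- by move=> y /andP[xy yc]; apply: lap_dkernel; rewrite (le_trans x0).
Qed.

(* At s = 0 this gives [int 0 c q = lap c g 0]; so w(k) = 0 as soon as [lap c g s = lap
   c g 0 - s]. *)
Lemma amplitude_at0 s : s * (amplitude s 0 - 1) = lap c g s - (int 0 c q)%:C.
Proof.
have c00 : 0 <= (0 : R) <= c by apply/andP; split => //; exact: ltW.
have cqB : cont2 (fun x t => q x * B x t).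
  by apply: cont_mul => //; apply: (cont_comp _ cq); exact: cont_fst.
have cqa : ccont (fun x => (q x)%:C * amplitude s x).
  by apply: ccontM; [exact: ccont_real|exact: ccont_amplitude].
have t0E : tail s 0 = lap c g s + cint 0 c (fun x => (q x)%:C * amplitude s x) - (int 0 c q)%:C.
  rewrite -lap_dkernel//.
  have cB' : continuous (fun y => int 0 c (fun x => q x * B x y)).
    by apply: (cont_int_cst (f := fun y x => q x * B x y)); exact: cont2_swap.
  rewrite (@eq_lap _ _ _ (fun y => g y + int 0 c (fun x => q x * B x y))); last 4 first.
  - exact/cont2_slice/cont_dkernel.
  - exact: cont_add.
  - exact: ltW.
  - exact: qE.
  rewrite lapD// lap_int// -addrA; congr (_ + _).
  have -> : (int 0 c q)%:C = cint 0 c (fun x => (q x)%:C).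
    by have := @int_lap_integrand 0 c s q 1 cq; rewrite mulr1 => ->; congr cint; apply/funext => t; rewrite mulr1.
  rewrite -cintB//; last exact: ccont_real.
  congr cint; apply/funext => x.
  rewrite -[X in _ - X]mulr1 -mulrBr amplitude_sub1.
  by rewrite lapZ//; exact: cont2_slice.
have ct := ccont_tail s.
have cst' : ccont (fun x => s * tail s x) by apply: ccontM => //; exact: ccont_cst.
(* Integrating [tail_derivative] over [[0, c]] produces the same integral of [q * amplitude] as
   [t0E], and the two cancel; the boundary condition [qE] has the form that makes this happen. *)
have : cint 0 c (fun x => - ((q x)%:C * amplitude s x) - s * tail s x) = - tail s 0.
  rewrite (cint_FTC _ _ (tail_derivative s)); first by rewrite tail_ge// sub0r.
  by apply: ccontB => //; exact: ccontN.
rewrite cintB//; last exact: ccontN.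
have a0 : amplitude s 0 - 1 = cint 0 c (tail s).
  by rewrite amplitudeE// addrAC subrr add0r.
rewrite cintN// cintZ// a0 t0E => h.
have -> : s * cint 0 c (tail s) = - (- cint 0 c (fun x => (q x)%:C * amplitude s x) - s * cint 0 c (tail s)) - cint 0 c (fun x => (q x)%:C * amplitude s x) by ring.
by rewrite h; ring.
Qed.

End jost_representation.

(** * Absolutely continuous functions with derivative zero almost everywhere *)

Section absolutely_continuous_functions.
Context {R : realType}.
Implicit Types (f h g : R -> R) (a b x y z : R).

Local Notation mu := (@lebesgue_measure R).

(** The supremum of the points of [[a, b]] satisfying [P] must be [b], since the local hypothesis
    carries [P] from a point just below the supremum to one beyond it. *)
Lemma real_induction (P : R -> Prop) a b : a <= b -> P a ->
  (forall s, a <= s <= b -> exists2 r : R, 0 < r & forall y z, a <= y -> z <= b ->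
     s - r < y -> y <= s -> s <= z -> z < s + r -> P y -> P z) ->
  P b.
Proof.
move=> ab Pa loc.
pose A : set R := [set x | a <= x <= b /\ P x].
have hA : has_sup A.
  split; first by exists a; split => //; rewrite lexx.
  by exists b => x [/andP[]].
have Aa : A a by split => //; rewrite lexx.
set s := sup A.
have sa : a <= s by apply: ub_le_sup => //; case: hA.
have sb : s <= b by apply: ge_sup; [exists a|move=> x [/andP[]]].
have [|r r0 H] := loc s; first by rewrite sa sb.
have [y [/andP[ay yb] Py] sy] := sup_adherent r0 hA.
have ys : y <= s by apply: ub_le_sup => //; [case: hA|split => //; rewrite ay].
have [bs|lsb] := leP b s.
  have -> : b = s by apply/eqP; rewrite eq_le bs sb.
  by apply: (H y s) => //; rewrite ltrDl.
pose z := Num.min (s + r / 2) b.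
have r2 : 0 < r / 2 by rewrite divr_gt0.
have sz : s < z by rewrite /z lt_min lsb andbT ltrDl.
have zb : z <= b by rewrite /z ge_min lexx orbT.
have Pz : P z.
  apply: (H y z) => //; first exact: ltW.
  by apply: (@le_lt_trans _ _ (s + r / 2)); [rewrite /z ge_min lexx|rewrite ltrD2l; lra].
have : z <= s.
  apply: ub_le_sup; first by case: hA.
  by split => //; rewrite zb andbT (le_trans sa)// ltW.
by rewrite leNgt sz.
Qed.

Lemma abs_continuousB a b f g : abs_continuous a b f -> abs_continuous a b g ->
  abs_continuous a b (fun x => f x - g x).
Proof.
move=> cf cg e e0; have e2 : 0 < e / 2 by rewrite divr_gt0.
have [d1 d10 H1] := cf _ e2; have [d2 d20 H2] := cg _ e2.
exists (Num.min d1 d2); first by rewrite lt_min d10 d20.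
move=> n u v uv tI; rewrite lt_min => /andP[s1 s2].
rewrite [e]splitr; apply: le_lt_trans (ltrD (H1 n u v uv tI s1) (H2 n u v uv tI s2)).
rewrite -big_split; apply: ler_sum => i _ /=.
have -> : f (v i) - g (v i) - (f (u i) - g (u i)) = (f (v i) - f (u i)) - (g (v i) - g (u i)) by ring.
exact: ler_normB.
Qed.

Lemma abs_continuousS a b a' b' f : a <= a' -> b' <= b -> abs_continuous a b f ->
  abs_continuous a' b' f.
Proof.
move=> aa bb cf e e0; have [d d0 H] := cf _ e0; exists d => // n u v uv tI s.
by apply: H => // i; have [h1 h2 h3] := uv i; split => //; [apply: le_trans h1|apply: le_trans h3 _].
Qed.

Lemma abs_continuous_modulus a b f e : abs_continuous a b f -> 0 < e ->
  exists2 d : R, 0 < d & forall x y, a <= x -> x <= y -> y <= b -> y - x < d ->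
    `|f y - f x| < e.
Proof.
move=> cf e0; have [d d0 H] := cf _ e0; exists d => // x y ax xy yb xyd.
have := H 1%N (fun=> x) (fun=> y); rewrite !big_ord_recl !big_ord0 !addr0; apply => //.
by move=> i j _ _ _; rewrite (ord1 i) (ord1 j).
Qed.

Lemma continuous_bounded a b f : continuous f -> a <= b ->
  exists2 K : R, 0 <= K & forall x, a <= x <= b -> `|f x| <= K.
Proof.
move=> cf ab.
have cn : {within `[a, b], continuous (fun x => `|f x|)}.
  by apply: continuous_subspaceT; exact: cont_norm.
have [m _ Hm] := EVT_max ab cn.
exists `|f m| => // x xab; apply: Hm; exact: xab.
Qed.

Lemma abs_continuous_C1 f g a b : (forall x, is_derive x (1 : R) f (g x)) ->
  continuous g -> abs_continuous a b f.
Proof.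
move=> df cg e e0.
have [ba|ab] := ltP b a.
  exists 1 => // -[|n] u v uv _ _; first by rewrite big_ord0.
  have [h1 h2 h3] := uv ord0.
  by have := lt_le_trans ba (le_trans h1 (le_trans h2 h3)); rewrite ltxx.
have [K K0 HK] := continuous_bounded cg ab.
have K1 : 0 < K + 1 by rewrite ltr_wpDl.
exists (e / (K + 1)); first by rewrite divr_gt0.
move=> n u v uv _; rewrite ltr_pdivlMr// mulrC; apply: le_lt_trans.
rewrite mulr_sumr; apply: ler_sum => i _; have [h1 h2 h3] := uv i.
apply: (derive_norm_bound h2 (fun x _ => df x)) => x /andP[ux xv].
apply: le_trans (HK x _) _; last by rewrite lerDl.
by rewrite (le_trans h1)// (le_trans xv).
Qed.

(* Cousin-type covering argument: outside a null set the increments of [h] over short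
   intervals are small, and the null set is covered by an open set of small measure,
   where absolute continuity applies. *)
Lemma abs_continuous_cst h a b : a <= b -> abs_continuous a b h ->
  {ae mu, forall x, a < x < b -> is_derive x (1 : R) h 0} -> h b = h a.
Proof.
move=> ab hac [N [mN N0 NE]].
apply/eqP; rewrite -subr_eq0 -normr_le0.
suff key eta e : 0 < eta -> 0 < e -> `|h b - h a| <= eta * (b - a) + e.
  apply/ler_addgt0Pr => e e0; rewrite add0r.
  have b1 : 0 < b - a + 1 by rewrite ltr_wpDl// subr_ge0.
  have e2 : 0 < e / 2 by rewrite divr_gt0.
  have e3 : 0 < e / 2 / (b - a + 1) by rewrite divr_gt0.
  apply: le_trans (key _ _ e3 e2) _; rewrite [leRHS]splitr lerD2r.
  by rewrite mulrAC ler_pdivrMr// ler_pM2l// lerDl.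
move=> eta0 e0; have [d d0 Hd] := hac _ e0.
(* The derivative is known only inside the interval, so the endpoints join the exceptional set. *)
pose N' := N `|` [set a] `|` [set b].
have mN' : measurable N' by apply: measurableU => //; exact: measurableU.
have N'0 : mu N' = 0.
  have mNa : measurable (N `|` [set a]) by exact: measurableU.
  rewrite /N' measureU0//; last exact: lebesgue_measure_set1.
  by rewrite measureU0//; exact: lebesgue_measure_set1.
have N'y : (mu N' < +oo)%E by rewrite N'0 ltry.
have [U [oU NU Ud]] := lebesgue_regularity_outer mN' N'y d0.
have mU : measurable U by exact: measurable_realfun.open_measurable.
have {}Ud : (mu U < d%:E)%E.
  apply: le_lt_trans Ud; rewrite -[X in (_ <= X)%E]adde0 -N'0.
  by rewrite -{1}(setDUK NU) setUC; apply: measureU2 => //; exact: measurableD.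
pose L x := mu (U `&` `[a, x]).
have mL x : measurable (U `&` `[a, x]) by exact: measurableI.
(* The property propagated from left to right: up to [x], the increment of [h] is paid for by the
   slope [eta] and by finitely many ordered intervals whose total length is at most the measure of
   the part of [U] in [[a, x]]. At [b] this length is below [d], so the intervals cost less than
   [e]. *)
pose P x := exists n (u v : nat -> R),
  [/\ forall i, (i < n)%N -> [/\ a <= u i, u i <= v i & v i <= x],
      forall i j, (i < j < n)%N -> v i <= u j,
      ((\sum_(i < n) (v i - u i))%:E <= L x)%E &
      `|h x - h a| <= eta * (x - a) + \sum_(i < n) `|h (v i) - h (u i)| ].
have Lmono y z : y <= z -> (L y <= L z)%E.
  move=> yz; apply: le_measure; [by apply: mem_set; exact: mL|by apply: mem_set; exact: mL|].
  by apply: setIS; apply: subset_itvl; rewrite bnd_simp.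
have step1 y z : y <= z -> `|h z - h y| <= eta * (z - y) -> P y -> P z.
  move=> yz hzy [n [u [v [H1 H2 H3 H4]]]]; exists n, u, v; split => //.
  - by move=> i /H1[? ? h3]; split => //; exact: le_trans h3 yz.
  - exact: le_trans H3 (Lmono _ _ yz).
  - have -> : h z - h a = (h z - h y) + (h y - h a) by ring.
    apply: le_trans (ler_normD _ _) _; apply: le_trans (lerD hzy H4) _.
    by rewrite le_eqVlt; apply/orP; left; apply/eqP; ring.
(* An interval inside [U] is appended to the list; in [step1] the list stays the same. *)
have step2 y z : a <= y -> y <= z -> `[y, z] `<=` U -> P y -> P z.
  move=> ay yz yzU [n [u [v [H1 H2 H3 H4]]]].
  pose u' i := if (i < n)%N then u i else y.
  pose v' i := if (i < n)%N then v i else z.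
  have sumE (G : R -> R -> R) :
     \sum_(i < n.+1) G (v' i) (u' i) = \sum_(i < n) G (v i) (u i) + G z y.
    rewrite big_ord_recr /= /u' /v' ltnn; congr (_ + _).
    by apply: eq_bigr => i _; rewrite ltn_ord.
  exists n.+1, u', v'; split.
  - move=> i; rewrite ltnS /u' /v'; case: ltnP => [i_n _|_ _]; last by split.
    by have [? ? h3] := H1 i i_n; split => //; exact: le_trans h3 yz.
  - move=> i j /andP[ij]; rewrite ltnS => jn; rewrite /u' /v' (leq_trans ij jn).
    case: ltnP => jn'; first by apply: H2; rewrite ij.
    by have [] := H1 i (leq_trans ij jn).
  - rewrite (sumE (fun x y : R => x - y)) EFinD.
    (* The half-open interval is disjoint from [[a, y]], so the measures add. *)
    have -> : ((z - y)%:E = mu `]y, z])%E.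
      by rewrite lebesgue_measure_itv /= lte_fin lt_neqAle yz andbT; case: eqVneq => //= ->; rewrite subrr.
    apply: le_trans (leeD2r _ H3) _.
    rewrite /L -measureU//; [|exact: mL|].
      apply: le_measure; [by apply: mem_set; apply: measurableU => //; exact: mL|by apply: mem_set; exact: mL|].
      move=> x [[Ux]|] /=; rewrite !in_itv/=.
        by move=> /andP[ax xy]; split => //; rewrite ax (le_trans xy).
      move=> /andP[yx xz]; split; first by apply: yzU; rewrite /= in_itv/= ltW.
      by rewrite (le_trans ay)// ltW.
    apply/seteqP; split => // x [[_ /=]]; rewrite !in_itv/= => /andP[_ xy] /andP[yx _].
    by move: yx; rewrite ltNge xy.
  - rewrite (sumE (fun x y => `|h x - h y|)).
    have -> : h z - h a = (h z - h y) + (h y - h a) by ring.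
    apply: le_trans (ler_normD _ _) _; rewrite addrC addrA; apply: lerD => //.
    apply: le_trans H4 _; rewrite lerD2r ler_wpM2l ?(ltW eta0)//.
    by rewrite lerD2r.
have [n [u [v [H1 H2 H3 H4]]]] : P b.
  apply: (real_induction ab).
    exists 0%N, (fun=> 0), (fun=> 0); split.
    + by [].
    + by move=> i j /andP[].
    + by rewrite big_ord0; exact: measure_ge0.
    + by rewrite big_ord0 !subrr normr0 mulr0 addr0.
  move=> s /andP[sa sb].
  (* Near an exceptional point the interval to be crossed lies in [U]; near any other point the zero
     derivative makes its increment small. *)
  have [sN|sN] := pselect (N' s).
    have /nbhs_ballP[r /= r0 Hr] : nbhs s U by apply: open_nbhs_nbhs; split => //; exact: NU.
    exists r => // y z ay zb sy ys sz zs; apply: step2 => //; first exact: le_trans sz.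
    move=> x; rewrite /= in_itv/= => /andP[yx xz]; apply: Hr; rewrite /ball/= ltr_norml.
    by apply/andP; split; lra.
  have das : is_derive s (1 : R) h 0.
    have sab : a < s < b.
      rewrite !lt_neqAle sa sb !andbT; apply/andP; split; apply/eqP => E; apply: sN.
        by left; right.
      by right.
    by apply: contrapT => nd; apply: sN; left; left; apply: NE => /(_ sab).
  have /is_derive_epsP /(_ eta eta0)[r r0 Hr] := das.
  exists r => // y z ay zb sy ys sz zs; apply: step1 => //; first exact: le_trans sz.
  have h1 := Hr y; have h2 := Hr z.
  have -> : h z - h y = (h z - h s - 0 * (z - s)) - (h y - h s - 0 * (y - s)) by ring.
  apply: le_trans (ler_normB _ _) _.
  apply: le_trans (lerD (h2 _) (h1 _)) _; try by rewrite ltr_norml; apply/andP; split; lra.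
  rewrite (ger0_norm (_ : 0 <= z - s)) ?subr_ge0// distrC (ger0_norm (_ : 0 <= s - y)) ?subr_ge0//.
  by rewrite -mulrDr ler_wpM2l ?(ltW eta0)//; lra.
apply: le_trans H4 _; rewrite lerD2l ltW//.
apply: (Hd n (fun i => u i) (fun i => v i)).
- by move=> i; exact: H1.
- move=> i j _ _ [x [/=]]; rewrite !in_itv/= => /andP[ui iv] /andP[uj jv].
  apply/val_inj/eqP => /=; case: ltngtP => //= ij.
    by have := H2 i j; rewrite ij ltn_ord => /(_ isT); lra.
  by have := H2 j i; rewrite ij ltn_ord => /(_ isT); lra.
- rewrite -lte_fin; apply: le_lt_trans H3 _; apply: le_lt_trans Ud.
  by apply: le_measure; [by apply: mem_set; exact: mL|exact: mem_set|exact: subIsetl].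
Qed.

End absolutely_continuous_functions.

(** * Uniqueness of the Jost solution *)

Section jost_solutions.
Context {R : realType}.
Implicit Types (q f g : R -> R) (k z : R[i]) (psi phi : R -> R[i]) (x y b : R).

Local Notation mu := (@lebesgue_measure R).

Lemma ae_impl (P Q : R -> Prop) : (forall x, P x -> Q x) ->
  {ae mu, forall x, P x} -> {ae mu, forall x, Q x}.
Proof.
move=> PQ [N [mN N0 PN]]; exists N; split => // x nQ.
by apply: PN => /= Px; apply: nQ; exact: PQ.
Qed.

Lemma ae_impl2 (P1 P2 Q : R -> Prop) : (forall x, P1 x -> P2 x -> Q x) ->
  {ae mu, forall x, P1 x} -> {ae mu, forall x, P2 x} -> {ae mu, forall x, Q x}.
Proof.
move=> PQ [N1 [mN1 N10 PN1]] [N2 [mN2 N20 PN2]]; exists (N1 `|` N2); split.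
- exact: measurableU.
- by rewrite measureU0.
- move=> x nQ; have [n1|n1] := pselect (P1 x); last by left; exact: PN1.
  by right; apply: PN2 => /= P2x; apply: nQ; exact: PQ.
Qed.

Lemma has_derivative_locally_ac (F f : R -> R[i]) :
  (forall x, has_derivative F x (f x)) -> ccont f -> locally_abs_continuous F.
Proof.
move=> dF [f1 f2] b b0; split.
  exact: (@abs_continuous_C1 _ (@re R \o F) (fun x => re (f x)) 0 b (fun x => proj1 (dF x)) f1).
exact: (@abs_continuous_C1 _ (@im R \o F) (fun x => im (f x)) 0 b (fun x => proj2 (dF x)) f2).
Qed.

(* Groenwall's inequality for the energy d1^2 + d2^2 + e1^2 + e2^2, run backwards from
   [b]. *)
Lemma linear_system_zero (d1 d2 e1 e2 q : R -> R) (k1 k2 a b : R) : a <= b ->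
  continuous q ->
  (forall x, a <= x <= b -> is_derive x (1 : R) d1 (e1 x)) ->
  (forall x, a <= x <= b -> is_derive x (1 : R) d2 (e2 x)) ->
  (forall x, a <= x <= b -> is_derive x (1 : R) e1 ((q x - k1) * d1 x + k2 * d2 x)) ->
  (forall x, a <= x <= b -> is_derive x (1 : R) e2 ((q x - k1) * d2 x - k2 * d1 x)) ->
  d1 b = 0 -> d2 b = 0 -> e1 b = 0 -> e2 b = 0 ->
  d1 a = 0 /\ d2 a = 0.
Proof.
move=> ab cq dd1 dd2 de1 de2 d1b d2b e1b e2b.
have [K1 K10 HK1] := continuous_bounded cq ab.
pose C := K1 + `|k1| + `|k2|.
have C0 : 0 <= C by rewrite !addr_ge0.
have qC x : a <= x <= b -> `|q x - k1| <= C.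
  move=> xab; apply: le_trans (ler_normB _ _) _; rewrite /C.
  by have := HK1 _ xab; have := normr_ge0 k2; lra.
have kC : `|k2| <= C by rewrite /C; have := normr_ge0 k1; lra.
pose Y x := d1 x * d1 x + d2 x * d2 x + (e1 x * e1 x + e2 x * e2 x).
pose E x := expR ((1 + 2 * C) * x).
pose dY x := (e1 x * d1 x + d1 x * e1 x) + (e2 x * d2 x + d2 x * e2 x) +
  ((((q x - k1) * d1 x + k2 * d2 x) * e1 x + e1 x * ((q x - k1) * d1 x + k2 * d2 x)) +
   (((q x - k1) * d2 x - k2 * d1 x) * e2 x + e2 x * ((q x - k1) * d2 x - k2 * d1 x))).
have dYx x : a <= x <= b -> is_derive x (1 : R) Y (dY x).
  move=> xab.
  have h1 := is_derive_mul (dd1 x xab) (dd1 x xab).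
  have h2 := is_derive_mul (dd2 x xab) (dd2 x xab).
  have h3 := is_derive_mul (de1 x xab) (de1 x xab).
  have h4 := is_derive_mul (de2 x xab) (de2 x xab).
  exact: (is_deriveD (is_deriveD h1 h2) (is_deriveD h3 h4)).
have dEx x : is_derive x (1 : R) E ((1 + 2 * C) * E x).
  have := @is_derive1_comp _ _ _ _ _ _ (is_derive_expR ((1 + 2 * C) * x)) (is_derive_scale (1 + 2 * C) x).
  by rewrite [expR _ * _]mulrC.
have twoab (u v : R) : `|2 * u * v| <= u * u + v * v.
  rewrite ler_norml; apply/andP; split.
    have : 0 <= (u + v) * (u + v) by rewrite -expr2 sqr_ge0.
    by lra.
  have : 0 <= (u - v) * (u - v) by rewrite -expr2 sqr_ge0.
  by lra.
have pab (p u v : R) : `|p| <= C -> - (C * (u * u + v * v)) <= 2 * (p * u) * v.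
  move=> pC; have -> : 2 * (p * u) * v = p * (2 * u * v) by ring.
  have : `|p * (2 * u * v)| <= C * (u * u + v * v) by rewrite normrM ler_pM.
  by rewrite ler_norml => /andP[].
have ab1 (u v : R) : - (u * u + v * v) <= 2 * u * v.
  by have := twoab u v; rewrite ler_norml => /andP[].
(* Each cross term satisfies [2uv >= - (u^2 + v^2)] and its coefficient is at most [C]; every square
   occurs once with coefficient 1 and twice with [C]. Hence [Y * E] is nondecreasing, and since it
   vanishes at [b] it is nonpositive at [a]. *)
have Ybound x : a <= x <= b -> 0 <= dY x + (1 + 2 * C) * Y x.
  move=> xab.
  have h1 := ab1 (d1 x) (e1 x); have h2 := ab1 (d2 x) (e2 x).
  have h3 := pab _ (d1 x) (e1 x) (qC x xab); have h4 := pab _ (d2 x) (e2 x) (qC x xab).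
  have h5 := pab _ (d2 x) (e1 x) kC.
  have kC' : `|- k2| <= C by rewrite normrN.
  have h6 := pab _ (d1 x) (e2 x) kC'.
  by rewrite /dY /Y; lra.
have YE : Y a * E a <= 0.
  have -> : 0 = Y b * E b by rewrite /Y d1b d2b e1b e2b; ring.
  rewrite -subr_ge0.
  have dYE x : a <= x <= b -> is_derive x (1 : R) (fun x => Y x * E x)
      (dY x * E x + Y x * ((1 + 2 * C) * E x)).
    by move=> xab; exact: is_derive_mul (dYx x xab) (dEx x).
  have [] := @MVT_segment _ (fun x => Y x * E x) (fun x => dY x * E x + Y x * ((1 + 2 * C) * E x)) a b ab.
  - by move=> x; rewrite in_itv/= => /andP[ax xb]; apply: dYE; rewrite !ltW.
  - apply: derivable_within_continuous => x; rewrite in_itv/= => axb.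
    exact: (@ex_derive _ _ _ _ _ _ _ (dYE _ axb)).
  move=> x; rewrite in_itv/= => xab ->; rewrite mulr_ge0 ?subr_ge0//.
  have -> : dY x * E x + Y x * ((1 + 2 * C) * E x) = (dY x + (1 + 2 * C) * Y x) * E x by ring.
  by rewrite mulr_ge0 ?expR_ge0//; exact: Ybound.
have Ya : Y a <= 0 by rewrite -(pmulr_lle0 _ (expR_gt0 ((1 + 2 * C) * a))).
have s1 : 0 <= d1 a * d1 a by rewrite -expr2 sqr_ge0.
have s2 : 0 <= d2 a * d2 a by rewrite -expr2 sqr_ge0.
have s3 : 0 <= e1 a * e1 a by rewrite -expr2 sqr_ge0.
have s4 : 0 <= e2 a * e2 a by rewrite -expr2 sqr_ge0.
by split; apply/eqP; rewrite -sqrf_eq0 expr2; apply/eqP; move: Ya; rewrite /Y; lra.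
Qed.

Lemma derive_locally_zero f (X x d : R) : (forall y, X <= y -> f y = 0) -> X < x ->
  is_derive x (1 : R) f d -> d = 0.
Proof.
move=> f0 Xx df.
have df0 : is_derive x (1 : R) f 0.
  apply/is_derive_epsP => e e0; exists (x - X); first by rewrite subr_gt0.
  move=> y; rewrite ltr_norml => /andP[h1 h2]; rewrite !f0; [|lra|lra].
  by rewrite mul0r !subrr normr0 mulr_ge0// ltW.
by rewrite -(@derive_val _ _ _ _ _ _ _ df) (@derive_val _ _ _ _ _ _ _ df0).
Qed.

(** This upgrades an almost everywhere derivative to a derivative everywhere: [e] minus a primitive
    of the continuous [g] is absolutely continuous with derivative zero almost everywhere, hence
    constant. *)
Lemma ac_primitive (e g : R -> R) a b : 0 < a -> a <= b ->
  abs_continuous 0 b e -> e b = 0 ->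
  (forall x, 0 < x -> {for x, continuous g}) ->
  {ae mu, forall x, 0 < x -> is_derive x (1 : R) e (g x)} ->
  exists E, [/\ forall x, a <= x <= b -> E x = e x, E b = 0 &
    forall x, a <= x <= b -> is_derive x (1 : R) E (g x)].
Proof.
move=> a0 ab ace eb cg dae.
(* Freezing [g] to the left of [a] makes it continuous on the whole line, as the primitives
   require. *)
pose ga x := g (Num.max x a).
have cga : continuous ga.
  move=> x; apply: (@continuous_comp _ _ _ (fun x => Num.max x a) g).
    have h : {for x, continuous ((fun y : R => y) \max (fun=> a))}.
      by apply: continuous_max; [exact: cvg_id|exact: cvg_cst].
    exact: h.
  by apply: cg; rewrite lt_max a0 orbT.
have gaE x : a <= x -> ga x = g x by move=> ax; rewrite /ga max_l.
exists (fun x => int b x ga); split; last 2 first.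
- exact: int_xx.
- by move=> x /andP[ax _]; rewrite -(gaE x ax); exact: int_derive.
move=> x /andP[ax xb].
have x0 : 0 < x by exact: lt_le_trans ax.
have h : e b - int b b ga = e x - int b x ga.
  apply: (@abs_continuous_cst _ (fun y => e y - int b y ga) x b) => //.
    apply: abs_continuousB; first by apply: abs_continuousS ace => //; exact: ltW.
    by apply: (abs_continuous_C1 (g := ga)) => // y; exact: int_derive.
  apply: ae_impl dae => y Hy /andP[xy yb].
  have := is_deriveB (Hy (lt_trans x0 xy)) (int_derive b y cga).
  by rewrite gaE ?subrr// (le_trans ax)// ltW.
by move: h; rewrite eb int_xx subrr => /esym/eqP; rewrite subr_eq0 => /eqP.
Qed.

(** The difference of two Jost solutions vanishes for large [x], and the backward Groenwall argument
    carries this down to every [a > 0]. The equation is given on the open half-line, so the value at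
    0 is reached through absolute continuity. *)
Lemma jost_solution_at0 q k psi phi : continuous q ->
  is_jost_solution q k psi -> is_jost_solution q k phi -> psi 0 = phi 0.
Proof.
move=> cq [[dpsi [acp dp acdp aep]] infp] [[dphi [acf df acdf aef]] inff].
pose d x := psi x - phi x; pose e x := dpsi x - dphi x.
have [X X1 d0] : exists2 X : R, 1 <= X & forall x, X <= x -> d x = 0.
  have : \forall x \near +oo, psi x = phi x.
    by apply: filterS2 infp inff => x -> ->.
  move=> [M [_ HM]]; exists (Num.max 1 (M + 1)); first by rewrite le_max lexx.
  move=> x; rewrite ge_max => /andP[_ Mx]; rewrite /d HM ?subrr//.
  by apply: lt_le_trans Mx; rewrite ltrDl.
have dd x : 0 < x -> has_derivative d x (e x).
  by move=> x0; apply: has_derivativeD (dp x x0) (has_derivativeN (df x x0)).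
have ad b : 0 < b -> abs_continuous 0 b (@re R \o d) /\ abs_continuous 0 b (@im R \o d).
  move=> b0; have [p1 p2] := acp b b0; have [f1 f2] := acf b b0; split.
    have -> : @re R \o d = (fun x => re (psi x) - re (phi x)) by apply/funext => x; rewrite /d /= !reimE.
    exact: abs_continuousB.
  have -> : @im R \o d = (fun x => im (psi x) - im (phi x)) by apply/funext => x; rewrite /d /= !reimE.
  exact: abs_continuousB.
have ae b : 0 < b -> abs_continuous 0 b (@re R \o e) /\ abs_continuous 0 b (@im R \o e).
  move=> b0; have [p1 p2] := acdp b b0; have [f1 f2] := acdf b b0; split.
    have -> : @re R \o e = (fun x => re (dpsi x) - re (dphi x)) by apply/funext => x; rewrite /e /= !reimE.
    exact: abs_continuousB.
  have -> : @im R \o e = (fun x => im (dpsi x) - im (dphi x)) by apply/funext => x; rewrite /e /= !reimE.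
  exact: abs_continuousB.
have [kk kkE] : exists kk, kk = k ^+ 2 by exists (k ^+ 2).
pose g x := ((q x)%:C - kk) * d x.
have de : {ae mu, forall x, 0 < x -> has_derivative e x (g x)}.
  apply: ae_impl2 aep aef => x Hp Hf x0.
  have [p2 hp2 ep2] := Hp x0; have [f2 hf2 ef2] := Hf x0.
  have -> : g x = p2 - f2.
    have -> : p2 = (q x)%:C * psi x - kk * psi x by rewrite kkE -ep2 opprD opprK addrCA subrr addr0.
    have -> : f2 = (q x)%:C * phi x - kk * phi x by rewrite kkE -ef2 opprD opprK addrCA subrr addr0.
    have key (a b u v : R[i]) : (a - b) * (u - v) = a * u - b * u - (a * v - b * v) by ring.
    exact: key.
  exact: has_derivativeD hp2 (has_derivativeN hf2).
pose k1 := re kk; pose k2 := im kk.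
have reg x : re (g x) = (q x - k1) * re (d x) + k2 * im (d x).
  by rewrite /g !reimE -/k1 -/k2; ring.
have img x : im (g x) = (q x - k1) * im (d x) - k2 * re (d x).
  by rewrite /g !reimE -/k1 -/k2; ring.
have X0 : 0 < X by exact: lt_le_trans X1.
pose b := X + 1.
have b0 : 0 < b by rewrite addr_gt0.
have Xb : X < b by rewrite ltrDl.
have db0 : d b = 0 by rewrite d0// ltW.
have eb0 : re (e b) = 0 /\ im (e b) = 0.
  have [h1 h2] := dd b b0; split.
    by apply: (derive_locally_zero (f := @re R \o d) _ Xb h1) => y Xy; rewrite /= d0.
  by apply: (derive_locally_zero (f := @im R \o d) _ Xb h2) => y Xy; rewrite /= d0.
have cd x : 0 < x -> {for x, continuous (fun x => re (d x))} /\ {for x, continuous (fun x => im (d x))}.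
  by move=> x0; have [h1 h2] := dd x x0; split; [exact: is_derive_continuous h1|exact: is_derive_continuous h2].
have cg1 x : 0 < x -> {for x, continuous (fun x => re (g x))}.
  move=> x0; have [h1 h2] := cd x x0.
  rewrite (_ : (fun x => re (g x)) = (fun x => (q x - k1) * re (d x) + k2 * im (d x))); last first.
    by apply/funext => y; exact: reg.
  apply: continuousD; apply: continuousM => //; try exact: cvg_cst.
  by apply: continuousB; [exact: cq|exact: cvg_cst].
have cg2 x : 0 < x -> {for x, continuous (fun x => im (g x))}.
  move=> x0; have [h1 h2] := cd x x0.
  rewrite (_ : (fun x => im (g x)) = (fun x => (q x - k1) * im (d x) - k2 * re (d x))); last first.
    by apply/funext => y; exact: img.
  apply: continuousB; apply: continuousM => //; try exact: cvg_cst.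
  by apply: continuousB; [exact: cq|exact: cvg_cst].
have da0 a : 0 < a -> a <= b -> re (d a) = 0 /\ im (d a) = 0.
  move=> a0 ab.
  have [E1 [E1e E1b dE1]] : exists E, [/\ forall x, a <= x <= b -> E x = re (e x), E b = 0 &
    forall x, a <= x <= b -> is_derive x (1 : R) E (re (g x))].
    apply: (ac_primitive (e := @re R \o e) a0 ab) => //.
    + by have [] := ae b b0.
    + by have [] := eb0.
    + by apply: ae_impl de => x Hx x0; have [] := Hx x0.
  have [E2 [E2e E2b dE2]] : exists E, [/\ forall x, a <= x <= b -> E x = im (e x), E b = 0 &
    forall x, a <= x <= b -> is_derive x (1 : R) E (im (g x))].
    apply: (ac_primitive (e := @im R \o e) a0 ab) => //.
    + by have [] := ae b b0.
    + by have [] := eb0.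
    + by apply: ae_impl de => x Hx x0; have [] := Hx x0.
  apply: (@linear_system_zero (@re R \o d) (@im R \o d) E1 E2 q k1 k2 a b) => //.
  - by move=> x xab; rewrite E1e//; have [] := dd x (lt_le_trans a0 (proj1 (andP xab))).
  - by move=> x xab; rewrite E2e//; have [] := dd x (lt_le_trans a0 (proj1 (andP xab))).
  - by move=> x xab; rewrite -reg; exact: dE1.
  - by move=> x xab; rewrite -img; exact: dE2.
  - by rewrite /= db0.
  - by rewrite /= db0.
have zero f : abs_continuous 0 b f -> (forall a, 0 < a -> a <= b -> f a = 0) -> f 0 = 0.
  move=> acF F0; apply/eqP; rewrite -normr_le0; apply/ler_addgt0Pr => r r0; rewrite add0r.
  have [t t0 Ht] := abs_continuous_modulus acF r0.
  pose y := Num.min (t / 2) b.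
  have t2 : 0 < t / 2 by rewrite divr_gt0.
  have y0 : 0 < y by rewrite lt_min t2 b0.
  have yb : y <= b by rewrite ge_min lexx orbT.
  have yt : y - 0 < t.
    by rewrite subr0; apply: (@le_lt_trans _ _ (t / 2)); [rewrite ge_min lexx|lra].
  have := Ht 0 y (lexx _) (ltW y0) yb yt.
  by rewrite F0// sub0r normrN => /ltW.
have [ad1 ad2] := ad b b0.
apply/eqP; rewrite -subr_eq0; apply/eqP; apply: ceqP.
  by apply: (zero (@re R \o d)) => // a a0 ab; have [] := da0 a a0 ab.
by apply: (zero (@im R \o d)) => // a a0 ab; have [] := da0 a a0 ab.
Qed.

End jost_solutions.

(** * The Jost function of the constructed potential *)

Section jost_existence.
Context {R : realType}.
Variables (c : R) (g q : R -> R) (B : R -> R -> R).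
Hypotheses (c0 : 0 < c) (cg : continuous g) (cq : continuous q) (cB : cont2 B).
Hypothesis q0 : forall y, c <= y -> q y = 0.
Hypothesis B0 : forall x t, 0 <= x -> 0 <= t -> c <= x + t -> B x t = 0.
Hypothesis BE : forall x t, 0 <= x <= c -> 0 <= t <= c ->
  B x t = int x c (fun y => dkernel q B y t).
Hypothesis qE : forall y, 0 <= y <= c ->
  dkernel q B 0 y = g y + int 0 c (fun x => q x * B x y).
Implicit Types (k : R[i]) (x : R).

Let s k : R[i] := 'i%C * k + 'i%C * k.
(** On the half-line this is [amplitude], by [amplitudeE]; the integral form is differentiable on
    the whole line. *)
Let m k x := 1 + cint x c (tail c q B (s k)).
Let psi k x := cexp ('i%C * k * x%:C) * m k x.

Lemma jost_solutionP k : is_jost_solution q k (psi k).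
Proof.
have ct := ccont_tail c cq cB (s k).
set z := 'i%C * k.
have z2 : z * z = - (k ^+ 2).
  have i2 : ('i%C * 'i%C : R[i]) = - 1 by apply: ceqP; rewrite !reimE /re /im /=; ring.
  have -> : z * z = ('i%C * 'i%C) * (k * k) by rewrite /z; ring.
  by rewrite i2 mulN1r expr2.
have dm x : has_derivative (m k) x (- tail c q B (s k) x).
  have -> : m k = fun x => 1 + - cint c x (tail c q B (s k)).
    apply/funext => y; rewrite /m; congr (_ + _); apply/eqP.
    by rewrite -addr_eq0 cint_chasles; exact/eqP/cint_xx.
  rewrite -[X in has_derivative _ _ X]add0r.
  apply: has_derivativeD; first exact: has_derivative_cst.
  by apply: has_derivativeN; exact: has_derivative_int.
have dE x := has_derivative_cexp z x.
pose dpsi x := cexp (z * x%:C) * (z * m k x - tail c q B (s k) x).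
(* The terms in [tail] cancel because the exponent of the transform is [s = 2z]. *)
pose ddpsi x := cexp (z * x%:C) * (z * z * m k x + (q x)%:C * amplitude c B (s k) x).
have d1 x : has_derivative (psi k) x (dpsi x).
  have := has_derivativeM (dE x) (dm x); congr (has_derivative _ _ _).
  by rewrite /dpsi; ring.
have d2 x : has_derivative dpsi x (ddpsi x).
  have h1 := has_derivativeM (has_derivative_cst z x) (dm x).
  have h2 := has_derivativeD h1 (has_derivativeN (tail_derivative c cq cB (s k) x)).
  have := has_derivativeM (dE x) h2; congr (has_derivative _ _ _).
  by rewrite /ddpsi /s -/z; ring.
have cm : ccont (m k).
  apply: ccontD; first exact: ccont_cst.
  apply: (ccont_cint (f := fun _ y => tail c q B (s k) y)); last 2 first.
  - exact: cont_id.
  - exact: cont_cst.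
  exact: (ccont_comp (f := fun p : R * R => p.2) (@cont_snd _ _) ct).
have cz := ccont_exp z.
have zm : ccont (fun x => z * m k x) by apply: ccontM => //; exact: ccont_cst.
have zzm : ccont (fun x => z * z * m k x) by apply: ccontM => //; exact: ccont_cst.
split.
  exists dpsi; split.
  - apply: has_derivative_locally_ac d1 _.
    by apply: ccontM => //; exact: ccontB.
  - by move=> x _; exact: d1.
  - apply: has_derivative_locally_ac d2 _.
    apply: ccontM => //; apply: ccontD => //.
    by apply: ccontM; [exact: ccont_real|exact: ccont_amplitude].
  - apply: aeW => x x0; exists (ddpsi x); first exact: d2.
    rewrite /ddpsi /psi -/z z2 (amplitudeE c0 cq cB q0 B0 BE (s k) (ltW x0)) -/(m k x).
    by ring.
exists c; split; first by rewrite num_real.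
move=> x /ltW cx; rewrite /psi -/z.
have : m k x = 1; last by move=> ->; rewrite mulr1.
rewrite -[RHS](addr0 1) /m; congr (_ + _).
have h : cint c x (tail c q B (s k)) = 0.
  rewrite (@eq_cint _ _ _ _ (fun=> 0))//; [|exact: ccont_cst|].
    by apply: ceqP; rewrite ?re_cint ?im_cint int_cst mul0r.
  by move=> t /andP[ct' _]; rewrite tail_ge.
by have := cint_chasles c x c (tail c q B (s k)); rewrite cint_xx h add0r.
Qed.

(** The definite description selects some Jost solution; existence rules out the default, and
    uniqueness at 0 fixes the value. *)
Lemma jost_functionE k : jost_function q k = 1 + lap c (B 0) (s k).
Proof.
have -> : jost_function q k = psi k 0.
  rewrite /jost_function /jost_solution; case: xgetP => [f _ /= Hf|].
    exact: jost_solution_at0 cq Hf (jost_solutionP k).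
  by move=> /(_ (psi k)) []; exact: jost_solutionP.
rewrite /psi mulr0 cexp0 mul1r.
by rewrite /m -(amplitudeE c0 cq cB q0 B0 BE (s k) (lexx 0)).
Qed.

Lemma continuous_compactly_supported_L1 : compactly_supported_L1 q.
Proof.
split.
  have iq : lebesgue_measure.-integrable `[0, c] (EFin \o q).
    apply: continuous_compact_integrable; first exact: segment_compact.
    exact: continuous_subspaceT.
  have E : `[0, +oo[%classic `&` `[0, c]%classic = `[0, c]%classic :> set R.
    by apply: setIidr => x; rewrite /= !in_itv/= andbT => /andP[].
  have mE : measurable (`[0, +oo[ : set R) by exact: measurable_itv.
  have mc : measurable (`[0, c] : set R) by exact: measurable_itv.
  have := integrable_restrict lebesgue_measure mc mE (EFin \o q).
  rewrite E => -[/(_ iq) h _]; apply: eq_integrable h => // x; rewrite inE /= in_itv/= andbT => x0.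
  rewrite /patch; case: ifPn => // /negP xc; rewrite /= q0//.
  rewrite leNgt; apply/negP => xltc; apply: xc; rewrite inE /= in_itv/= x0 ltW//.
apply: (@subclosed_compact _ _ `[0, c]).
- exact: closed_closure.
- exact: segment_compact.
- have cl : closed (`[0, c] : set R) by exact: interval_closed.
  rewrite [X in _ `<=` X](proj1 (closure_id _) cl); apply: closure_subset => x /= [x0 qx].
  rewrite in_itv/= x0 /= leNgt; apply/negP => /ltW /q0 E.
  by rewrite E eqxx in qx.
Qed.

End jost_existence.

Lemma potential_of_density (R : realType) (c e : R) (g : R -> R) :
  1 <= c -> 0 <= e -> e * c ^+ 2 * 100 <= 1 ->
  continuous g -> (forall y, `|g y| <= e) -> (forall y, c <= y -> g y = 0) ->
  lap c g 0 = 0 ->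
  exists2 q : R -> R, compactly_supported_L1 q &
    forall k : R[i], 'i%C * k + 'i%C * k != 0 ->
      lap c g ('i%C * k + 'i%C * k) = - ('i%C * k + 'i%C * k) -> jost_function q k = 0.
Proof.
move=> c1 e0 ec cg ge g0 lg0.
have c0 : 0 < c by exact: lt_le_trans c1.
have [q [B [cq cB q0 B0 [BE qE]]]] := inverse_kernel_exists c1 e0 ec cg ge g0.
exists q; first exact: continuous_compactly_supported_L1 cq q0.
move=> k; have := jost_functionE c0 cq cB q0 B0 BE k.
set s := 'i%C * k + 'i%C * k => jE s0 lgs.
have a0 := amplitude_at0 c0 cg cq cB q0 B0 BE qE.
(* At [s = 0] the identity says that [q] has integral zero; at a prescribed point it then reads
   [s * (amplitude - 1) = - s]. *)
have := a0 0; rewrite mul0r lg0 sub0r => /esym/eqP; rewrite oppr_eq0 => /eqP q0'.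
have := a0 s; rewrite q0' subr0 lgs => as0.
rewrite jE -[LHS]/(amplitude c B s 0); apply/eqP.
have : s * amplitude c B s 0 = 0.
  have key (u v : R[i]) : u * (v - 1) = - u -> u * v = 0.
    move=> h; have -> : u * v = u * (v - 1) + u by ring.
    by rewrite h addNr.
  exact: key as0.
by move/eqP; rewrite mulf_eq0 (negbTE s0).
Qed.

(** * Polynomial multiples of the form 1 + small *)

Section small_multiples.
Context {R : realType}.
Implicit Types (l : seq (R * R)) (p G H : {poly R}) (K : R).

Definition quad (bd : R * R) : {poly R} := 1 + bd.1 *: 'X + bd.2 *: 'X^2.

Definition quads l : {poly R} := \prod_(bd <- l) quad bd.

(** These bounds hold for a conjugate pair of roots of modulus at least 8: the coefficients are then
    [- 2 re z / |z|^2] and [1 / |z|^2]. *)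
Definition small_quad (bd : R * R) := (`|bd.1| <= 1 / 4) && (`|bd.2| <= 1 / 64).

Lemma coef_quadM bd G k : (quad bd * G)`_k =
  G`_k + bd.1 * (if (k < 1)%N then 0 else G`_(k - 1)) +
  bd.2 * (if (k < 2)%N then 0 else G`_(k - 2)).
Proof.
rewrite /quad !mulrDl mul1r -!scalerAl !coefD !coefZ -['X]expr1.
by rewrite (mulrC 'X^1) (mulrC 'X^2) !coefMXn.
Qed.

Lemma mul_div_pow2_ge0 (a K : R) k : 0 <= a -> 0 <= K -> 0 <= a * K / 2 ^+ k.
Proof. by move=> a0 K0; apply: divr_ge0; [exact: mulr_ge0|exact: exprn_ge0]. Qed.

(** In the weight [2 ^- k] a shift by one costs 2 and a shift by two costs 4, so each factor
    multiplies the bound by at most [1 + 2/4 + 4/64 < 2]. *)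
Lemma coef_quadsM_bound l G K : all small_quad l ->
  (forall k, `|G`_k| <= K / 2 ^+ k) ->
  forall k, `|(quads l * G)`_k| <= K * 2 ^+ size l / 2 ^+ k.
Proof.
move=> + GK; elim: l => [_ k|bd l IH /= /andP[/andP[hb hd] /IH{}IH] k].
  by rewrite /quads big_nil mul1r mulr1.
rewrite /quads big_cons -mulrA coef_quadM; set F := _ * G in IH *.
have K0 : 0 <= K * 2 ^+ size l.
  by have := IH 0%N; rewrite expr0 divr1; exact: le_trans.
set K' := K * 2 ^+ size l in IH K0 *.
have h1 : `|if (k < 1)%N then 0 else F`_(k - 1)| <= 2 * K' / 2 ^+ k.
  case: k => [|k]; first by rewrite normr0 mul_div_pow2_ge0.
  rewrite ltnS ltn0 subn1 /=; apply: le_trans (IH k) _.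
  have e2 : 2 ^+ k != 0 :> R by rewrite expf_neq0.
  by rewrite exprS le_eqVlt; apply/orP; left; apply/eqP; field.
have h2 : `|if (k < 2)%N then 0 else F`_(k - 2)| <= 4 * K' / 2 ^+ k.
  case: k {h1} => [|[|k]]; try by rewrite normr0 mul_div_pow2_ge0.
  rewrite !ltnS ltn0 subn2 /=; apply: le_trans (IH k) _.
  have e2 : 2 ^+ k != 0 :> R by rewrite expf_neq0.
  by rewrite !exprS le_eqVlt; apply/orP; left; apply/eqP; field.
have h3 : `|bd.1 * (if (k < 1)%N then 0 else F`_(k - 1))| <= 1 / 4 * (2 * K' / 2 ^+ k).
  by rewrite normrM ler_pM.
have h4 : `|bd.2 * (if (k < 2)%N then 0 else F`_(k - 2))| <= 1 / 64 * (4 * K' / 2 ^+ k).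
  by rewrite normrM ler_pM.
apply: le_trans (ler_normD _ _) _; apply: le_trans (lerD (ler_normD _ _) (lexx _)) _.
apply: le_trans (lerD (lerD (IH k) h3) h4) _.
have -> : K * 2 ^+ (size l).+1 / 2 ^+ k = 2 * (K' / 2 ^+ k) by rewrite /K' exprS; ring.
have : 0 <= K' / 2 ^+ k by apply: divr_ge0 => //; exact: exprn_ge0.
set w := K' / 2 ^+ k.
have -> : 2 * K' / 2 ^+ k = 2 * w by rewrite /w; ring.
have -> : 4 * K' / 2 ^+ k = 4 * w by rewrite /w; ring.
by lra.
Qed.

(** Division of a power series by one factor is the recursion [f k = h k - b * f (k - 1) - d * f (k
    - 2)]. If [h] is bounded by [K / 2 ^ k], the bound [3 * K / 2 ^ k] propagates, because
    [1 + 6/4 + 12/64 < 3]. *)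
Lemma quads_inverse l : all small_quad l -> exists h : nat -> R,
  (forall k, `|h k| <= 3 ^+ size l / 2 ^+ k) /\
  (forall N i, (i < N)%N -> (quads l * \poly_(j < N) h j)`_i = (i == 0%N)%:R).
Proof.
elim: l => [_|bd l IH /= /andP[/andP[hb hd] /IH{IH}[h [hK hQ]]]].
  exists (fun k => (k == 0%N)%:R); split.
    by case=> [|k]; rewrite ?expr0 ?divr1 ?normr1// normr0; apply: divr_ge0 => //; exact: exprn_ge0.
  by move=> N i iN; rewrite /quads big_nil mul1r coef_poly iN.
(* [aux k] holds [f k] together with [f (k - 1)], where [f (-1)] is read as 0. *)
pose aux := fix aux k := if k is k'.+1 then
  (h k - bd.1 * (aux k').1 - bd.2 * (aux k').2, (aux k').1) else (h 0%N, 0).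
pose f k := (aux k).1.
set K := 3 ^+ size l in hK.
have K0 : 0 <= K by rewrite exprn_ge0.
have bnd k : `|(aux k).1| <= 3 * K / 2 ^+ k /\ `|(aux k).2| <= 6 * K / 2 ^+ k.
  elim: k => [|k [I1 I2]] /=.
    rewrite expr0 !divr1 normr0; split; last by rewrite mulr_ge0.
    by have := hK 0%N; rewrite expr0 divr1; lra.
  have e2 : 0 < 2 ^+ k :> R by rewrite exprn_gt0.
  have w0 : 0 <= K / 2 ^+ k.+1 by apply: divr_ge0 => //; exact: exprn_ge0.
  have E3 : 3 * K / 2 ^+ k = 6 * (K / 2 ^+ k.+1).
    by rewrite exprS; field; exact: lt0r_neq0.
  have E6 : 6 * K / 2 ^+ k = 12 * (K / 2 ^+ k.+1).
    by rewrite exprS; field; exact: lt0r_neq0.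
  have E3' : 3 * K / 2 ^+ k.+1 = 3 * (K / 2 ^+ k.+1) by ring.
  have E6' : 6 * K / 2 ^+ k.+1 = 6 * (K / 2 ^+ k.+1) by ring.
  rewrite E3' E6'; rewrite E3 in I1; rewrite E6 in I2.
  split; last exact: I1.
  have J1 : `|bd.1 * (aux k).1| <= 1 / 4 * (6 * (K / 2 ^+ k.+1)) by rewrite normrM ler_pM.
  have J2 : `|bd.2 * (aux k).2| <= 1 / 64 * (12 * (K / 2 ^+ k.+1)) by rewrite normrM ler_pM.
  have J3 := hK k.+1.
  apply: le_trans (ler_normB _ _) _; apply: le_trans (lerD (ler_normB _ _) (lexx _)) _.
  apply: le_trans (lerD (lerD J3 J1) J2) _.
  by move: w0; lra.
exists f; split.
  by move=> k; rewrite exprS; have [] := bnd k.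
move=> N i iN.
have fE k : f k + bd.1 * (if (k < 1)%N then 0 else f (k - 1)%N) +
    bd.2 * (if (k < 2)%N then 0 else f (k - 2)%N) = h k.
  case: k => [|[|k]]; rewrite /f /=; [ring|ring|].
  by rewrite (_ : (k.+2 - 2)%N = k); [ring|lia].
have agree j : (j < N)%N -> (quad bd * \poly_(j0 < N) f j0)`_j = (\poly_(j0 < N) h j0)`_j.
  move=> jN; rewrite coef_quadM !coef_poly jN -(fE j).
  by rewrite (leq_ltn_trans (leq_subr _ _) jN) (leq_ltn_trans (leq_subr _ _) jN).
rewrite /quads big_cons -/(quads l) -mulrA mulrCA -(hQ N i iN) !coefM.
apply: eq_bigr => j _; congr (_ * _).
by rewrite agree// (leq_ltn_trans (leq_subr _ _) iN).
Qed.

Lemma size_quads l : (size (quads l) <= (size l).*2.+1)%N.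
Proof.
elim: l => [|bd l IH]; first by rewrite /quads big_nil size_poly1.
rewrite /quads big_cons; apply: leq_trans (size_polyMleq _ _) _.
have : (size (quad bd) <= 3)%N.
  rewrite /quad; apply: leq_trans (size_polyD _ _) _; rewrite geq_max.
  rewrite (leq_trans (size_scale_leq _ _))// ?size_polyXn// andbT.
  apply: leq_trans (size_polyD _ _) _; rewrite geq_max size_poly1 /=.
  by rewrite (leq_trans (size_scale_leq _ _))// size_polyX.
rewrite -/(quads l) /= doubleS; move: IH; set a := size (quad bd); set b := size (quads l).
by case: a => [|a] //=; lia.
Qed.

Lemma sum_pow2_le m : \sum_(i < m) 2^-1 ^+ i <= 2 :> R.
Proof.
suff : \sum_(i < m) 2^-1 ^+ i = 2 - 2 * 2^-1 ^+ m :> R.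
  by move=> ->; rewrite gerBl mulr_ge0// exprn_ge0.
elim: m => [|m IH]; first by rewrite big_ord0 expr0; ring.
by rewrite big_ord_recr /= IH exprS; field.
Qed.

(* [1 + p 'X^N] is [quads l] times the truncation at order [N] of its inverse power
   series. *)
Lemma small_multiple l N : all small_quad l -> (0 < N)%N ->
  exists p, [/\ (size p <= (size l).*2)%N,
    \sum_(i < size p) `|p`_i| <= 2 * 6 ^+ size l / 2 ^+ N &
    exists H, 1 + p * 'X^N = quads l * H].
Proof.
move=> sl N0; have [h [hK hQ]] := quads_inverse sl.
pose H := \poly_(j < N) h j.
have HK k : `|H`_k| <= 3 ^+ size l / 2 ^+ k.
  rewrite coef_poly; case: ifP => // _.
  by rewrite normr0; apply: divr_ge0 => //; exact: exprn_ge0.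
have QHK := coef_quadsM_bound sl HK.
have QHE : 1 + drop_poly N (quads l * H) * 'X^N = quads l * H.
  rewrite -[RHS](poly_take_drop N); congr (_ + _); apply/polyP => i.
  rewrite coef_take_poly coef1; case: ltnP => iN; first by rewrite hQ.
  by case: i iN => //; rewrite leqNgt N0.
exists (drop_poly N (quads l * H)); split; last by exists H.
  rewrite size_drop_poly.
  have := size_quads l; have := size_polyMleq (quads l) H.
  have : (size H <= N)%N by exact: size_poly.
  by lia.
set m := size _.
(* The inverse costs 3 per factor and the multiplication 2, whence the base 6; dropping the first
   [N] coefficients gains [2 ^- N]. *)
apply: (@le_trans _ _ (\sum_(i < m) (3 ^+ size l * 2 ^+ size l / 2 ^+ N) * 2^-1 ^+ i)).
  apply: ler_sum => i _; rewrite coef_drop_poly; apply: le_trans (QHK _) _.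
  by rewrite addnC exprD invfM exprVn mulrA.
rewrite -mulr_sumr -exprMn.
have -> : 3 * 2 = 6 :> R by ring.
rewrite -[leRHS]mulrA [leRHS]mulrC; apply: ler_wpM2l; last exact: sum_pow2_le.
by apply: divr_ge0 => //; exact: exprn_ge0.
Qed.

End small_multiples.

(** * Transforms of compactly supported functions *)

Section transform_algebra.
Context {R : realType}.
Implicit Types (A D f g : R -> R) (s : R[i]) (t r tau e : R) (phi psi u : R[i] -> R[i]).

Variable c : R.
Hypothesis c0 : 0 < c.

Definition supported tau f := forall t, t <= 0 \/ tau <= t -> f t = 0.

Lemma supportedW tau tau' f : tau <= tau' -> supported tau f -> supported tau' f.
Proof. by move=> tt sf t [t0|t0]; apply: sf; [left|right; exact: le_trans t0]. Qed.

Definition conv f g t := int 0 t (fun r => f r * g (t - r)).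

Lemma cont_conv f g : continuous f -> continuous g -> continuous (conv f g).
Proof.
move=> cf cg; apply: (cont_int (f := fun t r => f r * g (t - r))); last 2 first.
- exact: cont_cst.
- exact: cont_id.
apply: cont_mul; first by apply: (cont_comp _ cf); exact: cont_snd.
apply: (cont_comp _ cg).
by apply: cont_sub; [exact: cont_fst|exact: cont_snd].
Qed.

Lemma cont_conv_integrand f g t : continuous f -> continuous g ->
  continuous (fun r => f r * g (t - r)).
Proof.
move=> cf cg; apply: cont_mul => //; apply: (cont_comp _ cg).
by apply: cont_sub; [exact: cont_cst|exact: cont_id].
Qed.

Lemma int_eq0 a b f : continuous f -> a <= b -> (forall x, a <= x <= b -> f x = 0) ->
  int a b f = 0.
Proof.
move=> cf ab f0; rewrite (@eq_int _ _ _ _ (fun=> 0)) ?int_cst ?mul0r//.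
exact: cont_cst.
Qed.

Lemma supported_conv t1 t2 f g : continuous f -> continuous g ->
  0 <= t1 -> 0 <= t2 -> supported t1 f -> supported t2 g -> supported (t1 + t2) (conv f g).
Proof.
move=> cf cg t10 t20 sf sg t tt; have cfg := cont_conv_integrand (t := t) cf cg.
case: tt => [tle|tge].
  rewrite /conv int_swap int_eq0 ?oppr0// => x /andP[tx x0].
  by rewrite sf ?mul0r//; left.
apply: int_eq0 => //; first by apply: le_trans tge; exact: addr_ge0.
move=> x /andP[x0 xt]; have [t1x|xt1] := leP t1 x; first by rewrite sf ?mul0r//; right.
by rewrite sg ?mulr0//; right; move: tge xt1; lra.
Qed.

(** Truncation at [c] loses nothing, because the lengths of the supports add up to at most [c]. *)
Lemma lap_conv t1 t2 f g s : continuous f -> continuous g ->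
  0 <= t1 -> 0 <= t2 -> t1 + t2 <= c -> supported t1 f -> supported t2 g ->
  lap c (conv f g) s = lap c f s * lap c g s.
Proof.
move=> cf cg t10 t20 ttc sf sg.
pose F r t : R[i] := (f r * g t)%:C * cexp (s * (r + t)%:C).
have cF : ccont2 F.
  apply: ccontM.
    apply: ccont_real; apply: cont_mul.
      by apply: (cont_comp _ cf); exact: cont_fst.
    by apply: (cont_comp _ cg); exact: cont_snd.
  by apply: ccont_exp_comp; apply: cont_add; [exact: cont_fst|exact: cont_snd].
transitivity (cint 0 c (fun t => cint 0 t (fun r => F r (t - r)))).
  congr cint; apply/funext => t.
  rewrite int_lap_integrand//; last exact: cont_conv_integrand.
  by congr cint; apply/funext => r; rewrite /F (addrC r) subrK.
rewrite cint_fubini_triangle// /lap -cintZr; last exact: ccont_lap.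
have cFr r : ccont (F r) by exact: ccont_slice.
apply: eq_cint.
- apply: (ccont_cint (f := F) cF); first exact: cont_cst.
  by apply: cont_sub; [exact: cont_cst|exact: cont_id].
- by apply: ccontM; [exact: ccont_lap|exact: ccont_cst].
- exact: ltW.
move=> r /andP[r0 rc].
have FE t : F r t = ((f r)%:C * cexp (s * r%:C)) * ((g t)%:C * cexp (s * t%:C)).
  by rewrite /F rmorphD mulrDr cexpD rmorphM; exact: mulrACA.
rewrite -cintZ; last exact: ccont_lap.
have czero b : cint b c (fun=> 0 : R[i]) = 0.
  by apply: ceqP; rewrite ?re_cint ?im_cint int_cst mul0r.
have FcE : F r = (fun t => ((f r)%:C * cexp (s * r%:C)) * ((g t)%:C * cexp (s * t%:C))).
  by apply/funext => t; exact: FE.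
rewrite -FcE -(cint_chasles 0 (c - r) c).
have -> : cint (c - r) c (F r) = cint (c - r) c (fun=> 0).
  apply: eq_cint => //; [exact: ccont_cst|by rewrite gerBl|].
  move=> t /andP[ct tc]; rewrite /F.
  have [t1r|rt1] := leP t1 r; first by rewrite sf ?mul0r//; right.
  by rewrite sg ?mulr0 ?mul0r//; right; move: ct rt1 ttc; lra.
by rewrite czero addr0.
Qed.

Lemma int_conv t1 t2 f g : continuous f -> continuous g ->
  0 <= t1 -> 0 <= t2 -> t1 + t2 <= c -> supported t1 f -> supported t2 g ->
  int 0 c (conv f g) = int 0 c f * int 0 c g.
Proof.
move=> cf cg t10 t20 ttc sf sg.
have := lap_conv 0 cf cg t10 t20 ttc sf sg.
rewrite !lap0//; last exact: cont_conv.
by rewrite -rmorphM => /(congr1 (@re R)).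
Qed.

Lemma le_norm_conv f g t : continuous f -> continuous g -> 0 <= t ->
  `|conv f g t| <= conv (fun r => `|f r|) (fun r => `|g r|) t.
Proof.
move=> cf cg t0; apply: le_trans (ler_norm_int _ t0) _; first exact: cont_conv_integrand.
rewrite /conv le_eqVlt; apply/orP; left; apply/eqP; congr int.
by apply/funext => r; rewrite normrM.
Qed.

Lemma supported_norm tau f : supported tau f -> supported tau (fun t => `|f t|).
Proof. by move=> sf t tt; rewrite sf// normr0. Qed.

Lemma int_norm_conv t1 t2 f g : continuous f -> continuous g ->
  0 <= t1 -> 0 <= t2 -> t1 + t2 <= c -> supported t1 f -> supported t2 g ->
  int 0 c (fun t => `|conv f g t|) <= int 0 c (fun t => `|f t|) * int 0 c (fun t => `|g t|).
Proof.
move=> cf cg t10 t20 ttc sf sg.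
rewrite -(int_conv (cont_norm cf) (cont_norm cg) t10 t20 ttc (supported_norm sf) (supported_norm sg)).
apply: le_int; last 1 first.
- by move=> t /andP[t0 _]; exact: le_norm_conv.
- exact/cont_norm/cont_conv.
- by apply: cont_conv; exact: cont_norm.
- exact: ltW.
Qed.

(** Young's inequality for an integrable and a bounded factor. *)
Lemma conv_bound t1 t2 f g e : continuous f -> continuous g ->
  0 <= t1 -> 0 <= t2 -> t1 + t2 <= c -> supported t1 f -> supported t2 g ->
  (forall t, `|g t| <= e) -> forall t, `|conv f g t| <= int 0 c (fun t => `|f t|) * e.
Proof.
move=> cf cg t10 t20 ttc sf sg ge t.
have e0 : 0 <= e by apply: le_trans (ge 0); exact: normr_ge0.
have cn := cont_norm cf.
have i0 a b : a <= b -> 0 <= int a b (fun t => `|f t|).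
  by move=> ab; apply: int_ge0.
have [t0|t0] := leP t 0.
  rewrite (supported_conv cf cg t10 t20 sf sg) ?normr0; last by left.
  by rewrite mulr_ge0// i0// ltW.
have [tt|tt] := leP (t1 + t2) t.
  rewrite (supported_conv cf cg t10 t20 sf sg) ?normr0; last by right.
  by rewrite mulr_ge0// i0// ltW.
apply: le_trans (ler_norm_int (cont_conv_integrand (t := t) cf cg) (ltW t0)) _.
apply: (@le_trans _ _ (int 0 t (fun r => e * `|f r|))).
  apply: le_int; [exact/cont_norm/cont_conv_integrand|by apply: cont_mul => //; exact: cont_cst|exact: ltW|].
  by move=> r _; rewrite normrM mulrC ler_wpM2r.
rewrite intZ// mulrC; apply: ler_wpM2r => //.
rewrite -(int_chasles 0 t c) lerDl; apply: i0.
by apply: ltW; exact: lt_le_trans tt ttc.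
Qed.

(* [phi] is the transform of a small [A], and [s * phi s] that of a bounded [D], i.e. [D
   = - A']; keeping the pair avoids differentiating convolutions. *)
Definition transform tau e1 e2 phi := exists A D,
  [/\ continuous A /\ continuous D, supported tau A /\ supported tau D,
      int 0 c (fun t => `|A t|) <= e1, forall t, `|D t| <= e2 &
      forall s, lap c A s = phi s /\ lap c D s = s * phi s].

Lemma transformW tau tau' e1 e1' e2 e2' phi : tau <= tau' -> e1 <= e1' -> e2 <= e2' ->
  transform tau e1 e2 phi -> transform tau' e1' e2' phi.
Proof.
move=> tt ee1 ee2 [A [D [[cA cD] [sA sD] A1 D1 L]]]; exists A, D; split => //.
- by split; exact: supportedW tt _.
- exact: le_trans ee1.
- by move=> t; exact: le_trans (D1 t) _.
Qed.

Lemma transform0 tau : transform tau 0 0 (fun=> 0).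
Proof.
have cz : continuous (fun _ : R => 0 : R) by exact: cont_cst.
exists (fun=> 0), (fun=> 0); split => //.
- by rewrite normr0 int_cst mul0r.
- by move=> t; rewrite normr0.
- by move=> s; rewrite lap_cst0 mulr0.
Qed.

Lemma transformD tau e1 e2 e1' e2' phi psi :
  transform tau e1 e2 phi -> transform tau e1' e2' psi ->
  transform tau (e1 + e1') (e2 + e2') (fun s => phi s + psi s).
Proof.
move=> [A [D [[cA cD] [sA sD] A1 D1 L]]] [A' [D' [[cA' cD'] [sA' sD'] A1' D1' L']]].
exists (fun t => A t + A' t), (fun t => D t + D' t); split.
- by split; exact: cont_add.
- by split => t tt; rewrite ?sA ?sA' ?sD ?sD' ?addr0.
- apply: (@le_trans _ _ (int 0 c (fun t => `|A t| + `|A' t|))).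
    apply: le_int; last by move=> t _; exact: ler_normD.
    + exact/cont_norm/cont_add.
    + by apply: cont_add; exact: cont_norm.
    + exact: ltW.
  by rewrite intD; [rewrite lerD|exact: cont_norm|exact: cont_norm].
- by move=> t; apply: le_trans (ler_normD _ _) _; rewrite lerD.
- move=> s; have [l1 l2] := L s; have [l1' l2'] := L' s.
  by rewrite !lapD// l1 l2 l1' l2' mulrDr.
Qed.

Lemma transformZ tau e1 e2 k phi : transform tau e1 e2 phi ->
  transform tau (`|k| * e1) (`|k| * e2) (fun s => k%:C * phi s).
Proof.
move=> [A [D [[cA cD] [sA sD] A1 D1 L]]].
exists (fun t => k * A t), (fun t => k * D t); split.
- by split; apply: cont_mul => //; exact: cont_cst.
- by split => t tt; rewrite ?sA ?sD ?mulr0.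
- have -> : (fun t => `|k * A t|) = (fun t => `|k| * `|A t|).
    by apply/funext => t; rewrite normrM.
  by rewrite intZ ?ler_wpM2l//; exact: cont_norm.
- by move=> t; rewrite normrM ler_wpM2l.
- by move=> s; have [l1 l2] := L s; rewrite !lapZ// l1 l2; split => //; exact: mulrCA.
Qed.

(** The factor [s] is attached to [psi] alone, so the sup bound of the product involves the L1 bound
    of the first factor and the sup bound of the second. *)
Lemma transformM t1 t2 e1 e2 e1' e2' phi psi : 0 <= t1 -> 0 <= t2 -> t1 + t2 <= c ->
  transform t1 e1 e2 phi -> transform t2 e1' e2' psi ->
  transform (t1 + t2) (e1 * e1') (e1 * e2') (fun s => phi s * psi s).
Proof.
move=> t10 t20 ttc [A [D [[cA cD] [sA sD] A1 D1 L]]] [A' [D' [[cA' cD'] [sA' sD'] A1' D1' L']]].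
have nn f : continuous f -> 0 <= int 0 c (fun t => `|f t|).
  by move=> cf; apply: int_ge0 => //; [exact: cont_norm|exact: ltW].
exists (conv A A'), (conv A D'); split.
- by split; exact: cont_conv.
- by split; exact: supported_conv.
- apply: le_trans (int_norm_conv cA cA' t10 t20 ttc sA sA') _.
  by apply: ler_pM => //; exact: nn.
- move=> t; apply: le_trans (conv_bound cA cD' t10 t20 ttc sA sD' D1' t) _.
  by apply: ler_wpM2r => //; apply: le_trans (D1' 0).
- move=> s; have [l1 l2] := L s; have [l1' l2'] := L' s.
  rewrite (lap_conv s cA cA' t10 t20)// (lap_conv s cA cD' t10 t20)// l1 l1' l2'.
  by split => //; exact: mulrCA.
Qed.

(** An L1 bound of 1 keeps both bounds fixed under powers while only the support grows. The exponent
    starts at 1: the constant function 1 is not the transform of a continuous density. *)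
Lemma transformX tau e2 u j : 0 <= tau -> transform tau 1 e2 u ->
  (j.+1%:R * tau) <= c -> transform (j.+1%:R * tau) 1 e2 (fun s => u s ^+ j.+1).
Proof.
move=> tau0 tu; elim: j => [|j IH] jc; first by rewrite mul1r; apply: transformW tu.
have e : j.+2%:R * tau = j.+1%:R * tau + tau by rewrite -[j.+2]addn1 natrD mulrDl mul1r.
have jc' : j.+1%:R * tau <= c by apply: le_trans jc; rewrite e lerDl.
have h := transformM (mulr_ge0 (ler0n _ _) tau0) tau0 _ (IH jc') tu.
rewrite e; have := h; rewrite -e => /(_ jc); rewrite !mul1r.
have -> : (fun s => u s ^+ j.+2) = (fun s => u s ^+ j.+1 * u s).
  by apply/funext => s; rewrite exprSr.
by [].
Qed.

Lemma transform_poly tau e2 u (p : {poly R}) N : 0 <= tau -> transform tau 1 e2 u ->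
  (0 < N)%N -> (N + size p)%:R * tau <= c ->
  let S := \sum_(i < size p) `|p`_i| in
  transform ((N + size p)%:R * tau) S (S * e2)
    (fun s => \sum_(i < size p) (p`_i)%:C * u s ^+ (N + i)).
Proof.
move=> tau0 tu N0 pc S.
suff : forall m, (m <= size p)%N ->
  transform ((N + size p)%:R * tau) (\sum_(i < m) `|p`_i|) ((\sum_(i < m) `|p`_i|) * e2)
    (fun s => \sum_(i < m) (p`_i)%:C * u s ^+ (N + i)) by apply.
elim=> [_|m IH mp].
  rewrite big_ord0 mul0r.
  have -> : (fun s => \sum_(i < 0) (p`_i)%:C * u s ^+ (N + i)) = (fun=> 0).
    by apply/funext => s; rewrite big_ord0.
  exact: transform0.
have Nm : (N + m)%N = (N + m).-1.+1 by rewrite prednK// addn_gt0 N0.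
have le1 : (N + m)%:R * tau <= (N + size p)%:R * tau.
  by apply: ler_wpM2r => //; rewrite ler_nat leq_add2l ltnW.
have hX : transform ((N + size p)%:R * tau) 1 e2 (fun s => u s ^+ (N + m)).
  apply: (transformW le1 (lexx _) (lexx _)); rewrite Nm; apply: transformX => //.
  by rewrite -Nm; exact: le_trans le1 pc.
have := transformD (IH (ltnW mp)) (transformZ (p`_m) hX).
rewrite mulr1 -mulrDl -(big_ord_recr m (fun i : 'I_m.+1 => `|p`_i|)) /=.
congr (transform _ _ _ _); apply/funext => s.
by rewrite [RHS]big_ord_recr.
Qed.

End transform_algebra.

(** * A smooth probability density and its rescaled translates *)

Section bump.
Context {R : realType}.
Implicit Types (s z : R[i]) (t x a b : R).

Definition normsq z : R := re z ^+ 2 + im z ^+ 2.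

Lemma normsqM z w : normsq (z * w) = normsq z * normsq w.
Proof. by rewrite /normsq reM imM; ring. Qed.

Lemma normsq_cexp z : normsq (cexp z) = expR (2 * re z).
Proof.
rewrite /normsq re_cexp im_cexp !exprMn -mulrDr cos2Dsin2 mulr1.
by rewrite expr2 -expRD; congr expR; ring.
Qed.

Lemma sin_le_id x : 0 <= x -> sin x <= x.
Proof.
move=> x0.
have d y : is_derive y (1 : R) (fun y => y - sin y) (1 - cos y).
  exact: is_deriveB (is_derive_id y 1) (is_derive_sin y).
have := @derive_bound _ (fun y => y - sin y) (fun y => 1 - cos y) 0 x 0 2 x0.
rewrite sin0 subr0 => /(_ (fun y _ => d y)) H.
have {}/H /andP[h _] : forall y, 0 <= y <= x -> 0 <= 1 - cos y <= 2.
  by move=> y _; have := cos_le1 y; have := cos_geN1 y; lra.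
by move: h; rewrite mul0r !subr0 subr_ge0.
Qed.

Lemma cos_ge_half x : `|x| <= 1 -> 1 / 2 <= cos x.
Proof.
wlog x0 : x / 0 <= x.
  move=> H; have [/H//|/ltW x0 x1] := leP 0 x.
  by rewrite -cosN; apply: H; rewrite ?normrN// oppr_ge0.
rewrite ger0_norm// => x1.
(* [cos y + y^2 / 2] is nondecreasing for [y >= 0] since [sin y <= y]; hence
   [cos x >= 1 - x^2 / 2]. *)
have d y : is_derive y (1 : R) (fun y => cos y + 1 / 2 * (y * y)) (- sin y + y).
  have h := is_derive_mul (is_derive_cst (1 / 2 : R) y 1) (is_derive_mul (is_derive_id y 1) (is_derive_id y 1)).
  by apply: (is_derive_eq (is_deriveD (is_derive_cos y) h)); rewrite /cst /=; field.
have := @derive_bound _ _ _ 0 x 0 2 x0 (fun y _ => d y).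
rewrite cos0 !mul0r mulr0 addr0 subr0 => H.
have {}/H /andP[h _] : forall y, 0 <= y <= x -> 0 <= - sin y + y <= 2.
  by move=> y /andP[y0 yx]; have := sin_le_id y0; have := sin_geN1 y; lra.
have : x * x <= 1 by rewrite -[leRHS]mulr1 ler_pM.
by lra.
Qed.

(* 30 normalizes the integral of t^2 (1 - t)^2 over [0, 1]; [dbump0] is minus the
   derivative. *)
Definition bump0 t : R := 30 * ((clamp 1 t * (1 - clamp 1 t)) * (clamp 1 t * (1 - clamp 1 t))).

Definition dbump0 t : R := - (60 * ((clamp 1 t * (1 - clamp 1 t)) * (1 - 2 * clamp 1 t))).

Let one1 : (1 : R) <= 1. Proof. exact: lexx. Qed.

Lemma cont_bump0 : continuous bump0.
Proof.
have cc := @cont_clamp R 1.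
have c1 : continuous (fun t => 1 - clamp 1 t : R) by apply: cont_sub => //; exact: cont_cst.
apply: cont_mul; first exact: cont_cst.
by apply: cont_mul; apply: cont_mul.
Qed.

Lemma cont_dbump0 : continuous dbump0.
Proof.
have cc := @cont_clamp R 1.
have c1 : continuous (fun t => 1 - clamp 1 t : R) by apply: cont_sub => //; exact: cont_cst.
have c2 : continuous (fun t => 1 - 2 * clamp 1 t : R).
  by apply: cont_sub; [exact: cont_cst|apply: cont_mul => //; exact: cont_cst].
apply: cont_opp; apply: cont_mul; first exact: cont_cst.
by apply: cont_mul => //; apply: cont_mul.
Qed.

Lemma supported_bump0 t : t <= 0 \/ 1 <= t -> bump0 t = 0 /\ dbump0 t = 0.
Proof.
move=> [t0|t1]; rewrite /bump0 /dbump0.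
  have -> : clamp 1 t = 0 by rewrite /clamp max_r// min_l.
  by split; ring.
by rewrite (clamp_ge one1 t1); split; ring.
Qed.

Lemma bump0_ge0 t : 0 <= bump0 t.
Proof. by rewrite /bump0 mulr_ge0// -expr2 sqr_ge0. Qed.

Lemma dbump0_le t : `|dbump0 t| <= 60.
Proof.
rewrite /dbump0 normrN; have /andP[k0 k1] := clampP one1 t.
rewrite !normrM (ger0_norm (_ : 0 <= (60 : R)))//.
have h1 : `|clamp 1 t| <= 1 by rewrite ger0_norm.
have h2 : `|1 - clamp 1 t| <= 1 by rewrite ger0_norm; lra.
have h3 : `|1 - 2 * clamp 1 t| <= 1 by rewrite ler_norml; lra.
have h4 : `|clamp 1 t| * `|1 - clamp 1 t| <= 1 by rewrite -[leRHS]mulr1 ler_pM.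
have : `|clamp 1 t| * `|1 - clamp 1 t| * `|1 - 2 * clamp 1 t| <= 1.
  by rewrite -[leRHS]mulr1 ler_pM// mulr_ge0.
by lra.
Qed.

Lemma int_bump0 : int 0 1 bump0 = 1.
Proof.
pose P t : R := t * t * t * (10 - 15 * t + 6 * (t * t)).
pose p t : R := 30 * ((t * (1 - t)) * (t * (1 - t))).
have dP t : is_derive t (1 : R) P (p t).
  have di := is_derive_id t (1 : R).
  have d2 := is_derive_mul di di; have d3 := is_derive_mul d2 di.
  have d4 := is_deriveD (is_deriveB (is_derive_cst (10 : R) t 1) (is_derive_scale 15 t))
    (is_derive_mul (is_derive_cst (6 : R) t 1) d2).
  by apply: (is_derive_eq (is_derive_mul d3 d4)); rewrite /p /cst !fctE /=; ring.
have cp : continuous p.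
  have c1 : continuous (fun t : R => t * (1 - t)).
    by apply: cont_mul; [exact: cont_id|apply: cont_sub; [exact: cont_cst|exact: cont_id]].
  by apply: cont_mul; [exact: cont_cst|apply: cont_mul].
rewrite (@eq_int _ _ _ _ p)//; first by rewrite (int_FTC _ _ dP)// /P; ring.
  exact: cont_bump0.
by move=> t t01; rewrite /bump0 clamp_id.
Qed.

(** Integration by parts on the unclamped polynomials [p] and [q]; the boundary terms vanish. *)
Lemma lap_bump0 z : lap 1 dbump0 z = z * lap 1 bump0 z.
Proof.
pose p t : R := 30 * ((t * (1 - t)) * (t * (1 - t))).
pose q t : R := - (60 * ((t * (1 - t)) * (1 - 2 * t))).
have c1 : continuous (fun t : R => t * (1 - t)).
  by apply: cont_mul; [exact: cont_id|apply: cont_sub; [exact: cont_cst|exact: cont_id]].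
have cp : continuous p by apply: cont_mul; [exact: cont_cst|apply: cont_mul].
have cq : continuous q.
  apply: cont_opp; apply: cont_mul; first exact: cont_cst.
  apply: cont_mul => //; apply: cont_sub; first exact: cont_cst.
  by apply: cont_mul; [exact: cont_cst|exact: cont_id].
have dp t : is_derive t (1 : R) p (- q t).
  have di := is_derive_id t (1 : R).
  have d1 := is_derive_mul di (is_deriveB (is_derive_cst (1 : R) t 1) di).
  have h := is_derive_mul (is_derive_cst (30 : R) t 1) (is_derive_mul d1 d1).
  by apply: (is_derive_eq h); rewrite /q /cst !fctE /=; ring.
rewrite (@eq_lap _ _ dbump0 q)//; last 2 first.
- exact: cont_dbump0.
- by move=> t t01; rewrite /dbump0 clamp_id.
rewrite (@eq_lap _ _ bump0 p)//; last 2 first.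
- exact: cont_bump0.
- by move=> t t01; rewrite /bump0 clamp_id.
have dF t : has_derivative (fun t => (p t)%:C * cexp (z * t%:C)) t
   ((- q t)%:C * cexp (z * t%:C) + (p t)%:C * (z * cexp (z * t%:C))).
  apply: has_derivativeM; last exact: has_derivative_cexp.
  by split; [exact: dp|exact: is_derive_cst].
have lq := ccont_lap z cq; have lp := ccont_lap z cp.
have fE : (fun t => (- q t)%:C * cexp (z * t%:C) + (p t)%:C * (z * cexp (z * t%:C))) =
   (fun t => - ((q t)%:C * cexp (z * t%:C)) + z * ((p t)%:C * cexp (z * t%:C))).
  apply/funext => t; rewrite rmorphN mulNr; congr (_ + _); exact: mulrCA.
have := cint_FTC 0 1 dF; rewrite fE.
have zlp : ccont (fun t => z * ((p t)%:C * cexp (z * t%:C))) by apply: ccontM => //; exact: ccont_cst.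
have nlq : ccont (fun t => - ((q t)%:C * cexp (z * t%:C))) by exact: ccontN.
move=> /(_ (ccontD nlq zlp)); rewrite cintD// cintN// cintZ//.
have -> : p 1 = 0 by rewrite /p; ring.
have -> : p 0 = 0 by rewrite /p; ring.
rewrite !mul0r subrr -/(lap 1 q z) -/(lap 1 p z) => /eqP.
by rewrite addrC subr_eq0 => /eqP.
Qed.

(** On [[0, 1]] the exponential has modulus at least 1 and its angle stays within [[-1, 1]], so the
    real part of the integrand is at least half the density. *)
Lemma re_lap_bump0 z : 0 <= re z -> `|im z| <= 1 -> 1 / 2 <= re (lap 1 bump0 z).
Proof.
move=> z0 z1; rewrite re_cint.
have [cl _] := ccont_lap z cont_bump0.
have -> : 1 / 2 = int 0 1 (fun t => 1 / 2 * bump0 t) :> R.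
  by rewrite intZ ?int_bump0 ?mulr1//; exact: cont_bump0.
apply: le_int => //; first by apply: cont_mul; [exact: cont_cst|exact: cont_bump0].
move=> t /andP[t0 t1]; rewrite reM reC imC mul0r subr0 mulrC; apply: ler_wpM2l.
  exact: bump0_ge0.
rewrite re_cexp !reM !imM reC imC !mulr0 subr0 add0r.
have h1 : 1 <= expR (re z * t) by rewrite -expR0 ler_expR mulr_ge0.
have h2 : 1 / 2 <= cos (im z * t).
  by apply: cos_ge_half; rewrite normrM (ger0_norm t0) -[leRHS]mulr1 ler_pM.
by rewrite -[leLHS]mul1r ler_pM.
Qed.

Lemma cint_affine a b (k d : R) (f : R -> R[i]) : ccont f ->
  cint a b (fun x => k%:C * f (k * x + d)) = cint (k * a + d) (k * b + d) f.
Proof.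
move=> [f1 f2]; apply: ceqP; rewrite ?re_cint ?im_cint.
  rewrite -(int_affine _ _ _ _ f1); congr int; apply/funext => x.
  by rewrite reM reC imC mul0r subr0.
rewrite -(int_affine _ _ _ _ f2); congr int; apply/funext => x.
by rewrite imM reC imC mul0r addr0.
Qed.

Lemma int_restrict_supported (f : R -> R) a b : continuous f -> a <= 0 -> 1 <= b ->
  (forall t, t <= 0 \/ 1 <= t -> f t = 0) -> int a b f = int 0 1 f.
Proof.
move=> cf a0 b1 f0; rewrite -(int_chasles a 0 b) -(int_chasles 0 1 b).
rewrite (int_eq0 cf a0); last by move=> x /andP[_ x0]; rewrite f0//; left.
by rewrite (int_eq0 cf b1) ?add0r ?addr0// => x /andP[x1 _]; rewrite f0//; right.
Qed.

Variables (c al be : R).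
Hypotheses (be0 : 0 < be) (al0 : 0 <= al) (cab : (al + 1) / be <= c).

Lemma lap_affine (f : R -> R) (k : R) s : continuous f ->
  (forall t, t <= 0 \/ 1 <= t -> f t = 0) ->
  lap c (fun t => be * (k * f (be * t - al))) s =
  k%:C * (cexp (s * (al / be)%:C) * lap 1 f (s * (be^-1)%:C)).
Proof.
move=> cf f0.
pose h (x : R) : R[i] := k%:C * (cexp (s * (al / be)%:C) * ((f x)%:C * cexp (s * (be^-1)%:C * x%:C))).
have cl := ccont_lap (s * (be^-1)%:C) cf.
have clE : ccont (fun x => cexp (s * (al / be)%:C) * ((f x)%:C * cexp (s * (be^-1)%:C * x%:C))).
  by apply: ccontM => //; exact: ccont_cst.
have ch : ccont h by apply: ccontM => //; exact: ccont_cst.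
have bn0 : be != 0 by exact: lt0r_neq0.
transitivity (cint 0 c (fun t => be%:C * h (be * t - al))).
  congr cint; apply/funext => t; rewrite /h.
  have -> : s * t%:C = s * (al / be)%:C + s * (be^-1)%:C * (be * t - al)%:C.
    rewrite -mulrA -rmorphM -mulrDr -rmorphD; congr (_ * _%:C); field.
    by [].
  rewrite cexpD !rmorphM.
  have key (b' k' F E1 E2 : R[i]) : b' * (k' * F) * (E1 * E2) = b' * (k' * (E1 * (F * E2))) by ring.
  exact: key.
rewrite cint_affine// mulr0 add0r.
have -> : cint (- al) (be * c - al) h = cint 0 1 h.
  have h0 t : t <= 0 \/ 1 <= t -> h t = 0.
    by move=> tt; rewrite /h f0// mul0r !mulr0.
  have a1 : - al <= 0 by rewrite oppr_le0.
  have b1 : 1 <= be * c - al.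
    by rewrite lerBrDr addrC mulrC -ler_pdivrMr.
  have [h1 h2] := ch; apply: ceqP; rewrite ?re_cint ?im_cint.
    by rewrite int_restrict_supported// => t /h0 ->.
  by rewrite int_restrict_supported// => t /h0 ->.
by rewrite /h cintZ// cintZ.
Qed.

(** The density is compressed to width [1 / be] and moved right by [al / be]. The translation
    multiplies the transform by [e^{s al / be}], and [|im s| <= be] keeps the other factor at
    modulus at least 1/2, whence the 4. *)
Lemma bump_transform : exists u : R[i] -> R[i],
  transform c ((al + 1) / be) 1 (60 * be ^+ 2) u /\
  forall s, 0 <= re s -> `|im s| <= be -> expR (2 * (re s * (al / be))) <= 4 * normsq (u s).
Proof.
pose A t := be * (1 * bump0 (be * t - al)).
pose D t := be * (be * dbump0 (be * t - al)).
have ca : continuous (fun t : R => be * t - al).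
  by apply: cont_sub; [apply: cont_mul; [exact: cont_cst|exact: cont_id]|exact: cont_cst].
have cA : continuous A.
  apply: cont_mul; first exact: cont_cst.
  by apply: cont_mul; [exact: cont_cst|exact: (cont_comp ca cont_bump0)].
have cD : continuous D.
  apply: cont_mul; first exact: cont_cst.
  by apply: cont_mul; [exact: cont_cst|exact: (cont_comp ca cont_dbump0)].
have bn0 : be != 0 by exact: lt0r_neq0.
have sE t : t <= 0 \/ (al + 1) / be <= t -> be * t - al <= 0 \/ 1 <= be * t - al.
  move=> [t0|tb]; [left|right].
    by rewrite subr_le0 (le_trans _ al0)// mulr_ge0_le0// ltW.
  by rewrite lerBrDr addrC mulrC -ler_pdivrMr.
have lA s : lap c A s = cexp (s * (al / be)%:C) * lap 1 bump0 (s * (be^-1)%:C).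
  rewrite lap_affine ?mul1r//; first exact: cont_bump0.
  by move=> t /supported_bump0[].
have lD s : lap c D s = s * lap c A s.
  rewrite lap_affine; last 2 first.
  - exact: cont_dbump0.
  - by move=> t /supported_bump0[].
  rewrite lA lap_bump0.
  have e : be%:C * (be^-1)%:C = 1 :> R[i] by rewrite -rmorphM divff// rmorph1.
  have key (b b' E s' L : R[i]) : b * b' = 1 -> b * (E * (s' * b' * L)) = s' * (E * L).
    move=> bb; have -> : b * (E * (s' * b' * L)) = (b * b') * (s' * (E * L)) by ring.
    by rewrite bb mul1r.
  exact: key e.
exists (fun s => lap c A s); split.
  exists A, D; split => //.
  - split => t /sE tt; have [h1 h2] := supported_bump0 tt.
      by rewrite /A h1 !mulr0.
    by rewrite /D h2 !mulr0.
  - have -> : (fun t => `|A t|) = A.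
      apply/funext => t; apply: ger0_norm.
      by rewrite /A mul1r mulr_ge0 ?bump0_ge0 ?ltW.
    have := lA 0; rewrite lap0// !mul0r cexp0 mul1r lap0; last exact: cont_bump0.
    by rewrite int_bump0 => /(congr1 (@re R)); rewrite !reC => ->.
  - move=> t; rewrite /D !normrM (gtr0_norm be0).
    rewrite mulrA -expr2 mulrC; apply: ler_wpM2r; first by rewrite exprn_ge0// ltW.
    exact: dbump0_le.
move=> s s0 s1; rewrite lA normsqM normsq_cexp.
have -> : re (s * (al / be)%:C) = re s * (al / be) by rewrite reM reC imC mulr0 subr0.
have h : 1 / 4 <= normsq (lap 1 bump0 (s * (be^-1)%:C)).
  have h1 : 1 / 2 <= re (lap 1 bump0 (s * (be^-1)%:C)).
    apply: re_lap_bump0.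
      by rewrite reM reC imC mulr0 subr0 mulr_ge0// invr_ge0 ltW.
    rewrite imM reC imC mulr0 add0r normrM normfV (gtr0_norm be0).
    by rewrite ler_pdivrMr// mul1r.
  rewrite /normsq; have := sqr_ge0 (im (lap 1 bump0 (s * (be^-1)%:C))).
  have : (1 / 2) * (1 / 2) <= re (lap 1 bump0 (s * (be^-1)%:C)) ^+ 2 by rewrite expr2 ler_pM.
  by lra.
have := expR_ge0 (2 * (re s * (al / be))).
set E := expR _ => E0; set L := normsq _ in h *.
have : E * (1 / 4) <= E * L by rewrite ler_wpM2l.
by lra.
Qed.

End bump.

(** * The factor of one dyadic block *)

Section blocks.
Context {R : realType}.
Implicit Types (s z : R[i]) (l : seq (R * R)) (p : {poly R}).

Local Notation toC := (map_poly (real_complex R)).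

Lemma quads_root l bd z : bd \in l -> (toC (quad bd)).[z] = 0 -> (toC (quads l)).[z] = 0.
Proof.
move=> + rz; elim: l => [//|b l IH]; rewrite inE /quads big_cons rmorphM hornerM.
by move=> /orP[/eqP <-|/IH]; [rewrite rz mul0r|rewrite -/(quads l) => ->; rewrite mulr0].
Qed.

(* [quad (root_quad z)] is (1 - X / z) (1 - X / z^* ). *)
Definition root_quad z : R * R := (- (2 * re z / normsq z), (normsq z)^-1).

Lemma root_quadP z : 64 <= normsq z -> small_quad (root_quad z) /\ (toC (quad (root_quad z))).[z] = 0.
Proof.
move=> z64; have z0 : 0 < normsq z by apply: lt_le_trans z64.
split.
  apply/andP; split; rewrite /= ?normrN.
    rewrite normrM normfV (gtr0_norm z0) ler_pdivrMr// normrM (ger0_norm (_ : 0 <= (2 : R)))//.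
    have : 0 <= (`|re z| - 8) ^+ 2 by exact: sqr_ge0.
    have : 0 <= im z ^+ 2 by exact: sqr_ge0.
    have : `|re z| ^+ 2 = re z ^+ 2 by rewrite real_normK// num_real.
    move: z64; rewrite /normsq; set a := `|re z|; have : 0 <= a by exact: normr_ge0.
    by nra.
  rewrite normfV (gtr0_norm z0) div1r lef_pV2// posrE//.
rewrite /quad !rmorphD /= !map_polyZ /= rmorph1 map_polyX map_polyXn.
rewrite !hornerE /=.
have n0 : normsq z != 0 by exact: lt0r_neq0.
apply: ceqP; rewrite !reimE /root_quad /=; rewrite /normsq in n0 *; field; exact: n0.
Qed.

Lemma horner_toC p z : (toC p).[z] = \sum_(i < size p) (p`_i)%:C * z ^+ i.
Proof.
rewrite horner_coef size_map_poly; apply: eq_bigr => i _.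
by rewrite coef_map.
Qed.

(** The threshold [4 * 64] yields [|u s|^2 >= 64], which makes the conjugate pair at [u s] a
    [small_quad]. *)
Lemma block_transform (c al be : R) (l : seq R[i]) (N : nat) :
  0 < c -> 0 < be -> 0 <= al -> (0 < N)%N ->
  (N + (size l).*2)%:R * ((al + 1) / be) <= c ->
  (forall s, s \in l ->
     [/\ 0 <= re s, `|im s| <= be & 4 * 64 <= expR (2 * (re s * (al / be)))]) ->
  let S := 2 * 6 ^+ size l / 2 ^+ N in
  exists phi, transform c ((N + (size l).*2)%:R * ((al + 1) / be)) S (S * (60 * be ^+ 2)) phi /\
    forall s, s \in l -> phi s = - 1.
Proof.
move=> c0 be0 al0 N0 Nc hl S.
have tau0 : 0 <= (al + 1) / be by apply: divr_ge0; [exact: addr_ge0|exact: ltW].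
have tc : (al + 1) / be <= c.
  apply: le_trans Nc; rewrite -[leLHS]mul1r; apply: ler_wpM2r => //.
  by rewrite ler1n addn_gt0 N0.
have [u [tu hu]] := bump_transform be0 al0 tc.
have u64 s : s \in l -> 64 <= normsq (u s).
  by move=> /hl[h1 h2 h3]; have := hu s h1 h2; lra.
pose Q := [seq root_quad (u s) | s <- l].
have sQ : all small_quad Q.
  by apply/allP => bd /mapP[s /u64 /root_quadP[h _] ->].
have [p [sp Sp [H QH]]] := small_multiple sQ N0.
rewrite !size_map in sp Sp.
pose phi s := \sum_(i < size p) (p`_i)%:C * u s ^+ (N + i).
exists phi; split.
  have le1 : (N + size p)%:R * ((al + 1) / be) <= (N + (size l).*2)%:R * ((al + 1) / be).
    by apply: ler_wpM2r => //; rewrite ler_nat leq_add2l.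
  have b0 : 0 <= 60 * be ^+ 2 by rewrite mulr_ge0// sqr_ge0.
  apply: (transformW le1 Sp (ler_wpM2r b0 Sp)).
  by apply: transform_poly => //; exact: le_trans le1 Nc.
(* Evaluating the identity [QH] at [u s], a root of the quadratic product, leaves
   [1 + phi s = 0]. *)
move=> s sl; have := congr1 (fun q => (toC q).[u s]) QH.
rewrite rmorphD rmorph1 !rmorphM /= map_polyXn !hornerE.
rewrite (@quads_root Q (root_quad (u s))); last 2 first.
- by apply/mapP; exists s.
- by have [_ ->] := root_quadP (u64 s sl).
rewrite mul0r horner_toC => /eqP; rewrite addrC addr_eq0 => /eqP <-.
rewrite /phi mulr_suml; apply: eq_bigr => i _.
by rewrite addnC exprD mulrA.
Qed.

End blocks.

(** * The product over all blocks *)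

Section infinite_product.
Context {R : realType}.
Implicit Types (s z : R[i]) (f g h : R -> R).

Lemma expn_lower_bound (m : nat) : m%:R <= 2 ^+ m :> R.
Proof. by rewrite -natrX ler_nat ltnW// ltn_expl. Qed.

Lemma exists_large_exponent (a C : R) : 0 <= a -> 0 <= C ->
  exists2 L : nat, (3 <= L)%N & C * (a * L%:R) ^+ 2 <= 2 ^+ L.
Proof.
move=> a0 C0; pose B := 16 * (C * a ^+ 2).
have B0 : 0 <= B by rewrite !mulr_ge0// sqr_ge0.
pose m := (Num.truncn B).+1.
have Bm : B <= m%:R by rewrite ltW// truncnS_gt.
(* With exponent [4m] the left-hand side is [B * m^2], while [2^{4m} >= m^4], and [m >= B]. *)
exists (4 * m)%N; first by rewrite /m; lia.
have m1 : 1 <= m%:R :> R by rewrite ler1n.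
have -> : C * (a * (4 * m)%:R) ^+ 2 = B * m%:R ^+ 2 by rewrite natrM /B; ring.
apply: (@le_trans _ _ (m%:R ^+ 4)).
  have -> : m%:R ^+ 4 = m%:R ^+ 2 * m%:R ^+ 2 :> R by rewrite -exprD.
  apply: ler_wpM2r; first exact: sqr_ge0.
  by apply: le_trans Bm _; rewrite expr2 ler_peMr.
by rewrite mulnC exprM lerXn2r ?nnegrE ?exprn_ge0// expn_lower_bound.
Qed.

Lemma sum_idx_pow2 J : \sum_(j < J) j%:R / 2 ^+ j <= 2 :> R.
Proof.
suff -> : \sum_(j < J) j%:R / 2 ^+ j = 2 - 2 * (J%:R + 1) / 2 ^+ J :> R.
  by rewrite gerBl divr_ge0 ?exprn_ge0// mulr_ge0// addr_ge0.
elim: J => [|J IH]; first by rewrite big_ord0 expr0 add0r; field.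
rewrite big_ord_recr /= IH -natr1 exprS.
have e2 : 2 ^+ J != 0 :> R by rewrite expf_neq0.
by field.
Qed.

(** Uniform convergence on [[0, c]] passes to the transforms; as these are eventually constant, no
    limit of complex numbers has to be taken. *)
Lemma lap_limit (c K : R) (g : R -> R) (G : nat -> R -> R) s v n0 : 0 < c ->
  continuous g -> (forall n, continuous (G n)) ->
  (forall n t, `|g t - G n t| <= K * (1 / 2) ^+ n) ->
  (forall n, (n0 <= n)%N -> lap c (G n) s = v) -> lap c g s = v.
Proof.
move=> c0 cg cG gG lG.
have K0 : 0 <= K by have := gG 0%N 0; rewrite expr0 mulr1; exact: le_trans.
have key (h : R -> R) (w : R) : continuous h ->
    (forall n, (n0 <= n)%N -> int 0 c (fun t => G n t * h t) = w) ->
    int 0 c (fun t => g t * h t) = w.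
  move=> ch Gw; have [M M0 HM] := continuous_bounded ch (ltW c0).
  apply/eqP; rewrite -subr_eq0 -normr_le0; apply/ler_addgt0Pr => e e0; rewrite add0r.
  pose V := K * M * c.
  have V0 : 0 <= V by rewrite !mulr_ge0// ltW.
  pose n := (n0 + (Num.truncn (V / e)).+1)%N.
  rewrite -(Gw n (leq_addr _ _)) -intB; try exact: cont_mul.
  apply: le_trans (int_norm_bound (M := K * (1 / 2) ^+ n * M) _ (ltW c0) _) _.
  - by apply: cont_sub; exact: cont_mul.
  - move=> t t0c; rewrite -mulrBl normrM; apply: ler_pM => //; exact: HM.
  have -> : K * (1 / 2) ^+ n * M * (c - 0) = V * (1 / 2) ^+ n by rewrite subr0 /V; ring.
  rewrite expr_div_n expr1n mul1r ler_pdivrMr ?exprn_gt0// mulrC -ler_pdivrMr//.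
  apply: le_trans (expn_lower_bound n).
  apply: (@le_trans _ _ (Num.truncn (V / e)).+1%:R); first by rewrite ltW// truncnS_gt.
  by rewrite ler_nat leq_addl.
have [ce1 ce2] := ccont_exp s.
apply: ceqP; rewrite ?re_cint ?im_cint.
  have -> : (fun t => re ((g t)%:C * cexp (s * t%:C))) = (fun t => g t * re (cexp (s * t%:C))).
    by apply/funext => t; rewrite reM reC imC mul0r subr0.
  apply: key => // n nn; rewrite -(lG n nn) re_cint; congr int.
  by apply/funext => t; rewrite reM reC imC mul0r subr0.
have -> : (fun t => im ((g t)%:C * cexp (s * t%:C))) = (fun t => g t * im (cexp (s * t%:C))).
  by apply/funext => t; rewrite imM reC imC mul0r addr0.
apply: key => // n nn; rewrite -(lG n nn) im_cint; congr int.
by apply/funext => t; rewrite imM reC imC mul0r addr0.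
Qed.

Lemma uniform_limit_cont (K : R) (g : R -> R) (G : nat -> R -> R) :
  (forall n, continuous (G n)) ->
  (forall n t, `|g t - G n t| <= K * (1 / 2) ^+ n) -> continuous g.
Proof.
move=> cG gG x; apply/cvgrPdist_le => e e0.
have K0 : 0 <= K by have := gG 0%N 0; rewrite expr0 mulr1; exact: le_trans.
have e3 : 0 < e / 3 by rewrite divr_gt0.
pose n := (Num.truncn (K / (e / 3))).+1.
have Kn : K * (1 / 2) ^+ n <= e / 3.
  rewrite expr_div_n expr1n mul1r ler_pdivrMr ?exprn_gt0// mulrC -ler_pdivrMr//.
  by apply: le_trans (expn_lower_bound n); rewrite ltW// truncnS_gt.
have /cvgrPdist_le /(_ _ e3) := cG n x; apply: filterS => y xy.
have := le_trans (gG n x) Kn; have := le_trans (gG n y) Kn.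
by move: xy; rewrite !ler_norml; lra.
Qed.

(** With partial products [W n], the step [W n.+1 - W n = phi n + (W n - 1) * phi n] has at most
    twice the bounds of [phi n] while [W n - 1] has L1 bound 1. The densities of
    [s * (W n.+1 s - W n s)] are summed uniformly to [g], and once a vanishing factor has entered,
    [s * (W n s - 1)] is exactly [- s]. *)
Lemma density_of_products (c eps : R) (T S E : nat -> R) (phi : nat -> R[i] -> R[i]) :
  0 < c -> 0 <= eps ->
  (forall j, 0 <= T j) -> (forall J, \sum_(j < J) T j <= c) ->
  (forall j, S j <= (1 / 2) ^+ j / 4) -> (forall j, E j <= eps * (1 / 2) ^+ j) ->
  (forall j, transform c (T j) (S j) (E j) (phi j)) ->
  exists g, [/\ continuous g, forall t, `|g t| <= 4 * eps,
    forall t, c <= t -> g t = 0, lap c g 0 = 0 &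
    forall j s, phi j s = -1 -> lap c g s = - s].
Proof.
move=> c0 eps0 T0 Tc S4 Eeps tphi.
pose W n s := \prod_(j < n) (1 + phi j s).
pose TT n := \sum_(j < n) T j.
have TT0 n : 0 <= TT n by apply: sumr_ge0.
have TTS n : TT n.+1 = TT n + T n by rewrite /TT big_ord_recr.
have h2 n : 0 <= (1 / 2) ^+ n :> R by rewrite exprn_ge0.
have step a e n : 0 <= a -> a <= 1 -> transform c (TT n) a e (fun s => W n s - 1) ->
    transform c (TT n.+1) (2 * S n) (2 * E n) (fun s => W n.+1 s - W n s).
  move=> a0 a1 tW.
  have TSc : TT n + T n <= c by rewrite -TTS; exact: Tc.
  have tM := transformM c0 (TT0 n) (T0 n) TSc tW (tphi n).
  have le1 : T n <= TT n.+1 by rewrite TTS lerDr.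
  have tp := transformW le1 (lexx _) (lexx _) (tphi n).
  rewrite -TTS in tM.
  have := transformD c0 tp tM.
  have -> : (fun s => phi n s + (W n s - 1) * phi n s) = (fun s => W n.+1 s - W n s).
    by apply/funext => s; rewrite /W big_ord_recr /=; ring.
  have [A [D [[cA _] _ A1 D1 _]]] := tphi n.
  have S0 : 0 <= S n.
    by apply: le_trans A1; apply: int_ge0 => //; [exact: cont_norm|exact: ltW].
  have E0 : 0 <= E n by apply: le_trans (D1 0); exact: normr_ge0.
  apply: transformW; [exact: lexx| |].
    by have : a * S n <= S n by [rewrite ler_piMl|]; lra.
  by have : a * E n <= E n by [rewrite ler_piMl|]; lra.
(* The hypothesis on [S n] gives [2 * S n <= (1/2)^{n+1}], exactly the growth of [1 - (1/2)^n]; this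
   keeps the L1 bound below 1. *)
have tW n : exists e, transform c (TT n) (1 - (1 / 2) ^+ n) e (fun s => W n s - 1).
  elim: n => [|n [e IH]].
    exists 0; rewrite expr0 subrr.
    have -> : (fun s => W 0%N s - 1) = fun=> 0.
      by apply/funext => s; rewrite /W big_ord0 subrr.
    exact: transform0.
  have a0 : 0 <= 1 - (1 / 2) ^+ n :> R.
    by rewrite subr_ge0 exprn_ile1//; lra.
  have a1 : 1 - (1 / 2) ^+ n <= 1 :> R by rewrite gerBl.
  have st := step _ _ _ a0 a1 IH.
  have le1 : TT n <= TT n.+1 by rewrite TTS lerDl.
  have := transformD c0 (transformW le1 (lexx _) (lexx _) IH) st.
  have -> : (fun s => W n s - 1 + (W n.+1 s - W n s)) = (fun s => W n.+1 s - 1).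
    by apply/funext => s; ring.
  move=> h; exists (e + 2 * E n); apply: transformW h; rewrite ?lexx//.
  by have := S4 n; rewrite exprS; lra.
have tS n : transform c c 1 (2 * eps * (1 / 2) ^+ n) (fun s => W n.+1 s - W n s).
  have [e te] := tW n.
  have a0 : 0 <= 1 - (1 / 2) ^+ n :> R by rewrite subr_ge0 exprn_ile1//; lra.
  have a1 : 1 - (1 / 2) ^+ n <= 1 :> R by rewrite gerBl.
  apply: transformW (step _ _ _ a0 a1 te); first exact: Tc.
    have := S4 n; have : (1 / 2) ^+ n <= 1 :> R by rewrite exprn_ile1//; lra.
    by have := h2 n; lra.
  by have := Eeps n; lra.
have /choice[D HD] : forall n, exists d : R -> R, [/\ continuous d,
    supported c d, forall t, `|d t| <= 2 * eps * (1 / 2) ^+ n &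
    forall s, lap c d s = s * (W n.+1 s - W n s)].
  move=> n; have [A [d [[cA cd] [sA sd] A1 D1 L]]] := tS n.
  by exists d; split => // s; have [_] := L s.
pose G n t := \sum_(j < n) D j t.
have GS n : G n.+1 = fun t => G n t + D n t.
  by apply/funext => t; rewrite /G big_ord_recr.
have G0 : G 0%N = fun=> 0 by apply/funext => t; rewrite /G big_ord0.
have cG n : continuous (G n).
  elim: n => [|n IH]; first by rewrite G0; exact: cont_cst.
  by rewrite GS; apply: cont_add => //; have [] := HD n.
have lG n s : lap c (G n) s = s * (W n s - 1).
  elim: n => [|n IH]; first by rewrite G0 lap_cst0 /W big_ord0 subrr mulr0.
  rewrite GS lapD//; last by have [] := HD n.
  have [_ _ _ ->] := HD n; rewrite IH -mulrDr; congr (_ * _); ring.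
have sG n : supported c (G n).
  move=> t tt; rewrite /G big1// => j _; have [_ sD _ _] := HD j; exact: sD.
have th : 0 <= (1 / 2 : R) < 1 by apply/andP; split; lra.
have GD (n : nat) (t : R) : `|G n.+1 t - G n t| <= 2 * eps * (1 / 2) ^+ n * 1.
  by rewrite GS addrAC subrr add0r mulr1; have [_ _ Dn _] := HD n; exact: Dn.
have [g Hg] := geometric_step_limit th GD.
have gG n t : `|g t - G n t| <= 4 * eps * (1 / 2) ^+ n.
  have := Hg n t; rewrite mulr1.
  by have -> : 2 * eps / (1 - 1 / 2) = 4 * eps by field.
have cg : continuous g by exact: uniform_limit_cont cG gG.
exists g; split => //.
- by move=> t; have := gG 0%N t; rewrite G0 subr0 expr0 mulr1.
- move=> t ct; apply/eqP; rewrite -normr_le0; apply/ler_addgt0Pr => e e0; rewrite add0r.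
  pose n := (Num.truncn (4 * eps / e)).+1.
  apply: (@le_trans _ _ (4 * eps * (1 / 2) ^+ n)).
    by have := gG n t; rewrite sG ?subr0//; right.
  rewrite expr_div_n expr1n mul1r ler_pdivrMr ?exprn_gt0// [e * _]mulrC -ler_pdivrMr//.
  by apply: le_trans (expn_lower_bound n); rewrite ltW// truncnS_gt.
- by apply: (lap_limit (n0 := 0%N) c0 cg cG gG) => n _; rewrite lG mul0r.
(* The factor of index [j] occurs in [W n] only from [n = j + 1] on. *)
- move=> j s pj; apply: (lap_limit (n0 := j.+1) c0 cg cG gG) => n jn.
  rewrite lG /W (bigD1 (Ordinal jn)) //= pj subrr mul0r sub0r.
  by rewrite mulrN1.
Qed.

End infinite_product.

(** * Prescribing the zeros *)

Section prescribed_zeros.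
Context {R : realType}.
Implicit Types (s z : R[i]) (L : set R[i]).

Lemma density_of_blocks (ka rho Sg : R) (l : nat -> seq R[i]) :
  0 < ka -> 0 < rho -> 0 <= Sg ->
  (forall j s, s \in l j ->
     [/\ 0 <= re s, `|im s| <= 2 * rho * 2 ^+ j & ka * rho * 2 ^+ j <= re s]) ->
  (forall J, \sum_(j < J) (size (l j))%:R / 2 ^+ j <= Sg) ->
  exists (c e : R) (g : R -> R), [/\ 1 <= c /\ 0 <= e, e * c ^+ 2 * 100 <= 1,
    continuous g /\ (forall y, `|g y| <= e), (forall y, c <= y -> g y = 0) &
    lap c g 0 = 0 /\ forall j s, s \in l j -> lap c g s = - s].
Proof.
move=> ka0 rho0 Sg0 hl hS.
(* With [be j = 2 * rho * 2 ^+ j] the exponent [2 * re s * al / be j] is then at least [4 * 64], and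
   [e^x >= 1 + x] gives the threshold of [block_transform]. *)
pose al := 4 * 64 / ka.
have al0 : 0 <= al by apply: divr_ge0; [exact: mulr_ge0|exact: ltW].
pose be j : R := 2 * rho * 2 ^+ j.
have p0 j : 0 < 2 ^+ j :> R by rewrite exprn_gt0.
have be0 j : 0 < be j by rewrite !mulr_gt0.
pose w := (al + 1) / (2 * rho).
have w0 : 0 <= w by apply: divr_ge0; [exact: addr_ge0|apply: mulr_ge0 => //; exact: ltW].
have tauE j : (al + 1) / be j = w / 2 ^+ j.
  by rewrite /be /w; field; rewrite !lt0r_neq0.
(* Chosen so that the length [c] below, which is affine in [L], satisfies [c <= a * L] for
   [L >= 1]. *)
pose a := 1 + w * (5 * Sg + 12).
have a0 : 0 <= a by rewrite addr_ge0// mulr_ge0// addr_ge0// mulr_ge0.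
(* [C * c ^+ 2 / 2 ^+ L] is the left-hand side of the contraction condition for the bound [4 * eps]
   on [g]. *)
pose C := 100 * (4 * (60 * (8 * rho ^+ 2))).
have C0 : 0 <= C by rewrite /C; have := sqr_ge0 rho; lra.
have [L L3 HL] := exists_large_exponent a0 C0.
pose c := 1 + w * (5 * Sg + 10 + 2 * L%:R).
have c1 : 1 <= c by rewrite lerDl mulr_ge0// !addr_ge0// mulr_ge0.
have c0 : 0 < c by exact: lt_le_trans c1.
have L1 : 1 <= L%:R :> R by rewrite ler1n (leq_trans _ L3).
have caL : c <= a * L%:R.
  have h1 : 0 <= Sg * (L%:R - 1) by apply: mulr_ge0 => //; rewrite subr_ge0.
  have : w * (5 * Sg + 10 + 2 * L%:R) <= w * ((5 * Sg + 12) * L%:R).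
    by apply: ler_wpM2l => //; lra.
  by rewrite /c /a; lra.
pose n j := size (l j).
(* 2 ^ (3 n_j) absorbs the interpolation cost 6 ^ n_j, and 2 ^ (5 j) the factor be_j ^ 2
   ~ 4 ^ j with room for summability; the total length stays finite since n_j / 2 ^ j
   and j / 2 ^ j are summable. *)
pose N j := (3 * n j + 5 * j + L)%N.
pose S j : R := 2 * 6 ^+ n j / 2 ^+ N j.
pose T j : R := (N j + (n j).*2)%:R * ((al + 1) / be j).
have T0 j : 0 <= T j by rewrite /T tauE; apply: mulr_ge0 => //; apply: divr_ge0 => //; exact: ltW.
have TE j : T j = w * (5 * ((n j)%:R / 2 ^+ j) + 5 * (j%:R / 2 ^+ j) + L%:R * 2^-1 ^+ j).
  rewrite /T tauE /N -muln2 !natrD !natrM exprVn; field.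
  exact: lt0r_neq0.
have Tc J : \sum_(j < J) T j <= c.
  rewrite (eq_bigr _ (fun (j : 'I_J) _ => TE j)) -mulr_sumr !big_split /= -!mulr_sumr.
  apply: (@le_trans _ _ (w * (5 * Sg + 5 * 2 + L%:R * 2))).
    apply: ler_wpM2l => //; apply: lerD; last by apply: ler_wpM2l => //; exact: sum_pow2_le.
    by apply: lerD; apply: ler_wpM2l => //; [exact: hS|exact: sum_idx_pow2].
  rewrite /c -[leLHS]add0r lerD// ler_wpM2l//; lra.
have two6 k : 6 ^+ k <= 2 ^+ (3 * k) :> R.
  by rewrite exprM lerXn2r ?nnegrE//; lra.
have S32 j : S j <= 2 / 2 ^+ L * ((1 / 2) ^+ j * (1 / 16) ^+ j).
  rewrite -exprMn.
  have -> : 1 / 2 * (1 / 16) = (2 ^+ 5)^-1 :> R by field.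
  rewrite exprVn -exprM.
  have -> : S j = 2 / 2 ^+ L * ((2 ^+ (5 * j))^-1 * (6 ^+ n j / 2 ^+ (3 * n j))).
    by rewrite /S /N !exprD; field; rewrite !lt0r_neq0.
  apply: ler_wpM2l; first by apply: divr_ge0 => //; exact: ltW.
  apply: ler_piMr; first by rewrite invr_ge0 ltW.
  by rewrite ler_pdivrMr// mul1r.
have hp (x : R) j : 0 <= x <= 1 -> 0 <= x ^+ j <= 1.
  by move=> /andP[x0 x1]; rewrite exprn_ge0//= exprn_ile1.
have L8 : 8 <= 2 ^+ L :> R.
  have -> : 8 = 2 ^+ 3 :> R by ring.
  by apply: ler_weXn2l => //; rewrite ler1n.
have S4 j : S j <= (1 / 2) ^+ j / 4.
  apply: le_trans (S32 j) _.
  have /andP[h1 h2] : 0 <= (1 / 2 : R) ^+ j <= 1 by apply: hp; lra.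
  have /andP[h3 h4] : 0 <= (1 / 16 : R) ^+ j <= 1 by apply: hp; lra.
  have h5 : 2 / 2 ^+ L <= 1 / 4 :> R by rewrite ler_pdivrMr//; lra.
  have h6 : 0 <= 2 / 2 ^+ L :> R by apply: divr_ge0 => //; exact: ltW.
  have -> : (1 / 2) ^+ j / 4 = 1 / 4 * (1 / 2 : R) ^+ j by ring.
  by apply: ler_pM; [exact: h6|exact: mulr_ge0|exact: h5|exact: ler_piMr].
pose eps := 60 * (8 * rho ^+ 2) / 2 ^+ L.
have eps0 : 0 <= eps by apply: divr_ge0; [by have := sqr_ge0 rho; lra|exact: ltW].
pose E j : R := S j * (60 * be j ^+ 2).
have Eeps j : E j <= eps * (1 / 2) ^+ j.
  have b2 : 0 <= 60 * be j ^+ 2 by have := sqr_ge0 (be j); lra.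
  apply: le_trans (ler_wpM2r b2 (S32 j)) _.
  have -> : be j ^+ 2 = 4 * rho ^+ 2 * 4 ^+ j.
    rewrite /be !exprMn -exprM mulnC exprM.
    have -> : 2 ^+ 2 = 4 :> R by ring.
    by [].
  have e4 : (1 / 16) ^+ j * 4 ^+ j = (1 / 4 : R) ^+ j.
    by rewrite -exprMn; congr (_ ^+ _); field.
  have -> : 2 / 2 ^+ L * ((1 / 2) ^+ j * (1 / 16) ^+ j) * (60 * (4 * rho ^+ 2 * 4 ^+ j)) =
     eps * (1 / 2) ^+ j * ((1 / 16) ^+ j * 4 ^+ j) by rewrite /eps; ring.
  rewrite e4; apply: ler_piMr.
    by rewrite mulr_ge0// exprn_ge0.
  by have /andP[] : 0 <= (1 / 4 : R) ^+ j <= 1 by apply: hp; lra.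
have /choice[phi Hphi] : forall j, exists phi : R[i] -> R[i],
    transform c (T j) (S j) (E j) phi /\ forall s, s \in l j -> phi s = - 1.
  move=> j; apply: block_transform => //.
  - by rewrite /N !addn_gt0 (leq_trans _ L3) ?orbT.
  - have := Tc j.+1; rewrite big_ord_recr /=; apply: le_trans.
    by rewrite lerDr sumr_ge0.
  - move=> s sl; have [h1 h2 h3] := hl j s sl; split => //.
    apply: le_trans (expR_ge1Dx _).
    have : ka * rho * 2 ^+ j * (al / be j) <= re s * (al / be j).
      by apply: ler_wpM2r => //; rewrite divr_ge0// ltW.
    have -> : ka * rho * 2 ^+ j * (al / be j) = 2 * 64.
      by rewrite /al /be; field; rewrite !lt0r_neq0.
    by lra.
have [g [cg ge g0 lg0 lgs]] := density_of_products c0 eps0 T0 Tc S4 Eeps (fun j => proj1 (Hphi j)).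
exists c, (4 * eps), g; split => //.
- by split => //; exact: mulr_ge0.
- have -> : 4 * eps * c ^+ 2 * 100 = C * c ^+ 2 / 2 ^+ L by rewrite /eps /C; ring.
  rewrite ler_pdivrMr// mul1r; apply: le_trans HL; apply: ler_wpM2l => //.
  by rewrite lerXn2r ?nnegrE// ?(ltW c0)// mulr_ge0.
- by split => // j s sl; apply: (lgs j); have [_ ->] := Hphi j.
Qed.

Lemma cmodE z : cmod z = Num.sqrt (re z ^+ 2 + im z ^+ 2).
Proof. by case: z. Qed.

Lemma cmod_ge0 z : 0 <= cmod z. Proof. by rewrite cmodE sqrtr_ge0. Qed.

Lemma cmod_sqr z : cmod z ^+ 2 = re z ^+ 2 + im z ^+ 2.
Proof. by rewrite cmodE sqr_sqrtr// addr_ge0// sqr_ge0. Qed.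

Lemma ler_re_cmod z : `|re z| <= cmod z.
Proof. by rewrite cmodE -sqrtr_sqr ler_wsqrtr// lerDl sqr_ge0. Qed.

Lemma ler_im_cmod z : `|im z| <= cmod z.
Proof. by rewrite cmodE -sqrtr_sqr ler_wsqrtr// lerDr sqr_ge0. Qed.

Lemma ler_cmod z : cmod z <= `|re z| + `|im z|.
Proof.
rewrite -(ler_pXn2r (n := 2)) ?nnegrE ?cmod_ge0 ?addr_ge0// cmod_sqr.
rewrite -(real_normK (num_real (re z))) -(real_normK (num_real (im z))) sqrrD.
by rewrite addrAC lerDl mulrn_wge0// mulr_ge0.
Qed.

Lemma locally_finite_gap L : locally_finite L -> (forall z, L z -> 0 < cmod z) ->
  exists2 d : R, 0 < d & forall z, L z -> d <= cmod z.
Proof.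
move=> /(_ 1)/finite_seqP[r rE] pos.
(* Starting the minimum at 1 takes care of the points outside the unit disc. *)
pose d := \big[Num.min/1]_(z <- r | 0 < cmod z) cmod z.
exists d.
  rewrite /d; elim/big_ind: _ => //; first by move=> x y x0 y0; rewrite lt_min x0 y0.
move=> z Lz; have [z1|z1] := leP (cmod z) 1; last first.
  apply: le_trans (ltW z1); rewrite /d; elim/big_rec: _ => // y x _ h.
  by rewrite ge_min h orbT.
have zr : z \in r.
  have : (L `&` [set z | cmod z <= 1]) z by [].
  by rewrite rE.
have z0 := pos z Lz; rewrite /d; elim: r zr {rE d} => // y r IH.
rewrite inE big_cons => /orP[/eqP <-|/IH zr]; first by rewrite z0 ge_min lexx.
by case: ifP => // _; rewrite ge_min zr orbT.
Qed.

Lemma blaschke_finite_sum L (r : seq R[i]) : blaschke L -> uniq r ->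
  (forall z, z \in r -> L z) ->
  \sum_(z <- r) `|im z| / (1 + cmod z ^+ 2) <=
    fine (\esum_(z in L) (`|im z| / (1 + cmod z ^+ 2))%:E).
Proof.
move=> bL ur rL.
have t0 z : (0 <= (`|im z| / (1 + cmod z ^+ 2))%:E)%E.
  by rewrite lee_fin divr_ge0// addr_ge0// sqr_ge0.
rewrite -lee_fin fineK; last first.
  rewrite ge0_fin_numE//; apply: esum_ge0 => z _; exact: t0.
rewrite -sumEFin.
rewrite (fsbig_seq _ _ ur); apply: ereal_sup_ubound.
exists [set` r] => //; split; first exact: finite_seq.
by move=> z; exact: rL.
Qed.

(** The blocks are the annuli [d 2^j <= |z| < d 2^{j+1}], with [d] the distance from the set to the
    origin or smaller. In the cone [- im z] is comparable to [|z|], so each point of block [j]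
    contributes at least a constant times [2^-j] to the Blaschke sum. *)
Lemma blocks_of_set L : L `<=` [set z | im z < 0] -> locally_finite L -> blaschke L ->
  (exists2 C : R, 0 < C & L `<=` [set z | C * `|re z| <= - im z]) ->
  exists (ka rho Sg : R) (l : nat -> seq R[i]), [/\ 0 < ka /\ 0 < rho, 0 <= Sg,
  (forall j s, s \in l j ->
     [/\ 0 <= re s, `|im s| <= 2 * rho * 2 ^+ j & ka * rho * 2 ^+ j <= re s]),
  (forall J, \sum_(j < J) (size (l j))%:R / 2 ^+ j <= Sg) &
  (forall z, L z -> exists j, 'i%C * z + 'i%C * z \in l j)].
Proof.
move=> Llow Lfin bL [C C0 Lcone].
have pos z : L z -> 0 < cmod z.
  move=> /Llow /= z0; apply: lt_le_trans (ler_im_cmod z).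
  by rewrite normr_gt0 lt_eqF.
have [d d0 Ld] := locally_finite_gap Lfin pos.
have p0 j : 0 < 2 ^+ j :> R by rewrite exprn_gt0.
have /choice[b Hb] : forall j : nat, exists r : seq R[i], uniq r /\ forall z,
    (z \in r) <-> [/\ L z, d * 2 ^+ j <= cmod z & cmod z < d * 2 ^+ j.+1].
  move=> j.
  have /finite_seqP[r rE] : finite_set (L `&` [set z | d * 2 ^+ j <= cmod z /\ cmod z < d * 2 ^+ j.+1]).
    apply: sub_finite_set (Lfin (d * 2 ^+ j.+1)) => z [Lz [_ zd]]; split => //=; exact: ltW.
  exists (undup r); split; first exact: undup_uniq.
  move=> z; rewrite mem_undup; split.
    move=> zr; have : [set` r] z by [].
    by rewrite -rE => -[Lz [h1 h2]].
  move=> [Lz h1 h2]; have : (L `&` [set z | d * 2 ^+ j <= cmod z /\ cmod z < d * 2 ^+ j.+1]) z by [].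
  by rewrite rE.
(* In the cone, [C |z| <= C |re z| - C im z <= (1 + C) (- im z)]. *)
pose k0 := C / (1 + C).
have C1 : 0 < 1 + C by rewrite addr_gt0.
have k00 : 0 < k0 by rewrite divr_gt0.
have cone z : L z -> k0 * cmod z <= - im z.
  move=> Lz; have /= h1 := Lcone z Lz; have /= h2 := Llow z Lz.
  rewrite /k0 mulrAC ler_pdivrMr//.
  have := ler_cmod z; rewrite (ltr0_norm h2) => h3.
  have : C * cmod z <= C * (`|re z| + - im z) by rewrite ler_wpM2l// ltW.
  by lra.
pose dbl z := 'i%C * z + 'i%C * z.
have re_dbl z : re (dbl z) = - (2 * im z) by rewrite /dbl !reimE /re /im /=; ring.
have im_dbl z : im (dbl z) = 2 * re z by rewrite /dbl !reimE /re /im /=; ring.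
(* From [|z| >= d] follows [1 + |z|^2 <= (1/d^2 + 1) |z|^2], and one factor [|z|] is at most
   [2 d 2^j] in block [j]; the other cancels against [- im z >= k0 |z|]. *)
pose k2 := k0 / ((1 / d ^+ 2 + 1) * (2 * d)).
have dd : 0 < (1 / d ^+ 2 + 1) * (2 * d).
  by rewrite !mulr_gt0// addr_gt0// divr_gt0// exprn_gt0.
have k20 : 0 < k2 by rewrite divr_gt0.
pose t z : R := `|im z| / (1 + cmod z ^+ 2).
have tk j z : z \in b j -> k2 / 2 ^+ j <= t z.
  move=> /(proj2 (Hb j))[Lz h1 h2]; have z0 := pos z Lz.
  have dz := Ld z Lz.
  have D1 : 1 + cmod z ^+ 2 <= (1 / d ^+ 2 + 1) * cmod z ^+ 2.
    have : 1 <= 1 / d ^+ 2 * cmod z ^+ 2.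
      rewrite div1r mulrC ler_pdivlMr ?exprn_gt0// mul1r.
      by rewrite lerXn2r ?nnegrE// ltW.
    by move=> h; rewrite mulrDl (mul1r (cmod z ^+ 2)) lerD2r.
  have D2 : (1 / d ^+ 2 + 1) * cmod z ^+ 2 <= ((1 / d ^+ 2 + 1) * (2 * d)) * 2 ^+ j * cmod z.
    have -> : ((1 / d ^+ 2 + 1) * (2 * d)) * 2 ^+ j * cmod z = (1 / d ^+ 2 + 1) * (d * 2 ^+ j.+1 * cmod z).
      by rewrite (exprS 2 j); ring.
    apply: ler_wpM2l; first by rewrite addr_ge0// divr_ge0// exprn_ge0// ltW.
    by rewrite expr2; apply: ler_wpM2r => //; exact: ltW.
  have z1 : 0 < 1 + cmod z ^+ 2 by rewrite addr_gt0// exprn_gt0.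
  rewrite /t ler_pdivlMr//.
  apply: (@le_trans _ _ (k2 / 2 ^+ j * (((1 / d ^+ 2 + 1) * (2 * d)) * 2 ^+ j * cmod z))).
    apply: ler_wpM2l; first by rewrite divr_ge0// ltW.
    exact: le_trans D1 D2.
  have -> : k2 / 2 ^+ j * (((1 / d ^+ 2 + 1) * (2 * d)) * 2 ^+ j * cmod z) = k0 * cmod z.
    rewrite /k2; have := lt0r_neq0 dd; set q := _ * (2 * d) => q0.
    by field; rewrite q0 lt0r_neq0.
  have /= h := Llow z Lz.
  by rewrite (ltr0_norm h); exact: cone.
pose M := fine (\esum_(z in L) (`|im z| / (1 + cmod z ^+ 2))%:E).
(* The bound on the moduli keeps the collected points disjoint from the next annulus, so each term
   of the Blaschke sum is used once. *)
have partial J : exists r, [/\ uniq r, (forall z, z \in r -> L z /\ cmod z < d * 2 ^+ J) &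
    k2 * \sum_(j < J) (size (b j))%:R / 2 ^+ j <= \sum_(z <- r) t z].
  elim: J => [|J [r [ur rL rs]]].
    by exists [::]; split => //; rewrite big_ord0 big_nil mulr0.
  exists (r ++ b J); have [ubJ HbJ] := Hb J; split.
  - rewrite cat_uniq ur ubJ andbT /=; apply/hasPn => z /HbJ[_ zJ _].
    by apply/negP => /rL[_]; rewrite ltNge zJ.
  - move=> z; rewrite mem_cat => /orP[/rL[Lz zJ]|/HbJ[Lz _ zJ]]; split => //.
    apply: lt_le_trans zJ _; rewrite ler_pM2l// (exprS 2 J) ler_peMl ?ltW//; lra.
  - rewrite big_ord_recr /= big_cat /= mulrDr; apply: lerD => //.
    have -> : k2 * ((size (b J))%:R / 2 ^+ J) = \sum_(z <- b J) k2 / 2 ^+ J.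
      by rewrite big_const_seq count_predT iter_addr_0 -mulr_natr; ring.
    by rewrite big_seq [leRHS]big_seq; apply: ler_sum => z; exact: tk.
have sumM J : \sum_(j < J) (size (b j))%:R / 2 ^+ j <= M / k2.
  have [r [ur rL rs]] := partial J.
  rewrite ler_pdivlMr// mulrC; apply: le_trans rs _.
  by apply: blaschke_finite_sum => // z /rL[].
(* The point [s = 2iz] has twice the modulus of [z], hence [rho = 2 * d]. *)
exists k0, (2 * d), (M / k2), (fun j => [seq dbl z | z <- b j]); split.
- by split => //; exact: mulr_gt0.
- by have := sumM 0%N; rewrite big_ord0.
- move=> j s /mapP[z /(proj2 (Hb j))[Lz h1 h2] ->].
  have /= zl := Llow z Lz; have hc := cone z Lz.
  rewrite re_dbl im_dbl; split; first by lra.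
    rewrite normrM (ger0_norm (_ : 0 <= (2 : R)))//.
    have := le_lt_trans (ler_re_cmod z) h2; rewrite exprS; lra.
  have : k0 * (d * 2 ^+ j) <= k0 * cmod z by rewrite ler_wpM2l// ltW.
  by lra.
- by move=> J; under eq_bigr do rewrite size_map; exact: sumM.
- move=> z Lz.
  have exJ : exists J, cmod z < d * 2 ^+ J.
    exists (Num.truncn (cmod z / d)).+1; rewrite mulrC -ltr_pdivrMr//.
    apply: lt_le_trans (expn_lower_bound _); exact: truncnS_gt.
  (* The least exponent with [|z| < d 2^J] is positive because [|z| >= d]; its predecessor is the
     index of the block. *)
  have [[|J] zJ Jmin] := ex_minnP exJ.
    by move: zJ; rewrite expr0 mulr1 ltNge Ld.
  exists J; apply/map_f/(proj2 (Hb J)); split => //.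
  by rewrite leNgt; apply/negP => /Jmin; rewrite ltnn.
Qed.

End prescribed_zeros.

Theorem theorem1p1 (R : realType) (Lambda : set R[i])
    (Lambda_lower : Lambda `<=` [set z | im z < 0])
    (Lambda_locally_finite : locally_finite Lambda)
    (Lambda_blaschke : blaschke Lambda)
    (Lambda_cone : exists2 C : R, 0 < C &
       Lambda `<=` [set z | C * `|re z| <= - im z]) :
  exists2 q : R -> R, compactly_supported_L1 q & Lambda `<=` Res q.
Proof.
have [ka [rho [Sg [l [[ka0 rho0] Sg0 hl hS Ll]]]]] :=
  blocks_of_set Lambda_lower Lambda_locally_finite Lambda_blaschke Lambda_cone.
have [c [e [g [[c1 e0] ec [cg ge] g0 [lg0 lgs]]]]] := density_of_blocks ka0 rho0 Sg0 hl hS.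
have [q cq jq] := potential_of_density c1 e0 ec cg ge g0 lg0.
exists q => // z Lz; split; first exact: Lambda_lower.
have [j zj] := Ll z Lz; apply: jq; last exact: lgs zj.
(* The positive lower bound on [re s] excludes [s = 0], where the amplitude identity carries no
   information. *)
have [_ _ h] := hl j _ zj; apply: contraTneq h => ->.
by rewrite -ltNge !mulr_gt0// exprn_gt0.
Qed.
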